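(* Let $D>0$ be a constant, let $\phi=\phi(x)$ be a smooth function on $\mathbb{R}^n$, and let $f_0=f_0(x)$ be a probability density function on $\mathbb{R}^n$. Let $f$ be a solution of $$\frac{\partial f}{\partial t}+\operatorname{div}(f\mathbf{u})=0,\qquad \mathbf{u}=-\nabla\left(D\log f+\phi(x)\right)\quad (x\in\mathbb{R}^n,\ t>0),\qquad f(x,0)=f_0(x)\quad (x\in\mathbb{R}^n).$$ Assume that there is a constant $\lambda>0$ such that $\nabla^2\phi\ge\lambda I$, where $I$ is the identity matrix, and that $F[f_0]<\infty$ and $D_{\mathrm{dis}}[f_0]<\infty$. Then any smooth solution $f$ converges exponentially fast to the equilibrium state $f^{\mathrm{eq}}$: there is a constant $C>0$ depending only on $D$, $F[f^{\mathrm{eq}}]$ and $F[f_0]$ such that $$\|f-f^{\mathrm{eq}}\|_{L^1(\mathbb{R}^n)}\le Ce^{-\lambda t},\qquad t>0.$$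
   Context: $F[f]=\int_{\mathbb{R}^n}\left(Df(\log f-1)+f\phi(x)\right)dx$ is the free energy and $D_{\mathrm{dis}}[f](t)=\int_{\mathbb{R}^n}|\mathbf{u}|^2f\,dx$, so $D_{\mathrm{dis}}[f_0]=\int_{\mathbb{R}^n}|\nabla(D\log f_0+\phi)|^2f_0\,dx$. The equilibrium state is $f^{\mathrm{eq}}(x)=\exp\left(-\frac{\phi(x)-C_0}{D}\right)$, with the constant $C_0$ chosen so that $\int_{\mathbb{R}^n}f^{\mathrm{eq}}\,dx=1$. Solutions are positive, classical, preserve the total mass $\int f\,dx=1$, and are regular enough that all derivatives and integrations involved in the equations and the estimates make sense in the usual sense. *)

(* Defs.v *)
From HB Require Import structures.
From mathcomp Require Import all_boot all_order all_algebra.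
From mathcomp Require Import all_classical all_reals all_analysis.
Set Implicit Arguments.
Unset Strict Implicit.
Unset Printing Implicit Defensive.
Import Order.TTheory GRing.Theory Num.Theory.
Import numFieldNormedType.Exports.
Local Open Scope classical_set_scope.
Local Open Scope ring_scope.

(* R^n is ['rV[R]_n], with the product sigma-algebra: the one generated by the
   coordinate maps (it coincides with the Borel sigma-algebra). *)
Section measurable_rV.
Context {R : realType} (n : nat).

Let coord (i : 'I_n) (x : 'rV[R]_n) : measurableTypeR R := x ord0 i.

Let rV_set0 : g_sigma_preimage coord set0.
Proof. exact: sigma_algebra0. Qed.

Let rV_setC A : g_sigma_preimage coord A -> g_sigma_preimage coord (~` A).
Proof. exact: sigma_algebraC. Qed.

Let rV_bigcup (F : _^nat) : (forall i, g_sigma_preimage coord (F i)) ->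
  g_sigma_preimage coord (\bigcup_i (F i)).
Proof. exact: sigma_algebra_bigcup. Qed.

HB.instance Definition _ := @isMeasurable.Build default_measure_display
  'rV[R]_n (g_sigma_preimage coord) rV_set0 rV_setC rV_bigcup.

Lemma measurable_rV_coord (i : 'I_n) :
  measurable_fun [set: 'rV[R]_n] (fun x => x ord0 i : measurableTypeR R).
Proof.
move=> _ Y mY; rewrite setTI; apply: sub_sigma_algebra => /=.
rewrite -bigcup_seq/=; exists i => /=; first by rewrite mem_index_enum.
by exists Y => //; rewrite setTI.
Qed.

Lemma measurable_fun_rVP d (T : measurableType d) (h : T -> 'rV[R]_n) :
  (forall i, measurable_fun [set: T] (fun x => h x ord0 i : measurableTypeR R)) ->
  measurable_fun [set: T] h.
Proof.
move=> mh _ A; rewrite setTI; move: A.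
have sa : sigma_algebra setT [set A : set 'rV[R]_n | measurable (h @^-1` A)].
  split => /=.
  - by rewrite preimage_set0.
  - by move=> A mA; rewrite setTD preimage_setC; exact: measurableC.
  - by move=> F mF; rewrite preimage_bigcup; exact: bigcupT_measurable.
apply: smallest_sub => //.
rewrite -bigcup_seq; apply: bigcup_sub => i _ A [B mB <-] /=.
by rewrite setTI; have := mh i measurableT B mB; rewrite setTI.
Qed.

End measurable_rV.

Section lebesgue_rV.
Context {R : realType}.

Definition rV_cons n (p : measurableTypeR R * 'rV[R]_n) : 'rV[R]_n.+1 :=
  \row_i oapp (fun j => p.2 ord0 j) p.1 (unlift ord0 i).

Lemma measurable_rV_cons n : measurable_fun setT (@rV_cons n).
Proof.
apply: measurable_fun_rVP => i; case: (unliftP ord0 i) => [j ->|->].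
  under eq_fun do rewrite mxE liftK /=.
  exact: (measurableT_comp (measurable_rV_coord j) measurable_snd).
under eq_fun do rewrite mxE unlift_none /=.
exact: measurable_fst.
Qed.

Section step.
Context n (m : {sigma_finite_measure set 'rV[R]_n -> \bar R}).

Definition lebesgue_rV_step : set 'rV[R]_n.+1 -> \bar R :=
  pushforward (@lebesgue_measure R \x m)%E (@rV_cons n).

Let step0 : lebesgue_rV_step set0 = 0%E.
Proof. by rewrite /lebesgue_rV_step /pushforward preimage_set0 measure0. Qed.

Let step_ge0 A : (0 <= lebesgue_rV_step A)%E.
Proof. by rewrite /lebesgue_rV_step /pushforward measure_ge0. Qed.

Let step_sigma_additive : semi_sigma_additive lebesgue_rV_step.
Proof.
have mcons A : measurable A -> measurable (@rV_cons n @^-1` A).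
  by move=> mA; rewrite -[X in measurable X]setTI; exact: measurable_rV_cons.
move=> F mF tF mUF; rewrite /lebesgue_rV_step /pushforward preimage_bigcup.
apply: measure_semi_sigma_additive.
- by move=> k; exact: mcons.
- apply/trivIsetP => /= i j _ _ ij; rewrite -preimage_setI.
  by move/trivIsetP : tF => /(_ _ _ _ _ ij) ->//; rewrite preimage_set0.
- by rewrite -preimage_bigcup; exact: mcons.
Qed.

HB.instance Definition _ := isMeasure.Build _ _ _
  lebesgue_rV_step step0 step_ge0 step_sigma_additive.

Let step_sigma_finite : sigma_finite setT lebesgue_rV_step.
Proof.
pose uncons (x : 'rV[R]_n.+1) : measurableTypeR R * 'rV[R]_n :=
  (x ord0 ord0, \row_j x ord0 (lift ord0 j)).
have munc : measurable_fun setT uncons.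
  apply: measurable_fun_pair; first exact: measurable_rV_coord.
  apply: measurable_fun_rVP => i; under eq_fun do rewrite mxE.
  exact: measurable_rV_coord.
have consK p : uncons (rV_cons p) = p.
  case: p => x v; rewrite /uncons /rV_cons mxE unlift_none /=; congr pair.
  by apply/rowP => j; rewrite !mxE liftK.
have /sigma_finiteP[F [TF ndF Foo]] := sigma_finiteT (@lebesgue_measure R).
have /sigma_finiteP[G [TG ndG Goo]] := sigma_finiteT m.
exists (fun k => uncons @^-1` (F k `*` G k)).
  apply/esym/seteqP; split => // x _.
  have [i _ Fi] : (\bigcup_k F k) (uncons x).1 by rewrite -TF.
  have [j _ Gj] : (\bigcup_k G k) (uncons x).2 by rewrite -TG.
  exists (maxn i j) => //; split.
  - by move: (uncons x).1 Fi; exact/subsetPset/ndF/leq_maxl.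
  - by move: (uncons x).2 Gj; exact/subsetPset/ndG/leq_maxr.
move=> k; have [mF Fk] := Foo k; have [mG Gk] := Goo k; split.
  by rewrite -[X in measurable X]setTI; apply: munc => //; exact: measurableX.
rewrite /lebesgue_rV_step /pushforward -comp_preimage.
rewrite (_ : _ \o _ = id) ?preimage_id; last by apply/funext => p; exact: consK.
by rewrite product_measure1E// lte_mul_pinfty// ge0_fin_numE.
Qed.

HB.instance Definition _ := Measure_isSigmaFinite.Build _ _ _
  lebesgue_rV_step step_sigma_finite.

End step.

Fixpoint lebesgue_rV n : {sigma_finite_measure set 'rV[R]_n -> \bar R} :=
  match n with
  | 0 => dirac (0 : 'rV[R]_0)
  | n'.+1 => lebesgue_rV_step (lebesgue_rV n')
  end.

Lemma lebesgue_rV_box n (A : 'I_n -> set (measurableTypeR R)) :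
  (forall i, measurable (A i)) ->
  lebesgue_rV n [set x | forall i, A i (x ord0 i)] =
    (\prod_(i < n) lebesgue_measure (A i))%E.
Proof.
elim: n A => [|n IH] A mA.
  rewrite big_ord0 /= diracE mem_set//; by case.
have mB : measurable [set x : 'rV[R]_n | forall i, A (lift ord0 i) (x ord0 i)].
  rewrite (_ : [set x | _] = \bigcap_(i in [set: 'I_n])
      ((fun x : 'rV[R]_n => x ord0 i) @^-1` A (lift ord0 i))).
    apply: fin_bigcap_measurable => // i _.
    by rewrite -[X in measurable X]setTI; exact: measurable_rV_coord.
  by apply/seteqP; split => x /= h i; [move=> _; exact: h|exact: (h i I)].
rewrite big_ord_recl -(IH (fun i => A (lift ord0 i)))//.
rewrite -(product_measure1E lebesgue_measure (lebesgue_rV n) (mA ord0) mB).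
rewrite /= /lebesgue_rV_step /pushforward; congr (_ _).
apply/seteqP; split => -[x v] /=.
  move=> h; split; first by have := h ord0; rewrite mxE unlift_none.
  by move=> i; have := h (lift ord0 i); rewrite mxE liftK.
move=> [hx hv] i; rewrite mxE; case: (unliftP ord0 i) => [j ->|->].
  exact: hv.
exact: hx.
Qed.

End lebesgue_rV.
Arguments lebesgue_rV {R} n.

Section vector_calculus.
Context {R : realType} {n : nat}.
Implicit Types (g : 'rV[R]_n -> R) (x v : 'rV[R]_n) (A B : 'M[R]_n).

(* The squared Euclidean norm: the norm [`|v|] of ['rV[R]_n] in the library is
   the sup norm. *)
Definition sqnorm v : R := \sum_(i < n) v ord0 i ^+ 2.

Definition partial (i : 'I_n) g : 'rV[R]_n -> R := 'D_(delta_mx ord0 i) g.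

Definition gradient g x : 'rV[R]_n := \row_i partial i g x.

Definition divergence (V : 'rV[R]_n -> 'rV[R]_n) x : R :=
  \sum_(i < n) partial i (fun y => V y ord0 i) x.

Definition hessian g x : 'M[R]_n := \matrix_(i, j) partial i (partial j g) x.

(* The order A <= B on symmetric matrices. *)
Definition loewner_le A B : Prop :=
  forall v, (v *m A *m v^T) ord0 ord0 <= (v *m B *m v^T) ord0 ord0.

End vector_calculus.

(* C^infinity on an open set U of a finite-dimensional space: all iterated
   directional derivatives exist and are continuous on U. *)
Definition smooth_on {R : realType} {V : normedModType R} (U : set V)
    (g : V -> R) : Prop :=
  forall (vs : seq V) (x : V), U x ->
    let h := foldr (fun v k => 'D_v k) g vs in
    {for x, continuous h} /\ forall v, derivable h x v.

Section fokker_planck.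
Context {R : realType} {n : nat}.
Implicit Types (D : R) (phi g : 'rV[R]_n -> R) (f : 'rV[R]_n -> R -> R).

Definition is_density g : Prop :=
  [/\ measurable_fun setT g, (forall x, 0 <= g x) &
      (\int[lebesgue_rV n]_x (g x)%:E = 1)%E].

Definition velocity D phi g (x : 'rV[R]_n) : 'rV[R]_n :=
  - gradient (fun y => D * ln (g y) + phi y) x.

Definition energy_density D phi g (x : 'rV[R]_n) : R :=
  D * g x * (ln (g x) - 1) + g x * phi x.

Definition free_energy D phi g : \bar R :=
  (\int[lebesgue_rV n]_x (energy_density D phi g x)%:E)%E.

Definition dissipation D phi g : \bar R :=
  (\int[lebesgue_rV n]_x (sqnorm (velocity D phi g x) * g x)%:E)%E.

Definition equilibrium D phi (C0 : R) (x : 'rV[R]_n) : R := expR (- ((phi x - C0) / D)).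

(* Positive classical solutions of unit mass.  For t > 0 the equation involves
   only values of f at positive times; values at t < 0 are irrelevant. *)
Record classical_solution D phi (f0 : 'rV[R]_n -> R) f : Prop := ClassicalSolution {
  sol_smooth : smooth_on [set p : 'rV[R]_n * R | 0 < p.2] (fun p => f p.1 p.2) ;
  sol_continuous : {within [set p : 'rV[R]_n * R | 0 <= p.2],
    continuous (fun p => f p.1 p.2)} ;
  sol_positive : forall x (t : R), 0 <= t -> 0 < f x t ;
  sol_equation : forall x (t : R), 0 < t ->
    derive1 (f x) t +
      divergence (fun y => f y t *: velocity D phi (f ^~ t) y) x = 0 ;
  sol_initial : forall x, f x 0 = f0 x ;
  sol_mass : forall t : R, 0 <= t -> (\int[lebesgue_rV n]_x (f x t)%:E = 1)%E }.

(* "All derivatives and integrations make sense in the usual sense": f0 may be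
   differentiated in the formula for its dissipation; at positive times the free
   energy and the dissipation are convergent integrals and the free energy may be
   differentiated in t under the integral sign (local domination); and the free
   energy is continuous at t = 0. *)
Record regular_solution D phi (f0 : 'rV[R]_n -> R) f : Prop := RegularSolution {
  reg_initial : forall x, differentiable f0 x ;
  reg_energy : forall t : R, 0 < t ->
    (lebesgue_rV n).-integrable setT (EFin \o energy_density D phi (f ^~ t)) ;
  reg_dissipation : forall t : R, 0 < t -> (dissipation D phi (f ^~ t) < +oo)%E ;
  reg_derivative : forall t : R, 0 < t -> exists e : R, exists G : 'rV[R]_n -> R,
    [/\ 0 < e, (lebesgue_rV n).-integrable setT (EFin \o G) &
      forall x s, `|s - t| < e ->
        `|derive1 (fun r => energy_density D phi (f ^~ r) x) s| <= G x] ;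
  reg_energy0 :
    free_energy D phi (f ^~ t) @[t --> 0^'+] --> free_energy D phi f0 }.

End fokker_planck.

(* Main.v *)
Require Import Defs.
From mathcomp Require Import all_boot all_order all_algebra.
From mathcomp Require Import all_classical all_reals all_analysis.
From mathcomp Require Import measurable_realfun ring lra.

(** Along the flow the free energy is dissipated at the rate
    [Dis = \int |grad mu|^2 f] with [mu = D log f + phi].  Since nothing is known
    about [mu ^ 2 f], this identity is obtained by testing the equation against
    a bounded truncation of [mu] times a spatial cutoff: the boundary term is
    then controlled by [\int (1 + |grad mu|^2) f] alone.  The convexity of [phi]
    yields the logarithmic Sobolev inequality [F - F_eq <= Dis / (2 lambda)],
    which is derived from the Prekopa-Leindler inequality following Bobkov and
    Ledoux: applied to [e^(g / (1 - s)) p] and [p], it gives the inequality to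
    first order in [s].  Hence [F - F_eq] decays like [e^(- 2 lambda t)] by
    Gronwall's lemma, and it controls the squared L^1 distance. *)

Set Implicit Arguments.
Unset Strict Implicit.
Unset Printing Implicit Defensive.
Import Order.TTheory GRing.Theory Num.Theory.
Import numFieldNormedType.Exports.
Local Open Scope classical_set_scope.
Local Open Scope ring_scope.

(** * The Prekopa-Leindler inequality *)

(** At a positive time the hypotheses give an integrable energy density, a finite dissipation and a
    local bound on the time derivative of the energy density; no decay of [f] or of its derivatives
    at infinity is given, so the integration by parts needs a cutoff. For the same reason the
    logarithmic Sobolev inequality is proved at a frozen time: differentiating the dissipation along
    the flow would require more regularity. In Prekopa-Leindler, the strong convexity of
    [V = (phi - C0) / D] appears as a quadratic penalty, and one must bound the supremum of [g]
    minus this penalty. This is done only for bounded [g] with bounded and uniformly continuous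
    gradient. A density [h] relative to [exp (- V)] is therefore first replaced by
    [cutoff d * h + d], whose logarithm has these properties, and then [d] tends to [0]. The free
    energy of the equilibrium is [C0 - D], and [(F - (C0 - D)) / D] is the relative entropy. The L^1
    distance is at most [a / 2] times this entropy plus [2 / a] for every [a > 0]; the choice
    [a = exp (lambda t)] turns the rate [2 lambda] of the entropy into [lambda]. *)

Section brunn_minkowski_1d.
Context {R : realType}.
Local Notation leb := (@lebesgue_measure R).

Lemma measurable_affine (r a : R) :
  measurable_fun setT ((fun x => r * x + a) : measurableTypeR R -> measurableTypeR R).
Proof.
by apply: measurable_funD => //; exact: measurable_funM.
Qed.

(** Lebesgue measure is determined by its values on half-open intervals, and [r] times its image
    under [x |-> r * x + a] has the same values there. *)
Lemma lebesgue_measure_affine (r a : R) (A : set (measurableTypeR R)) : 0 < r ->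
  measurable A ->
  leb [set x | A (r * x + a)] = ((r^-1)%:E * leb A)%E.
Proof.
move=> r0 mA.
have rE : (0 <= r)%R := ltW r0.
pose U (x : measurableTypeR R) : measurableTypeR R := r * x + a.
have mU : measurable_fun setT U by exact: measurable_affine.
pose m (X : set (measurableTypeR R)) := (r%:E * leb [set x | X (r * x + a)%R])%E.
have -> : leb A = m A.
  have -> : m A = mscale (NngNum rE) (pushforward leb U) A by [].
  apply: lebesgue_measure_unique => // X [[c d] /= _ <-].
  rewrite /mscale/= /pushforward /U.
  change (_ @^-1` _) with [set x : R | `]c, d]%classic (r * x + a)].
  have -> : [set x : R | `]c, d]%classic (r * x + a)] = `](c - a) / r, (d - a) / r]%classic.
    apply/seteqP; split => x /=; rewrite !in_itv/= ltr_pdivrMr// ler_pdivlMr//; lra.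
  rewrite !lebesgue_measure_itv/= !lte_fin ltr_pM2r ?invr_gt0//.
  rewrite ltrD2r; case: ifPn => _; last by rewrite mule0.
  by rewrite -!EFinB -EFinM; congr EFin; field; rewrite gt_eqF.
by rewrite /m muleA -EFinM mulVf ?mul1e ?gt_eqF.
Qed.


Lemma lebesgue_measure_scale (r a : R) (A : set (measurableTypeR R)) : 0 < r ->
  measurable A ->
  leb [set x | A ((x - a) / r)] = (r%:E * leb A)%E.
Proof.
move=> r0 mA; rewrite -{2}(invrK r) -(@lebesgue_measure_affine r^-1 (- a / r))//.
  by congr (leb _); apply/seteqP; split => x /=; rewrite mulrBl mulNr (mulrC x).
by rewrite invr_gt0.
Qed.

Lemma measurable_scale (r a : R) (A : set (measurableTypeR R)) :
  measurable A -> measurable [set x | A ((x - a) / r)].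
Proof.
move=> mA; have := measurable_affine r^-1 (- a / r) measurableT mA.
rewrite setTI => mm.
rewrite [X in measurable X](_ : _ = (fun x => r^-1 * x + - a / r) @^-1` A)//.
by apply/seteqP; split => x /=; rewrite mulrBl mulNr (mulrC x).
Qed.

(* The sets [r A + q b0] and [r a0 + q B], with [a0] close to [sup A] and [b0]
   close to [inf B], both lie in [C] and overlap in a short interval only. *)
Lemma brunn_minkowski_bounded (r q M : R) (A B C : set (measurableTypeR R)) :
  0 < r -> 0 < q -> measurable A -> measurable B -> measurable C ->
  (forall x, A x -> `|x| <= M) -> (forall x, B x -> `|x| <= M) ->
  A !=set0 -> B !=set0 ->
  (forall x y, A x -> B y -> C (r * x + q * y)) ->
  (r%:E * leb A + q%:E * leb B <= leb C)%E.
Proof.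
move=> r0 q0 mA mB mC bA bB A0 B0 ABC.
have supA : has_sup A.
  by split => //; exists M => x /bA; rewrite ler_norml => /andP[].
have infB : has_inf B.
  by split => //; exists (- M) => x /bB; rewrite ler_norml => /andP[].
apply/lee_addgt0Pr => e e0.
(* With these tolerances the two halves of the interval [I], namely [r * (sup A - a0)] and
   [q * (b0 - inf B)], have length at most [e / 2] each. *)
have er : 0 < e / (2 * r) by rewrite divr_gt0// mulr_gt0.
have eq_ : 0 < e / (2 * q) by rewrite divr_gt0// mulr_gt0.
have [a0 Aa0 Ha0] := sup_adherent er supA.
have [b0 Bb0 Hb0] := inf_adherent eq_ infB.
pose A' := [set x | A ((x - q * b0) / r)].
pose B' := [set x | B ((x - r * a0) / q)].
have mA' : measurable A' by exact: measurable_scale.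
have mB' : measurable B' by exact: measurable_scale.
have subC : A' `|` B' `<=` C.
  move=> x [Ax|Bx].
    have := ABC _ _ Ax Bb0; congr (C _); field; lra.
  have := ABC _ _ Aa0 Bx; congr (C _); field; lra.
pose I := `[r * a0 + q * inf B, r * sup A + q * b0]%classic.
have subI : A' `&` B' `<=` I.
  move=> x [Ax Bx]; rewrite /I/= in_itv/=; apply/andP; split.
    have := ge_inf infB.2 Bx; rewrite ler_pdivlMr//; lra.
  have := ub_le_sup supA.2 Ax; rewrite ler_pdivrMr//; lra.
have Ie : (leb I <= e%:E)%E.
  rewrite lebesgue_measure_itv/= lte_fin; case: ifPn => _; last by rewrite lee_fin ltW.
  rewrite -EFinB lee_fin.
  have h1 : r * (sup A - a0) <= e / 2.
    rewrite mulrC -ler_pdivlMr//.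
    apply: (@le_trans _ _ (e / (2 * r))); first lra.
    by rewrite invfM mulrA.
  have h2 : q * (b0 - inf B) <= e / 2.
    rewrite mulrC -ler_pdivlMr//.
    apply: (@le_trans _ _ (e / (2 * q))); first lra.
    by rewrite invfM mulrA.
  lra.
rewrite -(lebesgue_measure_scale (q * b0) r0 mA) -(lebesgue_measure_scale (r * a0) q0 mB).
rewrite -/A' -/B'.
have mAB : measurable (A' `&` B') by exact: measurableI.
have -> : leb A' = (leb (A' `\` B') + leb (A' `&` B'))%E.
  exact: measureDI.
rewrite addeAC -measureU//; last 2 first.
- exact: measurableD.
- by rewrite setDE -setIA setICl setI0.
apply: leeD.
  apply: le_measure; rewrite ?inE//.
    by apply: measurableU => //; exact: measurableD.
  by apply: subset_trans subC => x [[]|]; [left|right].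
apply: le_trans Ie; apply: le_measure; rewrite ?inE//.
exact: measurable_itv.
Qed.

(** Truncation of [A] and [B] to [[- k, k]], with the same [C], and continuity of the measure from
    below. The points [a] and [b] keep both truncations nonempty for large [k]; the inequality fails
    for an empty factor. *)
Lemma brunn_minkowski_R (r q : R) (A B C : set (measurableTypeR R)) :
  0 < r -> 0 < q -> measurable A -> measurable B -> measurable C ->
  A !=set0 -> B !=set0 ->
  (forall x y, A x -> B y -> C (r * x + q * y)) ->
  (r%:E * leb A + q%:E * leb B <= leb C)%E.
Proof.
move=> r0 q0 mA mB mC [a Aa] [b Bb] ABC.
pose J k : set (measurableTypeR R) := `[- k%:R, k%:R]%classic.
have mJ k : measurable (J k) by exact: measurable_itv.
have JP k x : J k x <-> `|x| <= k%:R by rewrite /J/= in_itv/= ler_norml.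
have cv (D : set (measurableTypeR R)) : measurable D ->
    leb (D `&` J k) @[k --> \oo] --> leb D.
  move=> mD; have {2}-> : D = \bigcup_k (D `&` J k).
    apply/seteqP; split => [x Dx|x [k _ []]//].
    exists (Num.trunc `|x|).+1 => //; split => //; apply/JP.
    by rewrite ltW// truncnS_gt.
  apply: nondecreasing_cvg_mu.
  - by move=> k; exact: measurableI.
  - by apply: bigcupT_measurable => k; exact: measurableI.
  - move=> i j ij; apply/subsetPset => x [Dx /JP xi]; split => //.
    by apply/JP/(le_trans xi); rewrite ler_nat.
have cvAB : (r%:E * leb (A `&` J k) + q%:E * leb (B `&` J k))%E @[k --> \oo] -->
    (r%:E * leb A + q%:E * leb B)%E.
  apply: cvgeD.
  - by apply: ge0_adde_def; rewrite inE mule_ge0 ?lee_fin ?(ltW r0) ?(ltW q0).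
  - by apply: cvgeZl => //; exact: cv.
  - by apply: cvgeZl => //; exact: cv.
rewrite -(cvg_lim _ cvAB)//; apply: lime_le; first by apply/cvg_ex; eexists; exact: cvAB.
near=> k.
have ka : `|a| <= k%:R by near: k; exact: nbhs_infty_ger.
have kb : `|b| <= k%:R by near: k; exact: nbhs_infty_ger.
apply: (@brunn_minkowski_bounded r q k%:R) => //; try exact: measurableI.
- by move=> x [_ /JP].
- by move=> x [_ /JP].
- by exists a; split => //; exact/JP.
- by exists b; split => //; exact/JP.
- by move=> x y [Ax _] [By _]; exact: ABC.
Unshelve. all: by end_near. Qed.

End brunn_minkowski_1d.

(** * Prekopa-Leindler on the line, by integrating Brunn-Minkowski over the level sets *)

Section prekopa_leindler.
Context {R : realType}.
Local Notation leb := (@lebesgue_measure R).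

(* The pointwise hypothesis [F x ^ (1 - s) * G y ^ s <= H ((1 - s) x + s y)] is
   expressed on the real numbers below [F x] and [G y], so that infinite values
   need no special treatment. *)
Definition geomean (s a b : R) : R := expR ((1 - s) * ln a + s * ln b).

Lemma geomeanZ s a b t : 0 < a -> 0 < b -> 0 < t ->
  geomean s (a * t) (b * t) = geomean s a b * t.
Proof.
move=> a0 b0 t0; rewrite /geomean !lnM ?posrE// -[in RHS](lnK t0) -expRD.
by congr expR; ring.
Qed.

Lemma geomean_gt0 s a b : 0 < geomean s a b.
Proof. exact: expR_gt0. Qed.

(** The tangent line of the exponential at [w], the weighted mean of the logarithms, bounds each of
    [a] and [b] from below; in the weighted sum the linear terms cancel. *)
Lemma geomean_le s a b : 0 < s < 1 -> 0 < a -> 0 < b ->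
  geomean s a b <= (1 - s) * a + s * b.
Proof.
move=> /andP[s0 s1] a0 b0; set P := geomean s a b.
set u := ln a; set v := ln b; set w := (1 - s) * u + s * v.
have P0 : 0 < P := geomean_gt0 s a b.
have E c : 0 < c -> P * (1 + (ln c - w)) <= c.
  move=> c0; rewrite -[leRHS](lnK c0) -{2}(subrK w (ln c)) expRD mulrC.
  by rewrite ler_wpM2r ?expR_ge0// expR_ge1Dx.
have := E _ a0; have := E _ b0; rewrite -/u -/v => Eb Ea.
have -> : P = (1 - s) * (P * (1 + (u - w))) + s * (P * (1 + (v - w))).
  by rewrite /w; ring.
by apply: lerD; apply: ler_wpM2l => //; lra.
Qed.

(** The subgraph of [F / M] between the heights [0] and [1], as a set in the plane so that Tonelli
    exchanges its horizontal and vertical slices. The strict version is for the two factors and the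
    large one for [H], as dictated by the inequalities in the pointwise hypothesis. *)
Let sect (F : measurableTypeR R -> \bar R) (M : R) :
    set (measurableTypeR R * measurableTypeR R) :=
  [set p | 0 < p.2 < 1 /\ ((M * p.2)%:E < F p.1)%E].
Let csect (F : measurableTypeR R -> \bar R) (M : R) :
    set (measurableTypeR R * measurableTypeR R) :=
  [set p | 0 < p.2 < 1 /\ ((M * p.2)%:E <= F p.1)%E].

Let measurable_strip :
  measurable [set p : measurableTypeR R * measurableTypeR R | 0 < p.2 < 1].
Proof.
rewrite (_ : [set p | _] = snd @^-1` `]0, 1[%classic).
  by rewrite -[X in measurable X]setTI; apply: measurable_snd => //; exact: measurable_itv.
by apply/seteqP; split => p /=; rewrite in_itv.
Qed.

Let measurable_line (M : R) :
  measurable_fun setT (fun p : measurableTypeR R * measurableTypeR R => (M * p.2)%:E).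
Proof.
apply/measurable_EFinP; apply: measurable_funM => //; exact: measurable_snd.
Qed.

Let measurable_sect F M : measurable_fun setT F -> measurable (sect F M).
Proof.
move=> mF; rewrite (_ : sect F M = [set p | 0 < p.2 < 1] `&`
  (setT `&` [set p | ((M * p.2)%:E < F p.1)%E])); last by rewrite setTI.
apply: measurableI => //; apply: emeasurable_fun_lt => //.
exact: (measurableT_comp mF measurable_fst).
Qed.

Let measurable_csect F M : measurable_fun setT F -> measurable (csect F M).
Proof.
move=> mF; rewrite (_ : csect F M = [set p | 0 < p.2 < 1] `&`
  (setT `&` [set p | ((M * p.2)%:E <= F p.1)%E])); last by rewrite setTI.
apply: measurableI => //; apply: emeasurable_fun_le => //.
exact: (measurableT_comp mF measurable_fst).
Qed.

Let cavalieri (S : set (measurableTypeR R * measurableTypeR R)) : measurable S ->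
  (\int[leb]_t leb (ysection S t) = \int[leb]_x leb (xsection S x))%E.
Proof.
move=> mS.
have mI : measurable_fun setT (fun p => (\1_S p)%:E : \bar R).
  by apply/measurable_EFinP; exact: measurable_indic.
have I0 p : (0 <= (\1_S p)%:E :> \bar R)%E by rewrite lee_fin.
have := fubini_tonelli (m1 := leb) (m2 := leb) _ mI I0.
under eq_integral => x _.
  rewrite (_ : (fun y => _) = (fun y => (\1_(xsection S x) y)%:E)); last first.
    by apply/funext => y; rewrite !indicE mem_xsection.
  rewrite integral_indic ?setIT//; last exact: measurable_xsection.
  over.
move=> ->; apply: eq_integral => y _.
rewrite (_ : (fun x => _) = (fun x => (\1_(ysection S y) x)%:E)); last first.
  by apply/funext => x; rewrite !indicE mem_ysection.
by rewrite integral_indic ?setIT//; exact: measurable_ysection.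
Qed.


(** As [F <= M], the strip loses nothing and the vertical slice over [x] is the whole interval from
    [0] to [F x / M]. *)
Let integral_sect F M : 0 < M -> measurable_fun setT F -> (forall x, (0 <= F x)%E) ->
  (forall x, (F x <= M%:E)%E) ->
  (\int[leb]_t leb (ysection (sect F M) t) = (M^-1)%:E * \int[leb]_x F x)%E.
Proof.
move=> M0 mF F0 FM; rewrite cavalieri; last exact: measurable_sect.
rewrite -ge0_integralZl//; last by rewrite lee_fin invr_ge0 ltW.
apply: eq_integral => x _.
have Fx : F x = (fine (F x))%:E.
  by rewrite fineK// ge0_fin_numE// (le_lt_trans (FM x))// ltry.
have := F0 x; have := FM x; rewrite Fx !lee_fin; set c := fine _ => cM c0.
have cM1 : c / M <= 1 by rewrite ler_pdivrMr// mul1r.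
rewrite (_ : xsection _ x = `]0, (c / M)[%classic).
  rewrite lebesgue_measure_itv/= lte_fin.
  rewrite -EFinM (mulrC M^-1); case: ifPn; first by rewrite oppr0 adde0.
  rewrite -leNgt => h; congr EFin; apply/le_anti.
  by rewrite h divr_ge0// ltW.
apply/seteqP; split => t; rewrite /xsection/= inE /sect/= in_itv/= Fx lte_fin -/c.
  by move=> [/andP[-> _]]/=; rewrite ltr_pdivlMr// mulrC.
move=> /andP[-> h]; rewrite (lt_le_trans h cM1); split => //.
by rewrite mulrC -ltr_pdivlMr.
Qed.

(** Only an inequality, since here [F] may exceed [M] or be infinite, and the strip discards the
    heights above [1]. *)
Let integral_csect F M : 0 < M -> measurable_fun setT F -> (forall x, (0 <= F x)%E) ->
  (M%:E * \int[leb]_t leb (ysection (csect F M) t) <= \int[leb]_x F x)%E.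
Proof.
move=> M0 mF F0; rewrite cavalieri; last exact: measurable_csect.
have mS : measurable_fun setT (fun x => leb (xsection (csect F M) x)).
  by apply: measurable_fun_xsection; exact: measurable_csect.
rewrite -ge0_integralZl ?lee_fin ?(ltW M0)//.
apply: ge0_le_integral => //.
- by move=> x _; rewrite mule_ge0// lee_fin ltW.
- exact: emeasurable_funM.
move=> x _.
case Fx : (F x) => [c| |]; last 2 first.
- by rewrite leey.
- by have := F0 x; rewrite Fx.
have c0 : 0 <= c by have := F0 x; rewrite Fx lee_fin.
have cM0 : 0 <= c / M by rewrite divr_ge0// ltW.
have Lx : (M%:E * leb (xsection (csect F M) x) <= M%:E * leb `[0%R, (c / M)%R]%classic)%E.
  apply: lee_wpmul2l; first by rewrite lee_fin ltW.
  apply: le_measure; rewrite ?inE.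
  - by apply: measurable_xsection; exact: measurable_csect.
  - exact: measurable_itv.
  move=> t; rewrite /xsection/= inE /csect/= in_itv/= Fx lee_fin.
  by move=> [/andP[/ltW -> _]]/=; rewrite ler_pdivlMr// mulrC.
apply: le_trans Lx _.
rewrite lebesgue_measure_itv/= lte_fin; case: ifPn => _; last by rewrite mule0 lee_fin.
by rewrite oppr0 adde0 -EFinM mulrCA divff ?mulr1// gt_eqF.
Qed.

Definition pl_hyp (V : lmodType R) s (F G H : V -> \bar R) :=
  forall x y a b, 0 < a -> 0 < b -> (a%:E < F x)%E -> (b%:E < G y)%E ->
    ((geomean s a b)%:E <= H ((1 - s) *: x + s *: y)%R)%E.

(** Dividing each factor by its own supremum makes the level sets at every height [0 < t < 1]
    nonempty for both, as Brunn-Minkowski requires. Integration over [t] gives the arithmetic mean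
    of the normalised integrals, and [geomean_le] turns it into the geometric one; the factor
    [geomean s M N] undoes the normalisation. *)
Let pl_bounded s F G H M N : 0 < s < 1 -> 0 < M -> 0 < N ->
  measurable_fun setT F -> measurable_fun setT G -> measurable_fun setT H ->
  (forall x, (0 <= F x)%E) -> (forall x, (0 <= G x)%E) -> (forall x, (0 <= H x)%E) ->
  ereal_sup (range F) = M%:E -> ereal_sup (range G) = N%:E ->
  (forall x y a b, 0 < a -> 0 < b -> (a%:E < F x)%E -> (b%:E < G y)%E ->
    ((geomean s a b)%:E <= H ((1 - s) * x + s * y)%R)%E) ->
  forall a b, 0 < a -> 0 < b -> (a%:E < \int[leb]_x F x)%E ->
    (b%:E < \int[leb]_x G x)%E -> ((geomean s a b)%:E <= \int[leb]_x H x)%E.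
Proof.
move=> /[dup] s01 /andP[s0 s1] M0 N0 mF mG mH F0 G0 H0 sF sG FGH a b a0 b0 aF bG.
set P := geomean s M N; have P0 : 0 < P := geomean_gt0 s M N.
have FM x : (F x <= M%:E)%E by rewrite -sF; apply: ereal_sup_ubound; exists x.
have GN x : (G x <= N%:E)%E by rewrite -sG; apply: ereal_sup_ubound; exists x.
have q0 : 0 < 1 - s by lra.
have key t : ((1 - s)%:E * leb (ysection (sect F M) t) +
    s%:E * leb (ysection (sect G N) t) <= leb (ysection (csect H P) t))%E.
  have [t01|t01] := boolP (0 < t < 1); last first.
    have E (K : measurableTypeR R -> \bar R) L : ysection (sect K L) t = set0.
      apply/seteqP; split => // x; rewrite /ysection/= inE => -[/= t01'].
      by rewrite t01' in t01.
    by rewrite !E measure0 !mule0 adde0.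
  have /andP[t0 t1] := t01.
  have ne (K : measurableTypeR R -> \bar R) L : 0 < L ->
      ereal_sup (range K) = L%:E -> ysection (sect K L) t !=set0.
    move=> L0 sK; have : ((L * t)%:E < ereal_sup (range K))%E.
      by rewrite sK lte_fin; nra.
    by move=> /ereal_sup_gt[_ [x _ <-]] h; exists x; rewrite /ysection/= inE.
  apply: brunn_minkowski_R => //.
  - by apply: measurable_ysection; exact: measurable_sect.
  - by apply: measurable_ysection; exact: measurable_sect.
  - by apply: measurable_ysection; exact: measurable_csect.
  - exact: ne.
  - exact: ne.
  move=> x y; rewrite /ysection/= !inE => -[/= _ Fx] [/= _ Gy]; split => //=.
  by rewrite -geomeanZ//; apply: FGH => //; rewrite mulr_gt0.
have step : ((1 - s)%:E * ((M^-1)%:E * \int[leb]_x F x) +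
    s%:E * ((N^-1)%:E * \int[leb]_x G x) <=
    \int[leb]_t leb (ysection (csect H P) t))%E.
  have mSF : measurable_fun setT (fun t => leb (ysection (sect F M) t)).
    by apply: measurable_fun_ysection; exact: measurable_sect.
  have mSG : measurable_fun setT (fun t => leb (ysection (sect G N) t)).
    by apply: measurable_fun_ysection; exact: measurable_sect.
  rewrite -(integral_sect M0)// -(integral_sect N0)//.
  rewrite -ge0_integralZl ?lee_fin ?(ltW q0)//.
  rewrite -ge0_integralZl ?lee_fin ?(ltW s0)//.
  have mSF' : measurable_fun setT (fun t => (1 - s)%:E * leb (ysection (sect F M) t))%E.
    exact: emeasurable_funM.
  have mSG' : measurable_fun setT (fun t => s%:E * leb (ysection (sect G N) t))%E.
    exact: emeasurable_funM.
  have SF0 t : (0 <= (1 - s)%:E * leb (ysection (sect F M) t))%E.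
    by rewrite mule_ge0// lee_fin ltW.
  have SG0 t : (0 <= s%:E * leb (ysection (sect G N) t))%E.
    by rewrite mule_ge0// lee_fin ltW.
  rewrite -ge0_integralD//; apply: ge0_le_integral => //.
  - by move=> t _; rewrite adde_ge0.
  - exact: emeasurable_funD.
  - by apply: measurable_fun_ysection; exact: measurable_csect.
apply: le_trans (integral_csect P0 mH H0).
apply: (@le_trans _ _ (P%:E * ((1 - s)%:E * ((M^-1)%:E * a%:E) +
    s%:E * ((N^-1)%:E * b%:E)))%E); last first.
  apply: lee_wpmul2l; first by rewrite lee_fin ltW.
  apply: le_trans step; apply: leeD; do 2 (apply: lee_wpmul2l;
    first by rewrite lee_fin ?invr_ge0 ltW); exact: ltW.
rewrite -!EFinM lee_fin.
have -> : geomean s a b = P * geomean s (M^-1 * a) (N^-1 * b).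
  rewrite /P /geomean -expRD; congr expR.
  by rewrite !lnM ?posrE ?invr_gt0// !lnV ?posrE//; ring.
rewrite ler_pM2l//; apply: geomean_le => //; by rewrite mulr_gt0 ?invr_gt0.
Qed.

Let lt_integral_min (F : measurableTypeR R -> \bar R) (c : R) :
  measurable_fun setT F -> (forall x, (0 <= F x)%E) ->
  (c%:E < \int[leb]_x F x)%E ->
  exists k : nat, (c%:E < \int[leb]_x (mine (F x) k%:R%:E))%E.
Proof.
move=> mF F0 cF.
have cvF x : mine (F x) k%:R%:E @[k --> \oo] --> F x.
  case Fx : (F x) => [r| |]; last by have := F0 x; rewrite Fx.
    apply: cvg_near_cst; near=> k; apply/eqP; rewrite min_l// lee_fin.
    by near: k; exact: nbhs_infty_ger.
  rewrite [X in X @ _](_ : _ = (fun k : nat => k%:R%:E)); last first.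
    by apply/funext => k; rewrite min_r// leey.
  by apply/cvgenyP.
have mm k : measurable_fun setT (fun x => mine (F x) k%:R%:E).
  exact: measurable_mine.
have m0 k x : (0 <= mine (F x) k%:R%:E)%E.
  by rewrite le_min F0 lee_fin ler0n.
have nd x : nondecreasing_seq (fun k : nat => mine (F x) k%:R%:E).
  move=> i j ij; rewrite le_min ge_min lexx/= ge_min lee_fin ler_nat ij orbT//.
have := @cvg_monotone_convergence _ _ _ leb _ measurableT
  (fun k x => mine (F x) k%:R%:E) mm (fun k x _ => m0 k x) (fun x _ => nd x).
rewrite (_ : (\int[leb]_x _)%E = \int[leb]_x F x)%E; last first.
  by apply: eq_integral => x _; apply/cvg_lim => //; exact: cvF.
move=> cv; have : \forall k \near \oo, (c%:E < \int[leb]_x (mine (F x) k%:R%:E))%E.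
  exact: (cv [set u | (c%:E < u)%E] (open_ereal_gt' cF)).
by move=> [k _ /(_ k (leqnn _)) h]; exists k.
Unshelve. all: by end_near. Qed.

Let sup_fin (F : measurableTypeR R -> \bar R) (c k : R) : 0 < c ->
  measurable_fun setT F -> (forall x, (0 <= F x <= k%:E)%E) ->
  (c%:E < \int[leb]_x F x)%E ->
  exists2 M : R, 0 < M & ereal_sup (range F) = M%:E.
Proof.
move=> c0 mF F0 cF.
have F00 x : (0 <= F x)%E by have /andP[] := F0 x.
have sk : (ereal_sup (range F) <= k%:E)%E.
  by apply: ge_ereal_sup => _ [x _ <-]; have /andP[] := F0 x.
have [x Fx] : exists x, (0 < F x)%E.
  apply: contrapT => /forallNP h; move: cF.
  rewrite integral0_eq; first by rewrite lte_fin ltNge ltW.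
  move=> x _; apply/eqP; rewrite eq_le F00 andbT leNgt; exact/negP/h.
have s0 : (0 < ereal_sup (range F))%E.
  by apply: (lt_le_trans Fx); apply: ereal_sup_ubound; exists x.
exists (fine (ereal_sup (range F))).
  by rewrite fine_gt0// s0 (le_lt_trans sk)// ltry.
by rewrite fineK// gt0_fin_numE// (le_lt_trans sk)// ltry.
Qed.

(** The hypothesis speaks only of reals below the values of [F] and [G], so it survives truncation
    of both at finite heights; these are chosen so large that the integrals still exceed [a] and
    [b]. *)
Lemma prekopa_leindler_R s (F G H : measurableTypeR R -> \bar R) : 0 < s < 1 ->
  measurable_fun setT F -> measurable_fun setT G -> measurable_fun setT H ->
  (forall x, (0 <= F x)%E) -> (forall x, (0 <= G x)%E) -> (forall x, (0 <= H x)%E) ->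
  (forall x y a b, 0 < a -> 0 < b -> (a%:E < F x)%E -> (b%:E < G y)%E ->
    ((geomean s a b)%:E <= H ((1 - s) * x + s * y)%R)%E) ->
  forall a b, 0 < a -> 0 < b -> (a%:E < \int[leb]_x F x)%E ->
    (b%:E < \int[leb]_x G x)%E -> ((geomean s a b)%:E <= \int[leb]_x H x)%E.
Proof.
move=> s01 mF mG mH F0 G0 H0 FGH a b a0 b0 aF bG.
have [k ak] := lt_integral_min mF F0 aF.
have [l bl] := lt_integral_min mG G0 bG.
have mFk : measurable_fun setT (fun x => mine (F x) k%:R%:E) by exact: measurable_mine.
have mGl : measurable_fun setT (fun x => mine (G x) l%:R%:E) by exact: measurable_mine.
have Fk x : (0 <= mine (F x) k%:R%:E <= k%:R%:E)%E.
  by rewrite le_min F0 lee_fin ler0n ge_min lexx orbT.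
have Gl x : (0 <= mine (G x) l%:R%:E <= l%:R%:E)%E.
  by rewrite le_min G0 lee_fin ler0n ge_min lexx orbT.
have [M M0 sM] := sup_fin a0 mFk Fk ak.
have [N N0 sN] := sup_fin b0 mGl Gl bl.
apply: (pl_bounded s01 M0 N0 mFk mGl mH _ _ _ sM sN) => //.
- by move=> x; have /andP[] := Fk x.
- by move=> x; have /andP[] := Gl x.
- move=> x y c d c0 d0; rewrite !lt_min => /andP[cF _] /andP[dG _].
  exact: FGH.
Qed.

End prekopa_leindler.

(** * Prekopa-Leindler in every dimension, by induction on the coordinates *)

Section integral_rV.
Context {R : realType} (n : nat).
Local Notation leb := (@lebesgue_measure R).
Implicit Type F : 'rV[R]_n.+1 -> \bar R.

Lemma ge0_integral_rVS F : measurable_fun setT F -> (forall x, (0 <= F x)%E) ->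
  (\int[lebesgue_rV n.+1]_x F x =
   \int[leb]_x \int[lebesgue_rV n]_v F (rV_cons (x, v)))%E.
Proof.
move=> mF F0.
have mFc : measurable_fun setT (F \o @rV_cons R n).
  exact: measurableT_comp (@measurable_rV_cons R n).
rewrite -(fubini_tonelli1 (m1 := leb) (m2 := lebesgue_rV n) (F \o @rV_cons R n))//; last first.
  by move=> p; exact: F0.
have := @ge0_integral_pushforward _ _ _ _ R _ (@measurable_rV_cons R n)
  (leb \x lebesgue_rV n)%E setT F measurableT mF (fun x _ => F0 x).
by rewrite preimage_setT.
Qed.

Lemma measurable_marginal F : measurable_fun setT F -> (forall x, (0 <= F x)%E) ->
  measurable_fun setT (fun x => \int[lebesgue_rV n]_v F (rV_cons (x, v)))%E.
Proof.
move=> mF F0.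
have mFc : measurable_fun setT (F \o @rV_cons R n).
  exact: measurableT_comp (@measurable_rV_cons R n).
apply: (measurable_fun_fubini_tonelli_F (m2 := lebesgue_rV n) (F \o @rV_cons R n)) => // p; exact: F0.
Qed.

End integral_rV.

Lemma rV_consD {R : realType} n (a b x y : R) (v w : 'rV[R]_n) :
  rV_cons (a * x + b * y, a *: v + b *: w) =
  a *: rV_cons (x, v) + b *: rV_cons (y, w) :> 'rV[R]_n.+1.
Proof.
apply/rowP => i; rewrite !mxE; case: (unliftP ord0 i) => [j _|_] //=.
by rewrite !mxE.
Qed.

(** Conclusion and hypothesis have the same shape: the induction hypothesis, applied to the sections
    at first coordinates [x] and [y], is the one-dimensional hypothesis for the marginals. In
    dimension [0] the measure is a Dirac mass. *)
Theorem prekopa_leindler {R : realType} n s (F G H : 'rV[R]_n -> \bar R) :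
  0 < s < 1 ->
  measurable_fun setT F -> measurable_fun setT G -> measurable_fun setT H ->
  (forall x, (0 <= F x)%E) -> (forall x, (0 <= G x)%E) -> (forall x, (0 <= H x)%E) ->
  pl_hyp s F G H ->
  forall a b, 0 < a -> 0 < b -> (a%:E < \int[lebesgue_rV n]_x F x)%E ->
    (b%:E < \int[lebesgue_rV n]_x G x)%E ->
    ((geomean s a b)%:E <= \int[lebesgue_rV n]_x H x)%E.
Proof.
move=> s01; elim: n F G H => [|n IH] F G H mF mG mH F0 G0 H0 FGH a b a0 b0.
  rewrite /= !integral_dirac// !diracE !mem_set// !mul1e => aF bG.
  by have := FGH 0 0 a b a0 b0 aF bG; rewrite !scaler0 addr0.
rewrite !ge0_integral_rVS//.
apply: prekopa_leindler_R => //; try exact: measurable_marginal.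
- by move=> x; exact: integral_ge0.
- by move=> x; exact: integral_ge0.
- by move=> x; exact: integral_ge0.
move=> x y {a0 b0}c d c0 d0.
have msec (K : 'rV[R]_n.+1 -> \bar R) z : measurable_fun setT K ->
    measurable_fun setT (fun v => K (rV_cons (z, v))).
  move=> mK; apply: (measurableT_comp mK).
  exact: (measurableT_comp (@measurable_rV_cons R n) (measurable_pair1 z)).
apply: IH => //; try exact: msec.
move=> v w c' d' c0' d0' cF dG; rewrite rV_consD; exact: FGH.
Qed.

(** * Calculus on R^n *)

Section measurable_continuous_rV.
Context {R : realType} {n : nat}.
Implicit Types (g : 'rV[R]_n -> R) (x y : 'rV[R]_n).

Lemma ball_rVP x (e : R) y : 0 < e ->
  ball x e y <-> forall i, `|x ord0 i - y ord0 i| < e.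
Proof.
move=> e0; split => [[_ h] i|h]; first exact: h.
by split => // i j; rewrite (ord1 i); exact: h.
Qed.

Lemma measurable_box (q : 'I_n -> R) (e : R) :
  measurable [set x : 'rV[R]_n | forall i, `|q i - x ord0 i| < e].
Proof.
rewrite (_ : [set x | _] = \bigcap_(i in [set: 'I_n])
    ((fun x : 'rV[R]_n => x ord0 i) @^-1` ball (q i) e)).
  apply: fin_bigcap_measurable => // i _.
  rewrite -[X in measurable X]setTI.
  exact: (measurable_rV_coord i measurableT (measurable_ball (q i) e)).
by apply/seteqP; split => x /= h i; [move=> _; exact: h|exact: (h i I)].
Qed.

(** The sigma-algebra is generated by the coordinates, so an open set is written as the countable
    union of the boxes with rational centre and radius [1 / (k + 1)] that it contains. *)
Lemma measurable_open_rV (U : set 'rV[R]_n) : open U -> measurable U.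
Proof.
move=> oU.
pose B (p : {ffun 'I_n -> rat} * nat) :=
  [set x : 'rV[R]_n | forall i, `|ratr (p.1 i) - x ord0 i| < p.2.+1%:R^-1].
have -> : U = \bigcup_(p in [set p | B p `<=` U]) B p.
  apply/seteqP; split => [x Ux|x [p /= pU Bx]]; last exact: pU.
  have /nbhs_ballP[e /= e0 xeU] : nbhs x U by exact: open_nbhs_nbhs.
  have [k ke] : exists k : nat, k.+1%:R^-1 < e / 2.
    exists (Num.trunc (e / 2)^-1).
    by rewrite invf_plt ?posrE ?divr_gt0// truncnS_gt.
  have k0 : 0 < k.+1%:R^-1 :> R by rewrite invr_gt0.
  have /choice[q qP] i : exists q : rat, `|ratr q - x ord0 i| < k.+1%:R^-1.
    have [q] := @rat_in_itvoo R (x ord0 i) (x ord0 i + k.+1%:R^-1) ltac:(by rewrite ltrDl).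
    rewrite in_itv/= => /andP[q1 q2]; exists q.
    by rewrite ger0_norm ?subr_ge0 ?ltW// ltrBlDl.
  exists ([ffun i => q i], k); last by move=> i; rewrite /= ffunE.
  move=> y /= By; apply: xeU; apply/ball_rVP => // i.
  have := lt_trans (By i) ke; rewrite /= ffunE => qy; have := lt_trans (qP i) ke.
  rewrite distrC => qx.
  rewrite -(subrK (ratr (q i)) (x ord0 i)) -addrA.
  by apply: (le_lt_trans (ler_normD _ _)); lra.
rewrite bigcup_mkcond; apply: countable_bigcupT_measurable.
  exact: countableP.
by move=> p; case: ifPn => // _; exact: measurable_box.
Qed.

Lemma continuous_measurable_rV g : continuous g -> measurable_fun setT g.
Proof.
move=> /continuousP cg; apply: (measurability _ (RGenOInfty.measurableE R)) => //.
move=> /= _ [_ [a ->] <-]; rewrite setTI; apply: measurable_open_rV.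
by apply: cg; exact: interval_open.
Qed.

(** Compactness yields a common [d] on the cube of half-side [N + 1]. Since also [d < 1], a point
    outside this cube and its neighbours within [d] all lie where [g] vanishes. *)
Lemma unif_continuous_rV (N e : R) g : 0 < e -> continuous g ->
  (forall x, (exists i, N <= `|x ord0 i|) -> g x = 0) ->
  exists2 d, 0 < d &
    forall x y, (forall i, `|x ord0 i - y ord0 i| < d) -> `|g x - g y| < e.
Proof.
move=> e0 cg g0.
pose A := [set x : 'rV[R]_n | forall i, `[- (N + 1), N + 1]%classic (x ord0 i)].
have cA : compact A.
  by apply: (@rV_compact R n (fun _ => `[- (N + 1), N + 1]%classic)) => _; exact: segment_compact.
pose P (d : R) x := forall y, (forall i, `|x ord0 i - y ord0 i| < d) -> `|g x - g y| < e.
have : \forall d \near 0^'+, A `<=` P d.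
  move: cA => /compact_near_coveringP; apply => x _.
  have /cvgrPdist_lt/(_ (e / 2)) := cg x.
  rewrite divr_gt0// => /(_ erefl)/nbhs_ballP[r /= r0 hr].
  exists (ball x (r / 2), [set d | d < r / 2]) => /=.
    split; first by apply: nbhsx_ballx; rewrite divr_gt0.
    by apply: nbhs_right_lt; rewrite divr_gt0.
  move=> [x' d] /= [xx' dr] y xy.
  have r20 : 0 < r / 2 by rewrite divr_gt0.
  have h1 : `|g x - g x'| < e / 2.
    by apply: hr; apply: le_ball xx'; lra.
  have h2 : `|g x - g y| < e / 2.
    apply: hr; apply/ball_rVP => // i.
    have := (ball_rVP _ _ r20).1 xx' i; have := xy i => a b.
    rewrite -(subrK (x' ord0 i) (x ord0 i)) -addrA.
    by apply: (le_lt_trans (ler_normD _ _)); lra.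
  rewrite -(subrK (g x) (g x')) -addrA.
  by apply: (le_lt_trans (ler_normD _ _)); rewrite distrC; lra.
move=> hd.
have [d [d0 d1 dP]] : exists d, [/\ 0 < d, d < 1 & A `<=` P d].
  near (0:R)^'+ => d; exists d; split; first by [].
    by near: d; exact: nbhs_right_lt.
  by near: d.
exists d => // x y xy.
have [Ax|/existsNP[i nAx]] := pselect (A x); first exact: dP.
have xN : N + 1 <= `|x ord0 i|.
  rewrite leNgt; apply/negP => /ltW; rewrite ler_norml => h.
  by apply: nAx; rewrite /= in_itv.
have yN : N <= `|y ord0 i|.
  have := xy i; have := ler_normD (x ord0 i - y ord0 i) (y ord0 i).
  rewrite subrK; lra.
rewrite !g0 ?subrr ?normr0//; exists i => //; lra.
Unshelve. all: by end_near. Qed.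

End measurable_continuous_rV.

(** * Functions with continuous partial derivatives *)

Section C1.
Context {R : realType} {n : nat}.
Implicit Types (g h : 'rV[R]_n -> R) (dg dh : 'I_n -> 'rV[R]_n -> R).
Implicit Types (x y v : 'rV[R]_n).
Local Notation e_ i := (delta_mx ord0 i : 'rV[R]_n).

Lemma is_derive_lineP g x v (t d : R) :
  is_derive (t *: v + x) v g d <-> is_derive t 1 (fun k : R => g (k *: v + x)) d.
Proof.
have E : (fun h : R => h^-1 *: (g (h *: v + (t *: v + x)) - g (t *: v + x))) =
         (fun h : R => h^-1 *: (g ((h *: 1 + t) *: v + x) - g (t *: v + x))).
  by apply/funext => h; rewrite scalerDl [h *: 1]mulr1 addrA.
by split => -[]; rewrite /derivable /derive => H <-; apply: DeriveDef;
  rewrite /derivable /derive/=; rewrite ?E// -?E.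
Qed.

Lemma is_derive_comp_dir g x v (k : R -> R) (d dk : R) :
  is_derive x v g d -> is_derive (g x) 1 k dk ->
  is_derive x v (k \o g) (dk * d).
Proof.
move=> gd kd.
have : is_derive (0 *: v + x) v g d by rewrite scale0r add0r.
move/is_derive_lineP => gd0.
have kd' : is_derive (g (0 *: v + x)) 1 k dk by rewrite scale0r add0r.
have := @is_derive1_comp _ k (fun t : R => g (t *: v + x)) 0 dk d kd' gd0.
by move/(is_derive_lineP (k \o g) x v 0); rewrite scale0r add0r.
Qed.

(** The partial derivatives are an explicit family, so that each closure rule also produces the
    formula that enters the integrals later on. *)
Record C1 g dg : Prop := MkC1 {
  C1_continuous : continuous g ;
  C1_derive : forall x i, is_derive x (e_ i) g (dg i x) ;
  C1_dcontinuous : forall i, continuous (dg i) }.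

Lemma C1_partial g dg i : C1 g dg -> partial i g = dg i.
Proof. by move=> [_ h _]; apply/funext => x; rewrite /partial; exact: derive_val. Qed.

Lemma C1_eq g h dg dh : g =1 h -> (forall i x, dg i x = dh i x) -> C1 g dg -> C1 h dh.
Proof.
move=> /funext <- E; suff -> : dg = dh by [].
by apply/funext => i; apply/funext => x.
Qed.

Lemma C1_cst (c : R) : C1 (fun=> c) (fun _ _ => 0).
Proof.
split => [x|x i|i x]; [exact: cst_continuous|exact: (is_derive_cst c x (e_ i))|exact: cst_continuous].
Qed.

Lemma C1D g h dg dh : C1 g dg -> C1 h dh ->
  C1 (fun x => g x + h x) (fun i x => dg i x + dh i x).
Proof.
move=> [a b c] [a' b' c']; split => [x|x i|i x].
- exact: (cvgD (a x) (a' x)).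
- exact: (is_deriveD (b x i) (b' x i)).
- exact: (cvgD (c i x) (c' i x)).
Qed.

Lemma C1M g h dg dh : C1 g dg -> C1 h dh ->
  C1 (fun x => g x * h x) (fun i x => g x * dh i x + h x * dg i x).
Proof.
move=> [a b c] [a' b' c']; split => [x|x i|i x].
- exact: (cvgM (a x) (a' x)).
- exact: (is_deriveM (b x i) (b' x i)).
- exact: (cvgD (cvgM (a x) (c' i x)) (cvgM (a' x) (c i x))).
Qed.

Lemma C1_comp g dg (k dk : R -> R) : C1 g dg ->
  (forall x, is_derive (g x) 1 k (dk (g x))) ->
  (forall x, {for g x, continuous dk}) ->
  C1 (k \o g) (fun i x => dk (g x) * dg i x).
Proof.
move=> [a b c] kd kc; split => [x|x i|i x].
- apply: continuous_comp; first exact: a.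
  by apply: differentiable_continuous; apply/derivable1_diffP; exact: ex_derive.
- exact: is_derive_comp_dir.
- exact: (cvgM (continuous_comp (a x) (kc x)) (c i x)).
Qed.

Lemma C1Z (c : R) g dg : C1 g dg -> C1 (fun x => c * g x) (fun i x => c * dg i x).
Proof.
move=> gC; have := C1M (C1_cst c) gC; apply: C1_eq => // i x.
by rewrite mulr0 addr0.
Qed.

Lemma C1_coord j : C1 (fun x => x ord0 j) (fun i _ => (i == j)%:R).
Proof.
split => [x|x i|i x]; last exact: cst_continuous.
  exact: coord_continuous.
rewrite -[x in is_derive x](add0r x) -(scale0r (e_ i)); apply/is_derive_lineP.
rewrite (_ : (fun k : R => _) = (id * cst (i == j)%:R + cst (x ord0 j))).
  apply: is_derive_eq; rewrite addr0 scaler0 add0r.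
  exact: mulr1.
by apply/funext => k /=; rewrite !mxE eqxx/= (eq_sym j).
Qed.

Lemma C1_sum (I : Type) (r : seq I) (g : I -> 'rV[R]_n -> R)
    (dg : I -> 'I_n -> 'rV[R]_n -> R) : (forall j, C1 (g j) (dg j)) ->
  C1 (fun x => \sum_(j <- r) g j x) (fun i x => \sum_(j <- r) dg j i x).
Proof.
move=> H; elim: r => [|j r IH].
  apply: (@C1_eq (fun=> 0) _ (fun _ _ => 0)); last exact: C1_cst.
    by move=> x; rewrite big_nil.
  by move=> i x; rewrite big_nil.
have := C1D (H j) IH; apply: C1_eq => [x|i x]; by rewrite big_cons.
Qed.

Lemma C1_sqnorm : C1 sqnorm (fun i x => 2 * x ord0 i).
Proof.
have := C1_sum (index_enum _) (fun j => C1M (C1_coord j) (C1_coord j)).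
apply: C1_eq => [x|i x].
  by apply: eq_bigr => j _; rewrite expr2.
rewrite (bigD1 i)//= big1 ?addr0 => [|j ji]; rewrite ?eqxx ?mulr1 ?mulr2n ?mulrDl ?mul1r//.
by rewrite eq_sym (negbTE ji) mulr0 addr0.
Qed.

End C1.
Arguments C1_continuous {R n g dg} _ x.
Arguments C1_derive {R n g dg} _ x i.
Arguments C1_dcontinuous {R n g dg} _ i x.

Section mean_value.
Context {R : realType} {n : nat}.
Implicit Types (g : 'rV[R]_n -> R) (dg : 'I_n -> 'rV[R]_n -> R).
Implicit Types (x y z v : 'rV[R]_n).
Local Notation e_ i := (delta_mx ord0 i : 'rV[R]_n).

Lemma mvt_step (h dh : R -> R) (d : R) :
  (forall t : R, is_derive t 1 h (dh t)) ->
  exists2 c, `|c| <= `|d| & h d - h 0 = dh c * d.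
Proof.
move=> hd.
have hc a b : {within `[a, b], continuous h}.
  apply: continuous_subspaceT => t.
  by apply/differentiable_continuous/derivable1_diffP; have [] := hd t.
have [d0|d0] := leP 0 d.
  have [c] := @MVT_segment R h dh 0 d d0 (fun t _ => hd t) (hc _ _).
  rewrite in_itv/= subr0 => /andP[c0 cd] E; exists c => //.
  by rewrite !ger0_norm.
have [c] := @MVT_segment R h dh d 0 (ltW d0) (fun t _ => hd t) (hc _ _).
rewrite in_itv/= sub0r => /andP[dc c0] E; exists c.
  by rewrite !ler0_norm ?(ltW d0)// lerN2.
by rewrite -opprB E mulrN opprK.
Qed.

(* Moving from [z] to [x] one coordinate at a time. *)
Lemma mvt_rV g dg : (forall x i, is_derive x (e_ i) g (dg i x)) -> forall x z,
  exists2 xi : 'I_n -> 'rV[R]_n,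
    (forall i j, `|xi i ord0 j - z ord0 j| <= `|x ord0 j - z ord0 j|) &
    g x - g z = \sum_i dg i (xi i) * (x ord0 i - z ord0 i).
Proof.
move=> gd x z.
pose w (m : nat) : 'rV[R]_n := \row_j (if (j < m)%N then x ord0 j else z ord0 j).
have step (i : 'I_n) : exists xi : 'rV[R]_n,
    (forall j, `|xi ord0 j - z ord0 j| <= `|x ord0 j - z ord0 j|) /\
    g (w i.+1) - g (w i) = dg i xi * (x ord0 i - z ord0 i).
  have hd (t : R) : is_derive t 1 (fun k : R => g (k *: e_ i + w i)) (dg i (t *: e_ i + w i)).
    by apply/is_derive_lineP; exact: gd.
  have [c cle E] := mvt_step (x ord0 i - z ord0 i) hd.
  exists (c *: e_ i + w i); split.
    move=> j; rewrite !mxE eqxx/=; have [->|ji] := eqVneq j i.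
      by rewrite ltnn mulr1 addrK.
    by rewrite mulr0 add0r; case: ifPn => // _; rewrite subrr normr0.
  rewrite -E scale0r add0r; congr (g _ - _).
  apply/rowP => j; rewrite !mxE eqxx/= ltnS; have [->|ji] := eqVneq j i.
    by rewrite leqnn ltnn mulr1 subrK.
  by rewrite mulr0 add0r leq_eqVlt -(inj_eq val_inj) in ji * ; rewrite (negbTE ji).
have /choice[xi xiP] := step.
exists xi => [i j|]; first by have [] := xiP i.
under eq_bigr => i _ do rewrite -(xiP i).2.
rewrite -(big_mkord xpredT (fun i => g (w i.+1) - g (w i))) telescope_sumr//.
by congr (g _ - g _); apply/rowP => j; rewrite !mxE ?ltn_ord.
Qed.

(** The intermediate points of [mvt_rV] stay in the box spanned by [x] and [h *: v + x], so
    continuity of the partial derivatives replaces them by [x] in the limit. *)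
Lemma C1_is_derive g dg x v : C1 g dg ->
  is_derive x v g (\sum_i v ord0 i * dg i x).
Proof.
move=> [gc gd gdc].
suff H : h^-1 *: (g (h *: v + x) - g x) @[h --> (0:R)^'] --> \sum_i v ord0 i * dg i x.
  by apply: DeriveDef; [exact: cvgP H|exact: cvg_lim H].
pose S := \sum_i `|v ord0 i|.
have S0 : 0 <= S by rewrite sumr_ge0.
apply/cvgrPdist_le => e e0.
(* [S] is the sum of the [|v_i|], which weight the errors; the [+ 1] covers [v = 0]. *)
have e'0 : 0 < e / (S + 1) by rewrite divr_gt0// ltr_wpDl.
have : \forall y \near x, forall i, `|dg i x - dg i y| <= e / (S + 1).
  apply: (@filter_forall _ _ (fun i y => `|dg i x - dg i y| <= e / (S + 1)) (nbhs x)) => i.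
  by have /cvgrPdist_le := gdc i x; apply.
move=> /nbhs_ballP[r /= r0 hr].
have cv : h *: v + x @[h --> (0:R)] --> x.
  have {2}-> : x = 0 *: v + x by rewrite scale0r add0r.
  exact: (cvgD (@scalel_continuous _ _ v 0) (cvg_cst x)).
have xb : \forall h \near (0:R), ball x r (h *: v + x).
  exact: (cv (ball x r) (nbhsx_ballx _ _ r0)).
near=> h.
have h0 : h != 0 by near: h; exact: nbhs_dnbhs_neq.
have hb : ball x r (h *: v + x) by near: h; exact: nbhs_dnbhs.
have [xi xiP ->] := mvt_rV gd (h *: v + x) x.
rewrite /GRing.scale/= mulr_sumr -sumrB.
apply: (le_trans (ler_norm_sum _ _ _)).
apply: (@le_trans _ _ (\sum_i `|v ord0 i| * (e / (S + 1)))).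
  apply: ler_sum => i _; rewrite !mxE addrK.
  rewrite (_ : _ - _ = v ord0 i * (dg i x - dg i (xi i))); last by field.
  rewrite normrM.
  apply: ler_wpM2l => //; apply: hr; apply/ball_rVP => // j.
  rewrite distrC; apply: (le_lt_trans (xiP i j)).
  by rewrite distrC; have /ball_rVP := hb; apply.
rewrite -mulr_suml -/S mulrC -mulrA ger_pMr// ler_pdivrMl ?mulr1 ?ltr_wpDl//.
by rewrite lerDl.
Unshelve. all: by end_near. Qed.

End mean_value.

Section strong_convexity.
Context {R : realType} {n : nat}.
Implicit Types (x y v : 'rV[R]_n).

Lemma convex_chord (q dq : R -> R) (s : R) :
  (forall t : R, is_derive t 1 q (dq t)) ->
  (forall a b, a <= b -> dq a <= dq b) -> 0 <= s <= 1 ->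
  q s <= (1 - s) * q 0 + s * q 1.
Proof.
move=> qd dqm /andP[s0 s1].
have qc a b : {within `[a, b], continuous q}.
  apply: continuous_subspaceT => t.
  by apply/differentiable_continuous/derivable1_diffP; have [] := qd t.
have [a] := @MVT_segment R q dq 0 s s0 (fun t _ => qd t) (qc _ _).
rewrite in_itv/= => /andP[_ as_] Ea.
have [b] := @MVT_segment R q dq s 1 s1 (fun t _ => qd t) (qc _ _).
rewrite in_itv/= => /andP[sb _] Eb.
have ab := dqm a b (le_trans as_ sb).
have h : (1 - s) * (q s - q 0) <= s * (q 1 - q s).
  rewrite Ea Eb subr0 (mulrC (dq b)) mulrCA (mulrC (dq a)) !mulrA (mulrC (1 - s)).
  by apply: ler_wpM2l => //; rewrite mulr_ge0// subr_ge0.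
rewrite -subr_ge0.
have -> : (1 - s) * q 0 + s * q 1 - q s = s * (q 1 - q s) - (1 - s) * (q s - q 0) by ring.
by rewrite subr_ge0.
Qed.

(** Along the segment, [phi] minus [lambda / 2 * |v|^2 * t^2] has a nondecreasing derivative and
    lies below its chord. The gap [s - s^2] between [t^2] and its own chord is the factor
    [s * (1 - s)]. *)
Lemma strong_convexity phi (dphi : 'I_n -> 'rV[R]_n -> R)
    (ddphi : 'I_n -> 'I_n -> 'rV[R]_n -> R) (lambda : R) :
  C1 phi dphi -> (forall j, C1 (dphi j) (ddphi^~ j)) ->
  (forall x v, lambda * sqnorm v <=
    \sum_i \sum_j v ord0 i * v ord0 j * ddphi i j x) ->
  forall s x y, 0 <= s <= 1 ->
    phi ((1 - s) *: x + s *: y) <= (1 - s) * phi x + s * phi y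
      - lambda / 2 * (s * (1 - s)) * sqnorm (x - y).
Proof.
move=> phiC dphiC hess s x y s01.
pose v := y - x.
pose q (t : R) := phi (t *: v + x) - lambda / 2 * sqnorm v * t ^+ 2.
pose dq (t : R) := \sum_i v ord0 i * dphi i (t *: v + x) - lambda * sqnorm v * t.
pose ddq (t : R) := \sum_j v ord0 j * (\sum_i v ord0 i * ddphi i j (t *: v + x))
  - lambda * sqnorm v.
have qd (t : R) : is_derive t 1 q (dq t).
  have h1 : is_derive t 1 (fun k : R => phi (k *: v + x))
      (\sum_i v ord0 i * dphi i (t *: v + x)).
    by apply/is_derive_lineP; exact: C1_is_derive.
  have h2 : is_derive t 1 (cst (lambda / 2 * sqnorm v) * (id ^+ 2) : R -> R)
      (lambda * sqnorm v * t).
    apply: is_derive_eq; rewrite scaler0 addr0 expr1 /GRing.scale/= mulr1.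
    by field.
  exact: (is_deriveB h1 h2).
have dqd (t : R) : is_derive t 1 dq (ddq t).
  have h1 j : is_derive t 1 (fun k : R => v ord0 j * dphi j (k *: v + x))
      (v ord0 j * (\sum_i v ord0 i * ddphi i j (t *: v + x))).
    have h : is_derive t 1 (fun k : R => dphi j (k *: v + x))
        (\sum_i v ord0 i * ddphi i j (t *: v + x)).
      by apply/is_derive_lineP; exact: (C1_is_derive _ _ (dphiC j)).
    have := is_deriveZ (v ord0 j) h; exact.
  have h2 : is_derive t 1 (cst (lambda * sqnorm v) * id : R -> R) (lambda * sqnorm v).
    by apply: is_derive_eq; rewrite scaler0 addr0 /GRing.scale/= mulr1.
  suff -> : dq = (\sum_j (fun k : R => v ord0 j * dphi j (k *: v + x)))
      - (cst (lambda * sqnorm v) * id) by exact: (is_deriveB (is_derive_sum h1) h2).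
  by apply/funext => k; rewrite /dq !fctE fct_sumE.
have dqm a b : a <= b -> dq a <= dq b.
  move=> ab; have dqc : {within `[a, b], continuous dq}.
    apply: continuous_subspaceT => t.
    by apply/differentiable_continuous/derivable1_diffP; have [] := dqd t.
  have [c _ E] := @MVT_segment R dq ddq a b ab (fun t _ => dqd t) dqc.
  rewrite -subr_ge0 E mulr_ge0 ?subr_ge0//; apply: (le_trans (hess (c *: v + x) v)).
  rewrite exchange_big/=; rewrite le_eqVlt; apply/orP; left; apply/eqP; apply: eq_bigr => j _.
  rewrite mulr_sumr; apply: eq_bigr => i _; ring.
have := convex_chord qd dqm s01.
rewrite /q scale0r add0r scale1r subrK.
have -> : s *: v + x = (1 - s) *: x + s *: y.
  by apply/rowP => i; rewrite !mxE; ring.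
have -> : sqnorm (x - y) = sqnorm v.
  by apply: eq_bigr => i _; rewrite !mxE; ring.
lra.
Qed.

End strong_convexity.

(** * Integrals of partial derivatives of compactly supported functions *)

Section integration_by_parts.
Context {R : realType}.
Local Notation leb := (@lebesgue_measure R).

(** Compact support, phrased coordinate by coordinate so that it passes to the sections used in
    iterated integrals. *)
Definition boxed n (N : R) (k : 'rV[R]_n -> R) :=
  forall x : 'rV[R]_n, (exists i, N <= `|x ord0 i|) -> k x = 0.

Let box (n : nat) (N : R) := [set x : 'rV[R]_n | forall i, `[- N, N]%classic (x ord0 i)].

Lemma boxed_bounded n (N : R) (k : 'rV[R]_n -> R) : continuous k -> boxed N k ->
  exists M, forall x, `|k x| <= M.
Proof.
move=> kc k0.
have cA : compact (k @` @box n N).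
  apply: continuous_compact; first exact: continuous_subspaceT.
  by apply: (@rV_compact R n (fun _ => `[- N, N]%classic)) => _; exact: segment_compact.
have [M [_ MP]] := compact_bounded cA.
exists (Num.max (M + 1) 0) => x.
have [Ax|/existsNP[i nAx]] := pselect (@box n N x).
  by rewrite le_max (MP (M + 1))// ?ltrDl//; exists x.
rewrite k0 ?normr0 ?le_max ?lexx ?orbT//; exists i.
by rewrite leNgt; apply/negP => /ltW; rewrite ler_norml => h; apply: nAx; rewrite /= in_itv.
Qed.

Lemma boxed_integrable n (N : R) (k : 'rV[R]_n -> R) : continuous k -> boxed N k ->
  (lebesgue_rV n).-integrable setT (EFin \o k).
Proof.
move=> kc k0; have [M MP] := boxed_bounded kc k0.
have mA : measurable (@box n N).
  rewrite (_ : @box n N = \bigcap_(i in [set: 'I_n])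
      ((fun x : 'rV[R]_n => x ord0 i) @^-1` `[- N, N]%classic)).
    apply: fin_bigcap_measurable => // i _.
    rewrite -[X in measurable X]setTI.
    exact: (measurable_rV_coord i measurableT (measurable_itv _)).
  by apply/seteqP; split => x /= h i; [move=> _; exact: h|exact: (h i I)].
have mk : measurable_fun setT k by exact: continuous_measurable_rV.
have Afin : (lebesgue_rV n (@box n N) < +oo)%E.
  rewrite /box (@lebesgue_rV_box R n (fun=> (`[- N, N]%classic : set (measurableTypeR R))))//.
  rewrite -ge0_fin_numE; last by rewrite prode_ge0.
  apply: prode_fin_num => i _.
  by rewrite lebesgue_measure_itv/=; case: ifP.
apply: (@le_integrable _ _ _ _ _ _ _ (fun x => (M * \1_(@box n N) x)%:E)) => //.
- exact/measurable_EFinP.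
- move=> x _ /=; rewrite lee_fin.
  have [Ax|/existsNP[i nAx]] := pselect (@box n N x).
    by rewrite indicE mem_set// mulr1 (le_trans (MP x))// ler_norm.
  rewrite k0 ?normr0//; exists i.
  by rewrite leNgt; apply/negP => /ltW; rewrite ler_norml => h; apply: nAx; rewrite /= in_itv.
- under eq_fun do rewrite EFinM.
  apply: integrableZl => //; apply/integrableP; split.
    by apply/measurable_EFinP; exact: measurable_indic.
  under eq_integral do rewrite /= ger0_norm//.
  by rewrite integral_indic// setIT.
Qed.

Lemma integral_derive_boxed (F dF : R -> R) (N : R) : 0 < N ->
  (forall t : R, is_derive t 1 F (dF t)) -> continuous dF ->
  (forall t, N <= `|t| -> F t = 0) -> (forall t, N <= `|t| -> dF t = 0) ->
  (\int[leb]_x (dF x)%:E = 0)%E.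
Proof.
move=> N0 Fd dFc F0 dF0.
have -> : (\int[leb]_x (dF x)%:E = \int[leb]_(x in `[(- N)%R, N]) (dF x)%:E)%E.
  rewrite [RHS]integral_mkcond; apply: eq_integral => x _.
  rewrite patchE; case: ifPn => //; rewrite notin_setE/= in_itv/= => h.
  rewrite dF0// leNgt; apply/negP => /ltW; rewrite ler_norml; exact: h.
rewrite (@continuous_FTC2 _ dF F).
- by rewrite !F0 ?normrN ?(ger0_norm (ltW N0))// subee.
- by rewrite -subr_gt0; lra.
- exact: continuous_subspaceT.
- have Fc : continuous F.
    move=> t; apply/differentiable_continuous/derivable1_diffP.
    by have [] := Fd t.
  split => [t _|/=|/=]; first by have [] := Fd t.
    exact/cvg_at_right_filter/Fc.
  exact/cvg_at_left_filter/Fc.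
- by move=> t _; rewrite derive1E; exact: derive_val.
Qed.

Lemma continuous_rV_cons n (x : R) : continuous (fun v : 'rV[R]_n => rV_cons (x, v)).
Proof.
move=> v A /nbhs_ballP[e /= e0 eA]; apply/nbhs_ballP; exists e => //= w.
move=> /(ball_rVP _ _ e0) vw; apply: eA; apply/ball_rVP => // i.
rewrite !mxE; case: (unliftP ord0 i) => [j _|_] /=; first exact: vw.
by rewrite subrr normr0.
Qed.

Lemma continuous_rV_cons1 n (v : 'rV[R]_n) : continuous (fun x : R => rV_cons (x, v)).
Proof.
move=> x A /nbhs_ballP[e /= e0 eA]; apply/nbhs_ballP; exists e => //= y xy.
apply: eA; apply/ball_rVP => // i.
rewrite !mxE; case: (unliftP ord0 i) => [j _|_] /=; last exact: xy.
by rewrite subrr normr0.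
Qed.

(** Both orders are needed: a derivative in the first coordinate is integrated first in that
    coordinate, any other one is treated by induction with the first coordinate frozen. *)
Lemma integral_rVS n (k : 'rV[R]_n.+1 -> R) :
  (lebesgue_rV n.+1).-integrable setT (EFin \o k) ->
  (\int[lebesgue_rV n.+1]_x (k x)%:E =
     \int[leb]_x \int[lebesgue_rV n]_v (k (rV_cons (x, v)))%:E /\
   \int[lebesgue_rV n.+1]_x (k x)%:E =
     \int[lebesgue_rV n]_v \int[leb]_x (k (rV_cons (x, v)))%:E)%E.
Proof.
move=> ik.
have mk : measurable_fun setT (EFin \o k) := measurable_int _ ik.
have ik' : (leb \x lebesgue_rV n)%E.-integrable setT ((EFin \o k) \o @rV_cons R n).
  apply/integrableP; split.
    exact: measurableT_comp (@measurable_rV_cons R n).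
  have /integrableP[_] := ik; apply: le_lt_trans.
  have := @ge0_integral_pushforward _ _ _ _ R _ (@measurable_rV_cons R n)
    (leb \x lebesgue_rV n)%E setT (fun x => `|(EFin \o k) x|%E) measurableT
    ltac:(exact: measurableT_comp) (fun x _ => abse_ge0 _).
  by rewrite preimage_setT => <-.
have E : (\int[lebesgue_rV n.+1]_x (k x)%:E =
    \int[(leb \x lebesgue_rV n)%E]_p (k (rV_cons p))%:E)%E.
  have := @integral_pushforward _ _ _ _ R _ (@measurable_rV_cons R n)
    (leb \x lebesgue_rV n)%E setT (EFin \o k) mk ik' measurableT.
  by rewrite preimage_setT.
rewrite E; split.
  by rewrite -(integral12_prod_meas1 ik').
by rewrite -(integral21_prod_meas1 ik').
Qed.

(** The margin [1] leaves room to move by [|t| <= 1] along any axis without leaving the region where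
    [w] vanishes. *)
Lemma boxed_derive n (N : R) w (dw : 'I_n -> 'rV[R]_n -> R) i :
  C1 w dw -> boxed N w -> boxed (N + 1) (dw i).
Proof.
move=> wC w0 x [j xj].
have wd := C1_derive wC x i.
have : is_derive (0 *: (delta_mx ord0 i : 'rV[R]_n) + x) (delta_mx ord0 i) w (dw i x).
  by rewrite scale0r add0r.
move/is_derive_lineP => h.
rewrite -(@derive_val _ _ _ _ _ _ _ h).
rewrite (@near_eq_derive _ _ _ _ (cst 0))// ?derive_cst//.
near=> t; rewrite w0//; exists j; rewrite !mxE eqxx/=.
have t1 : `|t| <= 1 by near: t; exact: (@nbhs0_le R R 1).
have tj : `|t * (j == i)%:R| <= 1.
  by rewrite normrM; case: eqP => _; rewrite ?normr1 ?mulr1// normr0 mulr0.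
have := ler_normB (t * (j == i)%:R + x ord0 j) (t * (j == i)%:R).
by rewrite addrAC subrr add0r; lra.
Unshelve. all: by end_near. Qed.

Theorem integral_partial_boxed n (N : R) w (dw : 'I_n -> 'rV[R]_n -> R) i :
  0 < N -> C1 w dw -> boxed N w -> (\int[lebesgue_rV n]_x (dw i x)%:E = 0)%E.
Proof.
move=> N0; elim: n w dw i => [|n IH] w dw i wC w0; first by case: i.
have dwc := C1_dcontinuous wC i.
have dw0 := boxed_derive i wC w0.
have [E1 E2] := integral_rVS (boxed_integrable dwc dw0).
case: (unliftP ord0 i) => [j ij|i0].
  rewrite E1; apply: integral0_eq => x _; rewrite ij.
    apply: (IH (fun v => w (rV_cons (x, v)))
      (fun j v => dw (lift ord0 j) (rV_cons (x, v))) j).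
    - split => [v|v l|l v].
      + apply: (continuous_comp (@continuous_rV_cons n x v)); exact: C1_continuous wC _.
      + have := C1_derive wC (rV_cons (x, v)) (lift ord0 l).
        set a := delta_mx _ _; set b := delta_mx _ _ => h.
        have Eh (t : R) : rV_cons (x, t *: b + v) = t *: a + rV_cons (x, v).
          apply/rowP => m; rewrite !mxE; case: (unliftP ord0 m) => [p ->|->] /=.
            by rewrite !mxE/= (inj_eq (@lift_inj _ ord0)).
          by rewrite mulr0 add0r.
        have h0 : is_derive (0 *: a + rV_cons (x, v)) a w (dw (lift ord0 l) (rV_cons (x, v))).
          by rewrite scale0r add0r.
        move/is_derive_lineP : h0 => h0.
        rewrite -[v in is_derive v]add0r -(scale0r b).
        apply/is_derive_lineP.
        by under eq_fun do rewrite Eh.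
      + apply: (continuous_comp (@continuous_rV_cons n x v)); exact: C1_dcontinuous wC _ _.
    - move=> v [l vl]; apply: w0; exists (lift ord0 l).
      by rewrite mxE liftK.
rewrite E2; apply: integral0_eq => v _.
  apply: (@integral_derive_boxed (fun x => w (rV_cons (x, v))) _ (N + 1)).
  - lra.
  - move=> t.
    have := C1_derive wC (rV_cons (0, v)) i.
    set a := delta_mx _ _ => h.
    have Eh (k : R) : rV_cons (k, v) = k *: a + rV_cons (0, v).
      apply/rowP => m; rewrite !mxE i0; case: (unliftP ord0 m) => [p ->|->] /=.
        by rewrite mulr0 add0r.
      by rewrite mulr1 addr0.
    have -> : (fun x : R => w (rV_cons (x, v))) = (fun x : R => w (x *: a + rV_cons (0, v))).
      by apply/funext => k; rewrite Eh.
    rewrite (Eh t); apply/is_derive_lineP; exact: (C1_derive wC).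
  - move=> t.
    apply: (continuous_comp (@continuous_rV_cons1 n v t)); exact: dwc.
  - move=> t tN; apply: w0; exists ord0; rewrite mxE unlift_none/=; lra.
  - move=> t tN; apply: dw0; exists ord0; by rewrite mxE unlift_none.
Qed.

End integration_by_parts.

Lemma le_addgt0_small {R : realFieldType} (B K Z s0 : R) : 0 < s0 ->
  (forall s, 0 < s -> s <= s0 -> B <= K + s * Z) -> B <= K.
Proof.
move=> s00 H; apply/ler_addgt0Pr => e e0.
have Z0 : 0 < `|Z| + 1 by rewrite ltr_wpDl.
pose s := Num.min s0 (e / (`|Z| + 1)).
have sp : 0 < s by rewrite lt_min s00 divr_gt0.
apply: (le_trans (H s sp _)); first by rewrite ge_min lexx.
rewrite lerD2l; apply: (le_trans (ler_norm _)); rewrite normrM (gtr0_norm sp).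
apply: (@le_trans _ _ (e / (`|Z| + 1) * `|Z|)).
  by apply: ler_wpM2r => //; rewrite ge_min lexx orbT.
by rewrite -mulrA ger_pMr// ler_pdivrMl// mulr1 lerDl.
Qed.

(** From [1 - w <= exp (- w)] comes [exp w <= 1 / (1 - w)], which is below the quadratic for
    [w <= 1 / 2]. *)
Lemma expR_le_quad {R : realType} (w : R) : 0 <= w <= 1 / 2 ->
  expR w <= 1 + w + 2 * w ^+ 2.
Proof.
move=> /andP[w0 w1].
have h : 1 - w <= expR (- w) by have := expR_ge1Dx (- w).
have q0 : 0 < 1 - w by lra.
have : expR w * (1 - w) <= 1.
  have := ler_wpM2l (expR_ge0 w) h; by rewrite -expRD subrr expR0.
rewrite -ler_pdivlMr// mul1r => /le_trans; apply.
rewrite invf_ple ?posrE//; last by nra.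
rewrite -[leLHS]mul1r ler_pdivrMr; nra.
Qed.

(** * The logarithmic Sobolev inequality *)

Section weighted.
Context {R : realType} d (T : measurableType d) (mu : {measure set T -> \bar R}).
Implicit Types (p b : T -> R).

Lemma integrableDr p b : mu.-integrable setT (EFin \o p) ->
  mu.-integrable setT (EFin \o b) ->
  mu.-integrable setT (EFin \o (fun x => p x + b x)).
Proof. by move=> ip ib; exact: (integrableD measurableT ip ib). Qed.

Lemma integrableZr p r : mu.-integrable setT (EFin \o p) ->
  mu.-integrable setT (EFin \o (fun x => r * p x)).
Proof. by move=> ip; exact: (integrableZl measurableT r ip). Qed.

Lemma integrable_bounded_weight p b K : mu.-integrable setT (EFin \o p) ->
  (forall x, 0 <= p x) -> measurable_fun setT b -> (forall x, `|b x| <= K) ->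
  mu.-integrable setT (EFin \o (fun x => b x * p x)).
Proof.
move=> ip p0 mb bK.
have mp : measurable_fun setT p by apply/measurable_EFinP/(measurable_int _ ip).
apply: (@le_integrable _ _ _ _ _ _ _ (fun x => (K * p x)%:E)) => //.
- by apply/measurable_EFinP; exact: measurable_funM.
- move=> x _ /=; rewrite lee_fin normrM (ger0_norm (p0 x)).
  have K0 : 0 <= K := le_trans (normr_ge0 _) (bK x).
  by rewrite (ger0_norm (mulr_ge0 K0 (p0 x))) ler_wpM2r.
- under eq_fun do rewrite EFinM.
  exact: integrableZl.
Qed.

End weighted.

(** * The inequality for a bounded [g] with bounded, uniformly continuous gradient *)

Section lsi_bounded.
Context {R : realType} {n : nat}.
Variables (V g : 'rV[R]_n -> R) (dg : 'I_n -> 'rV[R]_n -> R) (kappa M L : R).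
Local Notation leb := (lebesgue_rV n).
Local Notation e_ i := (delta_mx ord0 i : 'rV[R]_n).
Let p x := expR (- V x).
Hypothesis kappa0 : 0 < kappa.
Hypothesis V_convex : forall s x y, 0 <= s <= 1 ->
  V ((1 - s) *: x + s *: y) <= (1 - s) * V x + s * V y
    - kappa / 2 * (s * (1 - s)) * sqnorm (x - y).
Hypothesis ip : leb.-integrable setT (EFin \o p).
Hypothesis p1 : \int[leb]_x p x = 1.
Hypothesis gd : forall x i, is_derive x (e_ i) g (dg i x).
Hypothesis mg : measurable_fun setT g.
Hypothesis mdg : forall i, measurable_fun setT (dg i).
Hypothesis gM : forall x, `|g x| <= M.
Hypothesis dgL : forall i x, `|dg i x| <= L.
Hypothesis dguc : forall e, 0 < e -> exists2 d, 0 < d &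
  forall x y : 'rV[R]_n, (forall i, `|x ord0 i - y ord0 i| < d) -> forall i, `|dg i x - dg i y| < e.
Hypothesis g1 : \int[leb]_x (expR (g x) * p x) = 1.

Let p0 x : 0 <= p x. Proof. exact: expR_ge0. Qed.

(** The squared gradient of [g], enlarged by [e] in each coordinate to absorb the variation of the
    gradient near [z]. [Cm] bounds it uniformly for [e <= 1]. *)
Let c (e : R) z := \sum_i (`|dg i z| + e) ^+ 2.
Let Cm := \sum_(i < n) (L + 1) ^+ 2.

Let c_ge0 e z : 0 <= c e z.
Proof. by apply: sumr_ge0 => i _; exact: sqr_ge0. Qed.

Let c_le e z : 0 <= e <= 1 -> c e z <= Cm.
Proof.
move=> /andP[e0 e1]; apply: ler_sum => i _; have := dgL i z; have := normr_ge0 (dg i z).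
by move=> a b; rewrite ler_pXn2r// ?nnegrE; lra.
Qed.

Let mc e : measurable_fun setT (c e).
Proof.
apply: measurable_sum => i; apply: measurable_funX; apply: measurable_funD => //.
exact: measurableT_comp.
Qed.

(* An upper bound on the Hopf-Lax semigroup: far from [z] the quadratic penalty
   beats the oscillation of [g], near [z] the gradient is almost constant. *)
Let hopf_lax e d s x z : 0 < e -> 0 < d -> 0 < s <= 1 / 2 ->
  (forall x y : 'rV[R]_n, (forall i, `|x ord0 i - y ord0 i| < d) -> forall i, `|dg i x - dg i y| < e) ->
  8 * s * M <= kappa * d ^+ 2 ->
  g x <= g z + s / (2 * kappa * (1 - s)) * c e z
    + kappa * (1 - s) / (2 * s) * sqnorm (x - z).
Proof.
move=> e0 d0 /andP[s0 s2] uc sM.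
have q0 : 0 < 1 - s by lra.
have B0 : 0 < kappa * (1 - s) / (2 * s) by rewrite divr_gt0 ?mulr_gt0.
have A0 : 0 < s / (2 * kappa * (1 - s)) by rewrite divr_gt0 ?mulr_gt0.
have [near|/existsNP[i /negP]] := pselect (forall i, `|x ord0 i - z ord0 i| < d).
  have [xi xiP E] := mvt_rV gd x z.
  rewrite -addrA -lerBlDl E /c /sqnorm !mulr_sumr -big_split/=.
  apply: ler_sum => i _; rewrite !mxE.
  apply: (le_trans (ler_norm _)); rewrite normrM.
  set a := `|dg i z| + e; set b := x ord0 i - z ord0 i.
  have h1 : `|dg i (xi i)| <= a.
    have := uc (xi i) z (fun j => le_lt_trans (xiP i j) (near j)) i.
    have := ler_normD (dg i (xi i) - dg i z) (dg i z); rewrite subrK /a; lra.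
  apply: (@le_trans _ _ (a * `|b|)); first exact: ler_wpM2r.
  rewrite -[b ^+ 2]real_normK ?num_real//; set b' := `|b|.
  rewrite -subr_ge0.
  have -> : s / (2 * kappa * (1 - s)) * a ^+ 2 + kappa * (1 - s) / (2 * s) * b' ^+ 2 - a * b'
      = (s * a - kappa * (1 - s) * b') ^+ 2 / (2 * s * kappa * (1 - s)).
    by field; rewrite !gt_eqF.
  by rewrite divr_ge0 ?sqr_ge0// !mulr_ge0// ltW.
rewrite -leNgt => far.
have := gM x; have := gM z; rewrite !ler_norml => /andP[gz _] /andP[_ gx].
(* [2 * M] bounds the oscillation of [g]. The condition [8 * s * M <= kappa * d ^+ 2] with
   [1 - s >= 1 / 2] makes the penalty at distance [d] at least as large. *)
have M2 : 2 * M <= kappa * (1 - s) / (2 * s) * d ^+ 2.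
  rewrite mulrAC ler_pdivlMr ?mulr_gt0//.
  have : kappa * d ^+ 2 <= 2 * (kappa * (1 - s) * d ^+ 2).
    have : 0 <= kappa * d ^+ 2 by rewrite mulr_ge0 ?sqr_ge0 ?ltW.
    nra.
  lra.
have dx : d ^+ 2 <= sqnorm (x - z).
  rewrite /sqnorm (bigD1 i)//= ler_wpDr//.
    by apply: sumr_ge0 => j _; exact: sqr_ge0.
  rewrite !mxE -[leRHS]real_normK ?num_real//.
  by rewrite ler_pXn2r// ?nnegrE ltW.
have : kappa * (1 - s) / (2 * s) * d ^+ 2 <= kappa * (1 - s) / (2 * s) * sqnorm (x - z).
  by rewrite ler_wpM2l// ltW.
have : 0 <= s / (2 * kappa * (1 - s)) * c e z by rewrite mulr_ge0 ?c_ge0 ?ltW.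
lra.
Qed.


(** The integral of the first factor, where [g] is divided by [1 - s] so that the power [1 - s] in
    the geometric mean restores it. [IH] belongs to the majorant that [hopf_lax] provides. *)
Let IF s := \int[leb]_x expR (g x / (1 - s) - V x).
Let IH e s := \int[leb]_x expR (g x + s / (2 * kappa * (1 - s)) * c e x - V x).

Let integrable_exp (b : 'rV[R]_n -> R) K : measurable_fun setT b ->
  (forall x, b x <= K) -> leb.-integrable setT (EFin \o (fun x => expR (b x - V x))).
Proof.
move=> mb bK.
have -> : (fun x => expR (b x - V x)) = (fun x => expR (b x) * p x).
  by apply/funext => x; rewrite expRD.
apply: (@integrable_bounded_weight _ _ _ _ _ _ (expR K)) => //.
  exact: measurableT_comp.
by move=> x; rewrite ger0_norm ?expR_ge0// ler_expR.
Qed.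

Let pl_step e d s : 0 < e <= 1 -> 0 < d -> 0 < s <= 1 / 2 ->
  (forall x y : 'rV[R]_n, (forall i, `|x ord0 i - y ord0 i| < d) ->
     forall i, `|dg i x - dg i y| < e) ->
  8 * s * M <= kappa * d ^+ 2 -> 0 < IF s ->
  expR ((1 - s) * ln (IF s)) <= IH e s.
Proof.
move=> /andP[e0 e1] d0 /andP[s0 s2] uc sM IF0.
have q0 : 0 < 1 - s by lra.
have s01 : 0 < s < 1 by rewrite s0/=; lra.
have A0 : 0 < s / (2 * kappa * (1 - s)) by rewrite divr_gt0 ?mulr_gt0.
pose F x := expR (g x / (1 - s) - V x).
pose H x := expR (g x + s / (2 * kappa * (1 - s)) * c e x - V x).
have iF : leb.-integrable setT (EFin \o F).
  apply: (@integrable_exp _ (M / (1 - s))); first exact: measurable_funM.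
  move=> x; rewrite ler_pM2r ?invr_gt0//; exact: (le_trans (ler_norm _) (gM x)).
have iH : leb.-integrable setT (EFin \o H).
  apply: (@integrable_exp _ (M + s / (2 * kappa * (1 - s)) * Cm)).
    by apply: measurable_funD => //; apply: measurable_funM.
  move=> x; apply: lerD; first exact: (le_trans (ler_norm _) (gM x)).
  by rewrite ler_wpM2l ?(ltW A0)// c_le// e1 ltW.
have iP : leb.-integrable setT (EFin \o p) by [].
have EI (k : 'rV[R]_n -> R) : leb.-integrable setT (EFin \o k) ->
    (\int[leb]_x (EFin \o k) x = (\int[leb]_x k x)%:E)%E.
  by move=> ik; rewrite /Rintegral fineK// integrable_fin_num.
have mE (k : 'rV[R]_n -> R) : leb.-integrable setT (EFin \o k) ->
    measurable_fun setT (EFin \o k) by move=> ik; exact: (measurable_int _ ik).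
have hyp : pl_hyp s (EFin \o F) (EFin \o p) (EFin \o H).
  move=> x y a b a0 b0; rewrite /= !lte_fin lee_fin => aF bp.
  set z := (1 - s) *: x + s *: y.
  have la : ln a <= g x / (1 - s) - V x.
    by rewrite -[leRHS]expRK ler_ln ?posrE ?expR_gt0// ltW.
  have lb : ln b <= - V y by rewrite -[leRHS]expRK ler_ln ?posrE ?expR_gt0// ltW.
  rewrite /geomean /H ler_expR.
  have hl := hopf_lax x z e0 d0 (introT andP (conj s0 s2)) uc sM.
  have s01' : 0 <= s <= 1 by rewrite ltW//=; lra.
  have := V_convex x y s01'; rewrite -/z => vc.
  have xz : sqnorm (x - z) = s ^+ 2 * sqnorm (x - y).
    rewrite /sqnorm mulr_sumr; apply: eq_bigr => i _; rewrite !mxE; ring.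
  have E : kappa * (1 - s) / (2 * s) * sqnorm (x - z) =
      kappa / 2 * (s * (1 - s)) * sqnorm (x - y).
    by rewrite xz; field; rewrite gt_eqF.
  rewrite E in hl.
  have h1 : (1 - s) * ln a <= g x - (1 - s) * V x.
    apply: (le_trans (ler_wpM2l (ltW q0) la)); rewrite mulrBr mulrCA divff ?mulr1//.
    by rewrite gt_eqF.
  have h2 : s * ln b <= - (s * V y) by rewrite -mulrN; apply: ler_wpM2l => //; exact: ltW.
  lra.
have PL := prekopa_leindler s01 (mE _ iF) (mE _ iP) (mE _ iH) _ _ _ hyp.
have IHe : (\int[leb]_x (EFin \o H) x = (IH e s)%:E)%E by rewrite EI.
have IFe : (\int[leb]_x (EFin \o F) x = (IF s)%:E)%E by rewrite EI.
have IPe : (\int[leb]_x (EFin \o p) x = 1%:E)%E by rewrite EI// p1.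
rewrite IHe IFe IPe in PL.
have {}PL a b : 0 < a -> 0 < b -> a < IF s -> b < 1 -> geomean s a b <= IH e s.
  move=> a0 b0 aI b1; rewrite -lee_fin.
  by apply: PL; rewrite ?lte_fin// => x; rewrite /= lee_fin expR_ge0.
have IH0 : 0 < IH e s.
  apply: (lt_le_trans (geomean_gt0 s (IF s / 2) (1 / 2))); apply: PL; lra.
rewrite -[leRHS](lnK IH0) ler_expR; apply/ler_addgt0Pr => eta eta0.
have eta1 : expR (- eta) < 1 by rewrite expR_lt1 oppr_lt0.
(* Prekopa-Leindler takes reals strictly below the integrals. Shrinking both by [expR (- eta)] costs
   exactly [eta] in the logarithm of the mean, because the weights sum to [1]. *)
have := PL (IF s * expR (- eta)) (expR (- eta)).
rewrite mulr_gt0 ?expR_gt0// => /(_ erefl erefl).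
rewrite gtr_pMr// => /(_ eta1 eta1).
rewrite -ler_ln ?posrE ?geomean_gt0// /geomean expRK lnM ?posrE ?expR_gt0// !expRK.
lra.
Qed.

(** [B] is the entropy of [expR g * p] relative to [p], [K e] its Fisher information over
    [2 * kappa] with the enlarged gradient, and [Q] the coefficient of the second-order terms in
    [s]. *)
Let B := \int[leb]_x (g x * expR (g x) * p x).
Let K e := (2 * kappa)^-1 * \int[leb]_x (c e x * expR (g x) * p x).
Let Q := 2 * (Cm / kappa) ^+ 2.

Let integrable_eg (b : 'rV[R]_n -> R) K' : measurable_fun setT b ->
  (forall x, `|b x| <= K') ->
  leb.-integrable setT (EFin \o (fun x => b x * expR (g x) * p x)).
Proof.
move=> mb bK.
apply: (@integrable_bounded_weight _ _ _ _ _ _ (K' * expR M)) => //.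
  by apply: measurable_funM => //; exact: measurableT_comp.
move=> x; rewrite normrM ler_pM// ger0_norm ?expR_ge0// ler_expR.
exact: (le_trans (ler_norm _) (gM x)).
Qed.

Let ieg : leb.-integrable setT (EFin \o (fun x => expR (g x) * p x)).
Proof.
have -> : (fun x => expR (g x) * p x) = (fun x => expR (g x - V x)).
  by apply/funext => x; rewrite expRD.
apply: (@integrable_exp _ M) => // x; exact: (le_trans (ler_norm _) (gM x)).
Qed.

Let igeg : leb.-integrable setT (EFin \o (fun x => g x * expR (g x) * p x)).
Proof. exact: (@integrable_eg _ M). Qed.

Let iceg e : 0 <= e <= 1 ->
  leb.-integrable setT (EFin \o (fun x => c e x * expR (g x) * p x)).
Proof.
move=> e01; apply: (@integrable_eg _ Cm) => // x.
by rewrite ger0_norm// c_le.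
Qed.

(** [1 + y <= exp y] at [y = s / (1 - s) * g], integrated against the probability density
    [expR g * p]. *)
Let IF_ge s : 0 < s <= 1 / 2 -> 1 + s / (1 - s) * B <= IF s.
Proof.
move=> /andP[s0 s2]; have q0 : 0 < 1 - s by lra.
rewrite -[X in X + _]g1 /B -RintegralZl// -RintegralD//; last exact: integrableZr.
apply: le_Rintegral => //.
- by apply: integrableDr => //; exact: integrableZr.
- apply: (@integrable_exp _ (M / (1 - s))); first exact: measurable_funM.
  move=> x; rewrite ler_pM2r ?invr_gt0//; exact: (le_trans (ler_norm _) (gM x)).
move=> x _.
have -> : g x / (1 - s) - V x = s / (1 - s) * g x + (g x - V x).
  by field; rewrite gt_eqF.
have := expR_ge1Dx (s / (1 - s) * g x); rewrite expRD.
have -> : expR (g x) * p x + s / (1 - s) * (g x * expR (g x) * p x) =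
  (1 + s / (1 - s) * g x) * expR (g x - V x) by rewrite expRD -/(p x); ring.
by move=> h; rewrite ler_wpM2r// expR_ge0.
Qed.

Let IH_le e s : 0 <= e <= 1 -> 0 < s <= 1 / 2 -> s * Cm / kappa <= 1 / 2 ->
  IH e s <= 1 + s / (1 - s) * K e + s ^+ 2 * Q.
Proof.
move=> e01 /andP[s0 s2] sC; have q0 : 0 < 1 - s by lra.
have A0 : 0 < s / (2 * kappa * (1 - s)) by rewrite divr_gt0 ?mulr_gt0.
have -> : 1 + s / (1 - s) * K e + s ^+ 2 * Q = \int[leb]_x (expR (g x) * p x
    + (s / (2 * kappa * (1 - s)) * (c e x * expR (g x) * p x)
    + s ^+ 2 * Q * (expR (g x) * p x))).
  rewrite RintegralD//; last by apply: integrableDr; apply: integrableZr => //; exact: iceg.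
  rewrite RintegralD//; [|by apply: integrableZr; exact: iceg|exact: integrableZr].
  rewrite !RintegralZl//; last exact: iceg.
  by rewrite g1 mulr1 /K; field; rewrite !gt_eqF.
apply: le_Rintegral => //.
- apply: (@integrable_exp _ (M + s / (2 * kappa * (1 - s)) * Cm)).
    by apply: measurable_funD => //; apply: measurable_funM.
  move=> x; apply: lerD; first exact: (le_trans (ler_norm _) (gM x)).
  by rewrite ler_wpM2l ?(ltW A0)// c_le.
- by apply: integrableDr => //; apply: integrableDr => //; apply: integrableZr => //; exact: iceg.
move=> x _; set w := s / (2 * kappa * (1 - s)) * c e x.
have w0 : 0 <= w by rewrite mulr_ge0 ?c_ge0 ?ltW.
(* [2 * (1 - s) >= 1] because [s <= 1 / 2]. This bound puts [w] in the range of [expR_le_quad] and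
   explains the value of [Q]. *)
have wC : w <= s * (Cm / kappa).
  apply: (@le_trans _ _ (s / kappa * c e x)); last first.
    rewrite mulrAC mulrA; apply: ler_wpM2r; first by rewrite invr_ge0 ltW.
    by apply: ler_wpM2l; [exact: ltW|exact: c_le].
  rewrite /w; apply: ler_wpM2r => //; apply: ler_wpM2l; first exact: ltW.
  have : 0 <= kappa * (1 / 2 - s) by rewrite mulr_ge0 ?(ltW kappa0) ?subr_ge0.
  rewrite lef_pV2 ?posrE ?mulr_gt0//; lra.
have w1 : 0 <= w <= 1 / 2 by rewrite w0 (le_trans wC)// mulrA.
have := expR_le_quad w1 => h.
have w2 : 2 * w ^+ 2 <= s ^+ 2 * Q.
  rewrite /Q (mulrCA (s ^+ 2)) -exprMn ler_pM2l//.
  by rewrite ler_pXn2r// ?nnegrE// (le_trans w0 wC).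
have -> : g x + w - V x = w + (g x - V x) by ring.
rewrite expRD.
apply: (@le_trans _ _ ((1 + w + s ^+ 2 * Q) * expR (g x - V x))).
  rewrite ler_wpM2r ?expR_ge0//; lra.
rewrite expRD -/(p x) /w le_eqVlt; apply/orP; left; apply/eqP; ring.
Qed.

(** [pl_step], [IF_ge] and [IH_le] compare two expansions that agree at [s = 0]; dividing by [s] and
    letting [s] tend to [0] compares the coefficients of first order. Only [B > 0] needs this, as
    [K e >= 0]. *)
Let B_le_K e : 0 < e <= 1 -> B <= K e.
Proof.
move=> /[dup] e01 /andP[e0 e1].
have K0 : 0 <= K e.
  rewrite mulr_ge0 ?invr_ge0 ?mulr_ge0 ?(ltW kappa0)//; apply: Rintegral_ge0 => x _.
  by rewrite !mulr_ge0 ?expR_ge0.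
have [B0|B0] := leP B 0; first exact: le_trans K0.
have [d d0 uc] := dguc e0.
have Cm0 : 0 <= Cm by apply: sumr_ge0 => i _; exact: sqr_ge0.
have M0 : 0 <= M := le_trans (normr_ge0 _) (gM 0).
have Q0 : 0 <= Q by rewrite mulr_ge0 ?sqr_ge0.
(* The last two bounds serve [hopf_lax] and [expR_le_quad]; the [+ 1] in the denominators covers
   [M = 0] and [Cm = 0]. *)
pose s0 := Num.min (1 / 2) (Num.min (kappa * d ^+ 2 / (8 * M + 1)) (kappa / (2 * Cm + 1))).
have s00 : 0 < s0.
  rewrite !lt_min; apply/andP; split; first lra.
  by rewrite !divr_gt0 ?mulr_gt0 ?exprn_gt0// ltr_wpDl// mulr_ge0.
(* The coefficient comes from expanding [(1 + 2 * s * B) * (K e * (1 + 2 * s) + s * Q)], the terms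
   in [s ^+ 2] being absorbed through [s <= 1 / 2]. *)
apply: (@le_addgt0_small _ _ _ (2 * K e + Q + 4 * B * K e + 2 * B * Q) s0) => // s s_gt0.
rewrite !le_min => /andP[s2 /andP[sM sC]].
have s12 : 0 < s <= 1 / 2 by rewrite s_gt0.
have q0 : 0 < 1 - s by lra.
have sM' : 8 * s * M <= kappa * d ^+ 2.
  by move: sM; rewrite ler_pdivlMr; [nra|lra].
have sC' : s * Cm / kappa <= 1 / 2.
  by move: sC; rewrite ler_pdivlMr ?ler_pdivrMr//; [nra|lra].
set u := s / (1 - s) * B.
have u0 : 0 < u by rewrite mulr_gt0// divr_gt0.
have IFu : 1 + u <= IF s := IF_ge s12.
have IF0 : 0 < IF s by apply: lt_le_trans IFu; lra.
have e01' : 0 <= e <= 1 by rewrite ltW.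
have h1 := pl_step e01 d0 s12 uc sM' IF0.
have h2 := IH_le e01' s12 sC'.
have h3 : 1 + (1 - s) * ln (IF s) <= IH e s by apply: le_trans h1; exact: expR_ge1Dx.
have h4 : u / (1 + u) <= ln (IF s).
  have u1 : 0 < 1 + u by lra.
  apply: (@le_trans _ _ (ln (1 + u))); last by rewrite ler_ln ?posrE.
  (* The upper bound [ln y <= y - 1] at [y = 1 / (1 + u)] is the lower bound wanted for
     [ln (1 + u)]. *)
  have := @le_ln1Dx _ ((1 + u)^-1 - 1).
  have iu : 0 < (1 + u)^-1 by rewrite invr_gt0.
  have -> : 1 + ((1 + u)^-1 - 1) = (1 + u)^-1 by ring.
  move=> /(_ ltac:(lra)).
  rewrite lnV ?posrE// => h.
  have -> : u / (1 + u) = 1 - (1 + u)^-1 by field; rewrite gt_eqF.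
  lra.
have h5 : (1 - s) * (u / (1 + u)) <= s / (1 - s) * K e + s ^+ 2 * Q.
  have := ler_wpM2l (ltW q0) h4; lra.
have E : (1 - s) * (u / (1 + u)) = s * (B / (1 + u)).
  by rewrite /u; field; rewrite !gt_eqF//; rewrite -/u; nra.
have h6 : B / (1 + u) <= K e / (1 - s) + s * Q.
  rewrite -(ler_pM2l s_gt0) -E; apply: (le_trans h5).
  by rewrite le_eqVlt; apply/orP; left; apply/eqP; field; rewrite gt_eqF.
have v1 : (1 - s)^-1 <= 1 + 2 * s.
  by rewrite -[leLHS]mul1r ler_pdivrMr//; nra.
have u1 : u <= 2 * s * B.
  rewrite /u ler_pM2r// ler_pdivrMr//; nra.
have h7 : B <= (1 + u) * (K e * (1 + 2 * s) + s * Q).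
  rewrite mulrC -ler_pdivrMr; last lra.
  apply: (le_trans h6); rewrite lerD2r; exact: ler_wpM2l.
apply: (le_trans h7).
have W0 : 0 <= K e * (1 + 2 * s) + s * Q by apply: addr_ge0; apply: mulr_ge0 => //; lra.
apply: (@le_trans _ _ ((1 + 2 * s * B) * (K e * (1 + 2 * s) + s * Q))).
  by rewrite ler_wpM2r// lerD2l.
have sBK : 0 <= s * (B * K e) := mulr_ge0 (ltW s_gt0) (mulr_ge0 (ltW B0) K0).
have sBQ : 0 <= s * (B * Q) := mulr_ge0 (ltW s_gt0) (mulr_ge0 (ltW B0) Q0).
have : s * (s * (B * K e)) <= 1 / 2 * (s * (B * K e)) by exact: ler_wpM2r.
have : s * (s * (B * Q)) <= 1 / 2 * (s * (B * Q)) by exact: ler_wpM2r.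
lra.
Qed.

(** The enlargement [e] tends to [0]: for [e <= 1] it raises each squared derivative by at most
    [e * (2 * |L| + 1)], and [expR g * p] has mass [1]. *)
Theorem lsi_bounded : \int[leb]_x (g x * expR (g x) * p x) <=
  (2 * kappa)^-1 * \int[leb]_x (\sum_i dg i x ^+ 2 * expR (g x) * p x).
Proof.
rewrite -/B.
have L0 : 0 <= \sum_(i < n) (2 * `|L| + 1) by apply: sumr_ge0 => i _; rewrite addr_ge0// mulr_ge0.
have icd : leb.-integrable setT (EFin \o (fun x => \sum_i dg i x ^+ 2 * expR (g x) * p x)).
  rewrite (_ : (fun x => _) = (fun x => c 0 x * expR (g x) * p x)).
    by apply: iceg; rewrite lexx ler01.
  apply/funext => x; rewrite /c -!mulr_suml; congr (_ * _ * _).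
  by apply: eq_bigr => i _; rewrite addr0 real_normK ?num_real.
apply: (@le_addgt0_small _ _ _ ((2 * kappa)^-1 * \sum_(i < n) (2 * `|L| + 1)) 1) => // e e0 e1.
have e01 : 0 < e <= 1 by rewrite e0.
have e01' : 0 <= e <= 1 by rewrite ltW.
apply: (le_trans (B_le_K e01)).
rewrite mulrCA -mulrDr; apply: ler_wpM2l; first by rewrite invr_ge0 mulr_ge0// ltW.
set Z := \sum_(i < n) _.
have -> : e * Z = \int[leb]_x (e * Z * (expR (g x) * p x)).
  by rewrite RintegralZl// g1 mulr1.
rewrite -RintegralD//; last exact: integrableZr.
apply: le_Rintegral => //.
- exact: iceg.
- by apply: integrableDr => //; exact: integrableZr.
move=> x _ /=; rewrite -mulrA; set W := expR (g x) * p x.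
have W0 : 0 <= W by rewrite mulr_ge0 ?expR_ge0.
have -> : \sum_i dg i x ^+ 2 * expR (g x) * p x = (\sum_i dg i x ^+ 2) * W.
  by rewrite mulr_suml; apply: eq_bigr => i _; rewrite mulrA.
rewrite -mulrDl ler_wpM2r// /Z mulr_sumr -big_split/=.
apply: ler_sum => i _; have := dgL i x; have := normr_ge0 (dg i x).
rewrite -[dg i x ^+ 2]real_normK ?num_real//; have := ler_norm L.
nra.
Qed.

End lsi_bounded.

Section real_lemmas.
Context {R : realType}.

Lemma Rintegral_dominated_cvg d (T : measurableType d) (mu : {measure set T -> \bar R})
    (f_ : nat -> T -> R) (f g : T -> R) :
  (forall k, measurable_fun setT (f_ k)) ->
  (forall x, f_ k x @[k --> \oo] --> f x) ->
  mu.-integrable setT (EFin \o g) -> (forall k x, `|f_ k x| <= g x) ->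
  \int[mu]_x f_ k x @[k --> \oo] --> \int[mu]_x f x.
Proof.
move=> mf ff ig fg.
have mf_ k : measurable_fun setT (EFin \o f_ k) by apply/measurable_EFinP.
have mfl : measurable_fun setT (EFin \o f).
  by apply/measurable_EFinP; apply: measurable_fun_cvg mf _ => x _; exact: ff.
have ffE x : (EFin \o f_ k) x @[k --> \oo] --> (f x)%:E.
  by apply: cvg_EFin; [exact: nearW|exact: ff].
have [if_ _ cv] := @dominated_convergence _ _ _ mu _ measurableT (fun k => EFin \o f_ k)
  (EFin \o f) (EFin \o g) mf_ mfl
  (aeW _ (fun x _ => ffE x)) ig (aeW _ (fun x k _ => fg k x)).
have fin : (\int[mu]_x (f x)%:E)%E \is a fin_num by exact: integrable_fin_num.
by have := fine_cvg (_ : _ --> (fine (\int[mu]_x (f x)%:E))%:E); apply; rewrite fineK.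
Qed.

(** A remainder bound valid for all [h] avoids a separate discussion of the kink of [pospart], whose
    square is the main application. *)
Lemma is_derive_quad (f : R -> R) (x d C : R) :
  (forall h, `|f (h + x) - f x - d * h| <= C * h ^+ 2) -> is_derive x 1 f d.
Proof.
move=> H.
have C0 : 0 <= C.
  by have := le_trans (normr_ge0 _) (H 1); rewrite expr1n mulr1.
suff cv : h^-1 *: (f (h *: 1 + x) - f x) @[h --> (0:R)^'] --> d.
  by apply: DeriveDef; [exact: cvgP cv|exact: cvg_lim cv].
apply/cvgrPdist_le => e e0.
have C1 : 0 < C + 1 by lra.
near=> h.
have h0 : h != 0 by near: h; exact: nbhs_dnbhs_neq.
have he : `|h| <= e / (C + 1).
  by near: h; apply: nbhs_dnbhs; apply: (@nbhs0_le R R); rewrite divr_gt0.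
have hp : 0 < `|h| by rewrite normr_gt0.
rewrite -(ler_pM2r hp) -normrM /GRing.scale/= mulr1.
rewrite (_ : (_ - _) * h = - (f (h + x) - f x - d * h)); last by field.
rewrite normrN.
apply: (le_trans (H h)).
rewrite -[h ^+ 2]real_normK ?num_real// expr2 mulrA ler_pM2r//.
apply: (@le_trans _ _ ((C + 1) * `|h|)); first by rewrite ler_pM2r//; lra.
by rewrite mulrC -ler_pdivlMr.
Unshelve. all: by end_near. Qed.

Definition pospart (s : R) : R := Num.max 0 s.

Lemma pospart_ge0 s : 0 <= pospart s. Proof. by rewrite le_max lexx. Qed.

Lemma pospart_cases s : (0 <= s /\ pospart s = s) \/ (s <= 0 /\ pospart s = 0).
Proof.
rewrite /pospart; have [s0|/ltW s0] := leP 0 s; [left|right]; split => //.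
Qed.

Lemma pospart_continuous : continuous pospart.
Proof.
by move=> x; apply: (@continuous_max _ _ (cst 0) id); [exact: cst_continuous|].
Qed.

Lemma is_derive_pospart_sqr (x : R) :
  is_derive x 1 (fun s => pospart s ^+ 2) (2 * pospart x).
Proof.
apply: (@is_derive_quad _ _ _ 1) => h; rewrite mul1r.
by have [[? ->]|[? ->]] := pospart_cases x; have [[? ->]|[? ->]] := pospart_cases (h + x);
  rewrite ler_norml; apply/andP; split; nra.
Qed.

Lemma xlnx_ge (y : R) : 0 < y -> -1 <= y * ln y.
Proof.
move=> y0; have := @le_ln1Dx R (y^-1 - 1).
have iy : 0 < y^-1 by rewrite invr_gt0.
have -> : 1 + (y^-1 - 1) = y^-1 by ring.
move=> /(_ ltac:(lra)); rewrite lnV ?posrE// => h.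
have := ler_wpM2l (ltW y0) h; rewrite mulrBr mulfV ?gt_eqF//; lra.
Qed.

Lemma ln_le_subr1 (y : R) : 0 < y -> ln y <= y - 1.
Proof.
by move=> y0; rewrite -{1}(subrKC 1 y); apply: le_ln1Dx; lra.
Qed.

(** Supplies the dominating function for the entropies of the approximants of a density [h], which
    stay below [h + 1]. For [y <= 1] the value lies in [[- 1, 0]]; for larger [y] it is at most
    [(h + 1) * ln (h + 1)]. *)
Lemma xlnx_bound (h y : R) : 0 < h -> 0 < y -> y <= h + 1 ->
  `|y * ln y| <= `|h * ln h| + h + 2.
Proof.
move=> h0 y0 yh; have yl := xlnx_ge y0; have hl := normr_ge0 (h * ln h).
have hn := ler_norm (h * ln h).
have [y1|y1] := leP y 1.
  rewrite ler_norml; apply/andP; split; first lra.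
  have : ln y <= 0 by rewrite -ln1 ler_ln ?posrE.
  nra.
have ly0 : 0 <= ln y by rewrite ln_ge0// ltW.
rewrite ger0_norm ?mulr_ge0 ?(ltW y0)//.
apply: (@le_trans _ _ ((h + 1) * ln (h + 1))).
  by apply: ler_pM => //; [exact: ltW|rewrite ler_ln ?posrE//; lra].
have h10 : 0 < h + 1 by lra.
have [h1|h1] := leP h 1.
  have := ln_le_subr1 h10; nra.
have hi : 0 < h^-1 by rewrite invr_gt0.
have l1 : ln (h + 1) <= ln h + h^-1.
  have -> : h + 1 = h * (1 + h^-1) by rewrite mulrDr mulr1 divff// gt_eqF.
  rewrite lnM ?posrE//; last lra.
  by rewrite lerD2l; apply: le_ln1Dx; lra.
have := ler_wpM2l (ltW h10) l1; rewrite mulrDr (mulrDl _ _ h^-1) mulfV ?gt_eqF// mul1r.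
have := ln_le_subr1 h0.
have : h^-1 <= 1 by rewrite invf_le1 ?ltW.
lra.
Qed.

End real_lemmas.

(** * Spatial cutoff functions *)

Section cutoff.
Context {R : realType} {n : nat}.
Implicit Types (x : 'rV[R]_n) (d : R).

(** The support is the ball of radius [d ^- 2], so that the gradient of [cutoff] is of order
    [d ^+ 2]. It then stays bounded, even small, when multiplied by the height [1 / d] of the
    truncated [mu] in the dissipation identity. *)
Definition cutoff_root d x : R := pospart (1 - d ^+ 4 * sqnorm x).
Definition cutoff d x : R := cutoff_root d x ^+ 2.
Definition dcutoff d (i : 'I_n) x : R := - (4 * d ^+ 4 * x ord0 i * cutoff_root d x).

Lemma sqnorm_ge0 x : 0 <= sqnorm x.
Proof. by apply: sumr_ge0 => i _; exact: sqr_ge0. Qed.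

Lemma sqr_le_sqnorm x i : x ord0 i ^+ 2 <= sqnorm x.
Proof.
rewrite /sqnorm (bigD1 i)//= lerDl; apply: sumr_ge0 => j _; exact: sqr_ge0.
Qed.

Lemma cutoff_root_ge0 d x : 0 <= cutoff_root d x. Proof. exact: pospart_ge0. Qed.

Lemma cutoff_root_le1 d x : cutoff_root d x <= 1.
Proof.
have : 0 <= d ^+ 4 * sqnorm x by rewrite mulr_ge0 ?sqnorm_ge0// (exprM d 2 2) sqr_ge0.
by rewrite /cutoff_root; have [[_ ->]|[_ ->]] := pospart_cases (1 - d ^+ 4 * sqnorm x); lra.
Qed.

Lemma cutoff_ge0 d x : 0 <= cutoff d x. Proof. exact: sqr_ge0. Qed.

Lemma cutoff_le1 d x : cutoff d x <= 1.
Proof. by rewrite expr_le1 ?cutoff_root_ge0 ?cutoff_root_le1. Qed.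

Lemma C1_cutoff d : C1 (cutoff d) (dcutoff d).
Proof.
have h := C1D (C1_cst 1) (C1Z (- d ^+ 4) (@C1_sqnorm R n)).
have := C1_comp (k := fun s => pospart s ^+ 2) (dk := fun s => 2 * pospart s) h
  (fun x => is_derive_pospart_sqr _).
have kc (s : R) : {for s, continuous (fun s : R => 2 * pospart s)}.
  apply: cvgM; [exact: cvg_cst|exact: pospart_continuous].
move=> /(_ (fun x => kc _)); apply: C1_eq => [x|i x] /=.
  by rewrite /cutoff /cutoff_root mulNr.
by rewrite /dcutoff /cutoff_root mulNr add0r; ring.
Qed.

Lemma boxed_cutoff_root d (k : 'rV[R]_n -> R) : 0 < d ->
  boxed (d ^- 2) (fun x => cutoff_root d x * k x).
Proof.
move=> d0 x [i xi].
have : 1 <= d ^+ 4 * sqnorm x.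
  apply: (@le_trans _ _ (d ^+ 4 * x ord0 i ^+ 2)); last first.
    by rewrite ler_wpM2l ?sqr_le_sqnorm// exprn_ge0// ltW.
  have : 1 <= d ^+ 2 * `|x ord0 i|.
    by rewrite mulrC -ler_pdivrMr ?exprn_gt0// mul1r.
  move=> h; have := exprn_ege1 2 h; rewrite exprMn -exprM real_normK ?num_real//.
rewrite /cutoff_root; have [[a ->]|[_ ->]] := pospart_cases (1 - d ^+ 4 * sqnorm x).
  by move=> b; rewrite (_ : 1 - _ = 0) ?mul0r//; lra.
by rewrite mul0r.
Qed.

(** On the support [d ^+ 2 * |x_i| <= 1], so half of the factor [d ^+ 4] compensates the
    coordinate. *)
Lemma dcutoff_le d i x : 0 < d <= 1 -> `|dcutoff d i x| <= 4 * d ^+ 2.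
Proof.
move=> /andP[d0 d1].
have d40 : 0 <= 4 * d ^+ 4 by rewrite mulr_ge0// exprn_ge0// ltW.
rewrite /dcutoff normrN normrM (ger0_norm (cutoff_root_ge0 _ _)) normrM (ger0_norm d40).
have [[a E]|[_ E]] := pospart_cases (1 - d ^+ 4 * sqnorm x); last first.
  by rewrite /cutoff_root E mulr0 mulr_ge0// exprn_ge0// ltW.
have h : d ^+ 4 * x ord0 i ^+ 2 <= 1.
  apply: (@le_trans _ _ (d ^+ 4 * sqnorm x)); last lra.
  by rewrite ler_wpM2l ?sqr_le_sqnorm// exprn_ge0// ltW.
have h2 : d ^+ 2 * `|x ord0 i| <= 1.
  have z0 : 0 <= d ^+ 2 * `|x ord0 i| by rewrite mulr_ge0// exprn_ge0// ltW.
  rewrite -(@expr_le1 _ 2)//.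
  by rewrite exprMn -exprM real_normK ?num_real.
have -> : 4 * d ^+ 4 * `|x ord0 i| * cutoff_root d x =
  4 * d ^+ 2 * (d ^+ 2 * `|x ord0 i| * cutoff_root d x) by ring.
have d20 : 0 <= d ^+ 2 by rewrite exprn_ge0// ltW.
rewrite -[leRHS]mulr1; apply: ler_wpM2l; first exact: mulr_ge0.
by rewrite mulr_ile1 ?(mulr_ge0 d20) ?cutoff_root_ge0 ?cutoff_root_le1.
Qed.

Lemma cutoff_root_cvg x (d_ : nat -> R) : d_ k @[k --> \oo] --> 0 ->
  cutoff_root (d_ k) x @[k --> \oo] --> (1 : R).
Proof.
move=> dc; have -> : 1 = cutoff_root 0 x :> R.
  by rewrite /cutoff_root expr0n/= mul0r subr0 /pospart max_r.
rewrite /cutoff_root; apply: continuous_cvg; first exact: pospart_continuous.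
apply: cvgB; first exact: cvg_cst.
apply: cvgM; last exact: cvg_cst.
exact: (cvg_comp d_ (fun y : R => y ^+ 4) dc (@exprn_continuous R 4 0)).
Qed.

End cutoff.

Section boxed_bounds.
Context {R : realType} {n : nat}.

Lemma boxed_unif_bounds (N : R) (k : 'I_n -> 'rV[R]_n -> R) :
  (forall i, continuous (k i)) -> (forall i, boxed N (k i)) ->
  exists L, forall i x, `|k i x| <= L.
Proof.
move=> kc k0; have /choice[L LP] i := boxed_bounded (kc i) (k0 i).
exists (\sum_i `|L i|) => i x.
apply: (le_trans (LP i x)); rewrite (bigD1 i)//=; apply: ler_wpDr.
  by apply: sumr_ge0 => j _.
exact: ler_norm.
Qed.

Lemma boxed_unif_continuous (N e : R) (k : 'I_n -> 'rV[R]_n -> R) : 0 < e ->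
  (forall i, continuous (k i)) -> (forall i, boxed N (k i)) ->
  exists2 d, 0 < d & forall x y : 'rV[R]_n, (forall i, `|x ord0 i - y ord0 i| < d) ->
    forall i, `|k i x - k i y| < e.
Proof.
move=> e0 kc k0.
have /choice[D DP] i : exists d, 0 < d /\ forall x y : 'rV[R]_n,
    (forall j, `|x ord0 j - y ord0 j| < d) -> `|k i x - k i y| < e.
  by have [d d0 dP] := unif_continuous_rV e0 (kc i) (k0 i); exists d.
exists (\big[Num.min/1]_i D i) => [|x y xy i].
  by apply: lt_bigmin => // i _; have [] := DP i.
apply: (DP i).2 => j; apply: (lt_le_trans (xy j)); exact: bigmin_le.
Qed.

End boxed_bounds.

(** * Extension to positive densities with integrable entropy and Fisher information *)

Section lsi.
Context {R : realType} {n : nat}.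
Variables (V g0 : 'rV[R]_n -> R) (dg0 : 'I_n -> 'rV[R]_n -> R) (kappa : R).
Local Notation leb := (lebesgue_rV n).
Let p x := expR (- V x).
Let h x := expR (g0 x).
Hypothesis kappa0 : 0 < kappa.
Hypothesis V_convex : forall s x y, 0 <= s <= 1 ->
  V ((1 - s) *: x + s *: y) <= (1 - s) * V x + s * V y
    - kappa / 2 * (s * (1 - s)) * sqnorm (x - y).
Hypothesis ip : leb.-integrable setT (EFin \o p).
Hypothesis p1 : \int[leb]_x p x = 1.
Hypothesis g0C : C1 g0 dg0.
Hypothesis ih : leb.-integrable setT (EFin \o (fun x => h x * p x)).
Hypothesis h1 : \int[leb]_x (h x * p x) = 1.
Hypothesis igh : leb.-integrable setT (EFin \o (fun x => g0 x * h x * p x)).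
Hypothesis idh : leb.-integrable setT (EFin \o (fun x => \sum_i dg0 i x ^+ 2 * h x * p x)).

Let hC : C1 h (fun i x => h x * dg0 i x).
Proof.
by apply: (C1_comp (k := expR) (dk := expR) g0C) => x; exact: continuous_expR.
Qed.

Let h0 x : 0 < h x. Proof. exact: expR_gt0. Qed.
Let p0 x : 0 < p x. Proof. exact: expR_gt0. Qed.

(* The approximant [hd d] is constant outside of a ball, and since [cutoff d] is
   a square, the term coming from its gradient has finite Fisher information. *)
Let hd d x := cutoff d x * h x + d.
Let dhd d i x := cutoff d x * (h x * dg0 i x) + h x * dcutoff d i x.
Let gd d x := ln (hd d x).
Let dgd d i x := (hd d x)^-1 * dhd d i x.

Let hd_gt0 d x : 0 < d -> 0 < hd d x.
Proof. by move=> d0; rewrite ltr_wpDl// mulr_ge0 ?cutoff_ge0// ltW. Qed.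

Let hd_le d x : 0 < d <= 1 -> hd d x <= h x + 1.
Proof.
move=> /andP[d0 d1]; apply: lerD => //.
by rewrite ger_pMl// cutoff_le1.
Qed.

Let hdC d : C1 (hd d) (dhd d).
Proof.
have := C1D (C1M (C1_cutoff d) hC) (C1_cst d).
by apply: C1_eq => // i x; rewrite addr0.
Qed.

Let gdC d : 0 < d -> C1 (gd d) (dgd d).
Proof.
move=> d0; apply: (C1_comp (k := @ln R) (dk := fun y => y^-1) (hdC d)) => x.
  exact/is_derive1_ln/hd_gt0.
by apply: inv_continuous; rewrite gt_eqF// hd_gt0.
Qed.

(** One factor [cutoff_root] comes out of both terms. It shows the compact support of the gradient,
    and its square cancels against [cutoff d x * h x <= hd d x] in the Fisher information. *)
Let dhdE d i x : dhd d i x = cutoff_root d x *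
  (cutoff_root d x * (h x * dg0 i x) - 4 * d ^+ 4 * x ord0 i * h x).
Proof. rewrite /dhd /dcutoff /cutoff; ring. Qed.

Let boxed_dgd d i : 0 < d -> boxed (d ^- 2) (dgd d i).
Proof.
move=> d0 x xi; have := boxed_cutoff_root (fun=> 1) d0 xi.
by rewrite mulr1 /dgd dhdE => ->; rewrite mul0r mulr0.
Qed.

Let boxed_hd d : 0 < d -> boxed (d ^- 2) (fun x => cutoff d x * h x).
Proof.
move=> d0 x xi; have := boxed_cutoff_root (fun=> 1) d0 xi.
by rewrite mulr1 /cutoff expr2 => ->; rewrite !mul0r.
Qed.

Let hd_bounded d : 0 < d -> exists K, forall x, `|hd d x| <= K.
Proof.
move=> d0; have [K KP] := boxed_bounded (k := fun x => cutoff d x * h x)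
  (C1_continuous (C1M (C1_cutoff d) hC)) (boxed_hd d0).
exists (K + d) => x; apply: (le_trans (ler_normD _ _)).
by rewrite (gtr0_norm d0) lerD2r.
Qed.

Let gd_bounded d : 0 < d -> exists K, forall x, `|gd d x| <= K.
Proof.
move=> d0; have [K KP] := hd_bounded d0.
exists (`|ln d| + `|ln K|) => x.
have l1 : ln d <= gd d x.
  rewrite ler_ln ?posrE ?hd_gt0// lerDr mulr_ge0 ?cutoff_ge0// ltW//.
have K0 : 0 < K by apply: lt_le_trans (KP x); rewrite normr_gt0 gt_eqF// hd_gt0.
have l2 : gd d x <= ln K.
  by rewrite ler_ln ?posrE ?hd_gt0// (le_trans (ler_norm _) (KP x)).
have := ler_norm (ln K); have := ler_norm (- ln d); rewrite normrN.
have := normr_ge0 (ln K); have := normr_ge0 (ln d).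
rewrite ler_norml => *; apply/andP; split; lra.
Qed.

Let A d := \int[leb]_x (hd d x * p x).

Let mhd d : measurable_fun setT (hd d).
Proof. by apply: continuous_measurable_rV; exact: (C1_continuous (hdC d)). Qed.

Let ihd d : 0 < d -> leb.-integrable setT (EFin \o (fun x => hd d x * p x)).
Proof.
move=> d0; have [K KP] := hd_bounded d0.
exact: (integrable_bounded_weight ip (fun x => ltW (p0 x)) (mhd d) KP).
Qed.

(** [lsi_bounded] asks for a probability density, hence the shift of [gd d] by [ln (A d)]. The
    gradient is unaffected, and multiplication by [A d] gives the stated form. *)
Let lsi_approx d : 0 < d ->
  \int[leb]_x (hd d x * gd d x * p x) - A d * ln (A d) <=
  (2 * kappa)^-1 * \int[leb]_x (\sum_i dhd d i x ^+ 2 / hd d x * p x).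
Proof.
move=> d0.
have [K KP] := gd_bounded d0.
have [K1 K1P] := hd_bounded d0.
have mgd : measurable_fun setT (gd d).
  by apply: continuous_measurable_rV; exact: (C1_continuous (gdC d0)).
have A0 : 0 < A d.
  have : d <= A d.
    rewrite -[leLHS]mulr1 -p1 -RintegralZl//; apply: le_Rintegral => //.
    - exact: integrableZr.
    - exact: ihd.
    by move=> x _; rewrite ler_wpM2r ?(ltW (p0 x))// lerDr mulr_ge0 ?cutoff_ge0// ltW.
  exact: lt_le_trans.
pose g x := gd d x - ln (A d).
have eg x : expR (g x) = hd d x / A d.
  by rewrite /g expRD expRN lnK ?posrE// lnK ?posrE ?hd_gt0.
have dc := C1_dcontinuous (gdC d0).
have [L LP] := boxed_unif_bounds dc (fun i => boxed_dgd i d0).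
have gd' x i : is_derive x (delta_mx ord0 i : 'rV[R]_n) g (dgd d i x).
  have := is_deriveB (C1_derive (gdC d0) x i)
    (is_derive_cst (ln (A d)) x (delta_mx ord0 i : 'rV[R]_n)).
  by rewrite subr0.
have mg : measurable_fun setT g by exact: measurable_funB.
have mdg i : measurable_fun setT (dgd d i) := continuous_measurable_rV (dc i).
have gK x : `|g x| <= K + `|ln (A d)|.
  by apply: (le_trans (ler_normB _ _)); rewrite lerD2r.
have uc e (e0 : 0 < e) := boxed_unif_continuous e0 dc (fun i => boxed_dgd i d0).
have E1 : \int[leb]_x (expR (g x) * expR (- V x)) = 1.
  under eq_Rintegral => x _ do rewrite eg mulrAC.
  by rewrite RintegralZr ?divff ?gt_eqF//; exact: ihd.
have := lsi_bounded kappa0 V_convex ip p1 gd' mg mdg gK LP uc E1.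
have i1 : leb.-integrable setT (EFin \o (fun x => hd d x * gd d x * p x)).
  apply: (@integrable_bounded_weight _ _ _ _ _ _ (K1 * K) ip).
  - by move=> x; exact: ltW.
  - exact: measurable_funM.
  - by move=> x; rewrite normrM ler_pM.
have E2 : \int[leb]_x (g x * expR (g x) * expR (- V x)) =
   (A d)^-1 * (\int[leb]_x (hd d x * gd d x * p x) - A d * ln (A d)).
  transitivity (\int[leb]_x ((A d)^-1 * (hd d x * gd d x * p x)
      + (- (ln (A d) / A d)) * (hd d x * p x))).
    apply: eq_Rintegral => x _; rewrite eg /g -/(p x); field.
    by rewrite gt_eqF.
  rewrite RintegralD//; last 2 first.
  - exact: integrableZr.
  - by apply: integrableZr; exact: ihd.
  rewrite !RintegralZl//; last exact: ihd.
  by rewrite -/(A d); field; rewrite gt_eqF.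
have E3 : \int[leb]_x (\sum_i dgd d i x ^+ 2 * expR (g x) * expR (- V x)) =
   (A d)^-1 * \int[leb]_x (\sum_i dhd d i x ^+ 2 / hd d x * p x).
  rewrite -RintegralZl//.
    apply: eq_Rintegral => x _; rewrite mulr_sumr; apply: eq_bigr => i _.
    rewrite eg /dgd -/(p x); field.
    by rewrite !gt_eqF// hd_gt0.
  rewrite (_ : _ \o _ = EFin \o (fun x => (\sum_i dgd d i x ^+ 2 * hd d x) * p x)).
    apply: (@integrable_bounded_weight _ _ _ _ _ _ (\sum_(i < n) (L ^+ 2 * K1)) ip).
    - by move=> x; exact: ltW.
    - apply: measurable_sum => i; apply: measurable_funM => //.
      by apply: measurable_funX; exact: continuous_measurable_rV (dc i).
    - move=> x; apply: (le_trans (ler_norm_sum _ _ _)); apply: ler_sum => i _.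
      rewrite normrM ler_pM// normrX ler_pXn2r// nnegrE.
      exact: le_trans (LP i x).
  apply/funext => x /=; congr EFin; rewrite mulr_suml; apply: eq_bigr => i _.
  rewrite /dgd; field; rewrite gt_eqF// hd_gt0//.
rewrite E2 E3 mulrCA ler_pM2l// invr_gt0//.
Qed.

Let d_ (k : nat) : R := harmonic k.

Let d_gt0 k : 0 < d_ k. Proof. by rewrite /d_ /harmonic/= invr_gt0. Qed.

Let d_le1 k : d_ k <= 1.
Proof. by rewrite /d_ /harmonic/= invf_le1// ler1n. Qed.

Let d_01 k : 0 < d_ k <= 1. Proof. by rewrite d_gt0 d_le1. Qed.

Let d_cvg : d_ k @[k --> \oo] --> 0. Proof. exact: cvg_harmonic. Qed.

Let cutoff_cvg (x : 'rV[R]_n) : cutoff (d_ k) x @[k --> \oo] --> (1 : R).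
Proof.
have := cutoff_root_cvg x d_cvg => m1.
rewrite -[X in _ --> X]mulr1 /cutoff.
by under eq_fun do rewrite expr2; exact: cvgM.
Qed.

Let hd_cvg (x : 'rV[R]_n) : hd (d_ k) x @[k --> \oo] --> h x.
Proof.
have -> : h x = 1 * h x + 0 by rewrite mul1r addr0.
exact: (cvgD (cvgM (@cutoff_cvg x) (cvg_cst (h x))) d_cvg).
Qed.

Let gd_cvg (x : 'rV[R]_n) : gd (d_ k) x @[k --> \oo] --> g0 x.
Proof.
have -> : g0 x = ln (h x) by rewrite expRK.
exact: (cvg_comp (fun k => hd (d_ k) x) (@ln R) (@hd_cvg x) (continuous_ln (h0 x))).
Qed.

Let dhd_cvg i (x : 'rV[R]_n) : dhd (d_ k) i x @[k --> \oo] --> h x * dg0 i x.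
Proof.
have dcut : dcutoff (d_ k) i x @[k --> \oo] --> (0 : R).
  apply/cvgrPdist_le => e e0; near=> k.
  rewrite sub0r normrN; apply: (le_trans (dcutoff_le i x (d_01 k))).
  apply: (@le_trans _ _ (4 * d_ k)).
    by rewrite ler_pM2l// expr2 ger_pMl.
  rewrite mulrC -ler_pdivlMr//.
  have : `|0 - d_ k| <= e / 4.
    near: k; have /cvgrPdist_le := d_cvg; apply; by rewrite divr_gt0.
  by rewrite sub0r normrN gtr0_norm.
have -> : h x * dg0 i x = 1 * (h x * dg0 i x) + h x * 0.
  by rewrite mul1r mulr0 addr0.
exact: (cvgD (cvgM (@cutoff_cvg x) (cvg_cst (h x * dg0 i x)))
  (cvgM (cvg_cst (h x)) dcut)).
Unshelve. all: by end_near. Qed.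

Let A_cvg : A (d_ k) @[k --> \oo] --> (1 : R).
Proof.
rewrite /A -[X in _ --> X]h1.
apply: (@Rintegral_dominated_cvg _ _ _ leb (fun k x => hd (d_ k) x * p x)
  (fun x => h x * p x) (fun x => h x * p x + p x)).
- move=> k; apply: measurable_funM => //; by apply/measurable_EFinP; exact: (measurable_int _ ip).
- by move=> x; exact: (cvgM (@hd_cvg x) (cvg_cst (p x))).
- exact: integrableDr.
- move=> k x; rewrite -[X in _ + X]mul1r -mulrDl normrM (gtr0_norm (p0 x)).
  by rewrite ler_wpM2r ?(ltW (p0 x))// gtr0_norm ?hd_gt0// hd_le.
Qed.

Let ent_cvg : \int[leb]_x (hd (d_ k) x * gd (d_ k) x * p x) @[k --> \oo] -->
  \int[leb]_x (g0 x * h x * p x).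
Proof.
have mp : measurable_fun setT p by apply/measurable_EFinP; exact: measurable_int ip.
apply: (@Rintegral_dominated_cvg _ _ _ leb
  (fun k x => hd (d_ k) x * gd (d_ k) x * p x) (fun x => g0 x * h x * p x)
  (fun x => `|g0 x * h x * p x| + (h x * p x + 2 * p x))).
- move=> k; apply: measurable_funM => //; apply: measurable_funM => //.
  by apply: continuous_measurable_rV; exact: (C1_continuous (gdC (d_gt0 k))).
- move=> x; rewrite (mulrC (g0 x)).
  exact: (cvgM (cvgM (@hd_cvg x) (@gd_cvg x)) (cvg_cst (p x))).
- apply: integrableDr; first exact: (integrable_norm igh).
  by apply: integrableDr => //; exact: integrableZr.
- move=> k x; rewrite !normrM (gtr0_norm (p0 x)) -!mulrDl.
  rewrite ler_wpM2r ?(ltW (p0 x))// -!normrM.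
  have := xlnx_bound (h0 x) (hd_gt0 x (d_gt0 k)) (hd_le x (d_01 k)).
  have -> : ln (h x) = g0 x by rewrite /h expRK.
  by move=> H; rewrite [leRHS]addrA (mulrC (g0 x)); exact: H.
Qed.

Let fisher_cvg : \int[leb]_x (\sum_i dhd (d_ k) i x ^+ 2 / hd (d_ k) x * p x)
    @[k --> \oo] --> \int[leb]_x (\sum_i dg0 i x ^+ 2 * h x * p x).
Proof.
have mp : measurable_fun setT p by apply/measurable_EFinP; exact: measurable_int ip.
apply: (@Rintegral_dominated_cvg _ _ _ leb
  (fun k x => \sum_i dhd (d_ k) i x ^+ 2 / hd (d_ k) x * p x)
  (fun x => \sum_i dg0 i x ^+ 2 * h x * p x)
  (* The constants come from [(u - 4 * w) ^+ 2 <= 2 * u ^+ 2 + 32 * w ^+ 2], where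
     [w = d ^+ 4 * x_i] satisfies [w ^+ 2 <= 1] on the support of the cutoff. *)
  (fun x => 2 * (\sum_i dg0 i x ^+ 2 * h x * p x) + \sum_(i < n) 32 * (h x * p x))).
- move=> k; apply: measurable_sum => i; apply: measurable_funM => //.
  apply: measurable_funM.
    apply: measurable_funX; exact: continuous_measurable_rV (C1_dcontinuous (hdC _) i).
  apply: continuous_measurable_rV => x; apply: continuous_comp.
    exact: C1_continuous (hdC _) x.
  by apply: inv_continuous; rewrite gt_eqF// hd_gt0.
- move=> x; apply: cvg_big => [|i _]; first exact: add_continuous.
  have -> : dg0 i x ^+ 2 * h x = (h x * dg0 i x) * (h x * dg0 i x) * (h x)^-1.
    by field; rewrite gt_eqF.
  under eq_fun do rewrite expr2.
  have h0' : h x != 0 by rewrite gt_eqF.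
  exact: (cvgM (cvgM (cvgM (@dhd_cvg i x) (@dhd_cvg i x)) (cvgV h0' (@hd_cvg x)))
    (cvg_cst (p x))).
- apply: integrableDr; first exact: integrableZr.
  rewrite (_ : (fun x => _) = (fun x => (\sum_(i < n) 32) * (h x * p x))).
    exact: integrableZr.
  by apply/funext => x; rewrite mulr_suml.
- move=> k x; apply: (le_trans (ler_norm_sum _ _ _)).
  rewrite mulr_sumr -big_split/=; apply: ler_sum => i _.
  have hd0 := hd_gt0 x (d_gt0 k).
  have -> : 2 * (dg0 i x ^+ 2 * h x * p x) + 32 * (h x * p x) =
    (2 * dg0 i x ^+ 2 * h x + 32 * h x) * p x by ring.
  rewrite normrM (gtr0_norm (p0 x)) ler_wpM2r ?(ltW (p0 x))//.
  rewrite normrM normrX real_normK ?num_real// normfV (gtr0_norm hd0).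
  rewrite ler_pdivrMr// dhdE exprMn.
  set m := cutoff_root _ x; set d := d_ k.
  have m0 : 0 <= m := cutoff_root_ge0 _ _.
  have rest : 0 <= 2 * dg0 i x ^+ 2 * h x + 32 * h x.
    have hx := ltW (h0 x).
    by apply: addr_ge0; apply: mulr_ge0 => //; apply: mulr_ge0 => //; exact: sqr_ge0.
  have hdm : m ^+ 2 * h x <= hd d x by rewrite lerDl ltW// d_gt0.
  apply: (@le_trans _ _ ((2 * dg0 i x ^+ 2 * h x + 32 * h x) * (m ^+ 2 * h x)));
    last exact: ler_wpM2l.
  have -> : (2 * dg0 i x ^+ 2 * h x + 32 * h x) * (m ^+ 2 * h x) =
    m ^+ 2 * ((2 * dg0 i x ^+ 2 + 32) * h x ^+ 2) by ring.
  have [/eqP mz|mz] := boolP (m == 0); first by rewrite mz expr0n/= !mul0r.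
  rewrite ler_wpM2l ?sqr_ge0//.
  have -> : m * (h x * dg0 i x) - 4 * d ^+ 4 * x ord0 i * h x =
    (m * dg0 i x - 4 * (d ^+ 4 * x ord0 i)) * h x by ring.
  rewrite exprMn ler_wpM2r ?sqr_ge0//.
  have w1 : (d ^+ 4 * x ord0 i) ^+ 2 <= 1.
    have sx : d ^+ 4 * sqnorm x <= 1.
      move: mz; rewrite /m /cutoff_root.
      have [[? ->]|[_ ->]] := pospart_cases (1 - d ^+ 4 * sqnorm x); last by rewrite eqxx.
      by rewrite -subr_ge0.
    have d40 : 0 <= d ^+ 4 by apply: exprn_ge0; apply: ltW; exact: d_gt0.
    have d41 : d ^+ 4 <= 1 by apply: exprn_ile1; [apply: ltW; exact: d_gt0|exact: d_le1].
    have := ler_wpM2l d40 (sqr_le_sqnorm x i) => e1.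
    rewrite exprMn expr2 -mulrA; apply: (@le_trans _ _ (d ^+ 4 * 1)); last by rewrite mulr1.
    by apply: ler_wpM2l => //; exact: le_trans sx.
  have mg : m ^+ 2 * dg0 i x ^+ 2 <= dg0 i x ^+ 2.
    by rewrite -[leRHS]mul1r ler_wpM2r ?sqr_ge0// cutoff_le1.
  have := sqr_ge0 (m * dg0 i x + 4 * (d ^+ 4 * x ord0 i)).
  rewrite -exprMn in mg; move: mg w1.
  set u := m * _; set w := d ^+ 4 * _ => mg w1; nra.
Unshelve. all: by []. Qed.

(** Both sides of [lsi_approx] pass to the limit; the normalising term [A * ln A] disappears since
    [A] tends to [1]. *)
Theorem lsi : \int[leb]_x (g0 x * h x * p x) <=
  (2 * kappa)^-1 * \int[leb]_x (\sum_i dg0 i x ^+ 2 * h x * p x).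
Proof.
have L : \int[leb]_x (hd (d_ k) x * gd (d_ k) x * p x) - A (d_ k) * ln (A (d_ k))
    @[k --> \oo] --> \int[leb]_x (g0 x * h x * p x).
  rewrite -[X in _ --> X]subr0 -(mulr0 1) -(@ln1 R); apply: cvgB; first exact: ent_cvg.
  apply: cvgM; first exact: A_cvg.
  exact: (cvg_comp (fun k => A (d_ k)) (@ln R) A_cvg (continuous_ln ltr01)).
have U : (2 * kappa)^-1 * \int[leb]_x (\sum_i dhd (d_ k) i x ^+ 2 / hd (d_ k) x * p x)
    @[k --> \oo] --> (2 * kappa)^-1 * \int[leb]_x (\sum_i dg0 i x ^+ 2 * h x * p x).
  by apply: cvgM; [exact: cvg_cst|exact: fisher_cvg].
by apply: (ler_cvg_to L U); apply: nearW => k; exact: lsi_approx (d_gt0 k).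
Qed.

End lsi.

(** * Dissipation of the free energy *)

Section dissipation_identity.
Context {R : realType} {n : nat}.
Variables (u mu : 'rV[R]_n -> R) (dmu : 'I_n -> 'rV[R]_n -> R).
Variable dw : 'I_n -> 'I_n -> 'rV[R]_n -> R.
Local Notation leb := (lebesgue_rV n).
Hypothesis muC : C1 mu dmu.
Hypothesis wC : forall j, C1 (fun x => u x * dmu j x) (fun i => dw i j).
Hypothesis u0 : forall x, 0 <= u x.
Let S x := \sum_i dw i i x.
Let E x := \sum_i dmu i x ^+ 2 * u x.
Hypothesis iu : leb.-integrable setT (EFin \o u).
Hypothesis iS : leb.-integrable setT (EFin \o (fun x => mu x * S x)).
Hypothesis iE : leb.-integrable setT (EFin \o E).

(* [th d] truncates the identity: [|th d s| <= min (|s|, 1 / d)]. *)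
Let th (d s : R) := s / (1 + d * s ^+ 2).
Let dth (d s : R) := (1 - d * s ^+ 2) / (1 + d * s ^+ 2) ^+ 2.

Let den_gt0 (d s : R) : 0 <= d -> 0 < 1 + d * s ^+ 2.
Proof. by move=> d0; rewrite ltr_pwDl// mulr_ge0// sqr_ge0. Qed.

Let is_derive_den d (s : R) : is_derive s 1 (fun s => 1 + d * s ^+ 2) (2 * d * s).
Proof.
apply: (@is_derive_quad _ _ _ _ `|d|) => h.
rewrite (_ : _ - _ - _ = d * h ^+ 2); last by ring.
by rewrite normrM (ger0_norm (sqr_ge0 h)).
Qed.

Let is_derive_th d (s : R) : 0 <= d -> is_derive s 1 (th d) (dth d s).
Proof.
move=> d0; have den := den_gt0 s d0.
have den0 : 1 + d * s ^+ 2 != 0 by rewrite gt_eqF.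
have h := is_deriveM (is_derive_id s 1) (is_deriveV (f := fun s => 1 + d * s ^+ 2) den0 (is_derive_den d s)).
suff -> : dth d s = s *: (- (1 + d * s ^+ 2) ^- 2 * (2 * d * s)) + (1 + d * s ^+ 2)^-1 *: 1 by [].
by rewrite /GRing.scale/= mulr1 /dth; field.
Qed.

Let th_le_abs d s : 0 <= d -> `|th d s| <= `|s|.
Proof.
move=> d0; have den := den_gt0 s d0.
rewrite normrM normfV (gtr0_norm den) ler_pdivrMr// ler_peMr//.
by rewrite lerDl mulr_ge0// sqr_ge0.
Qed.

Let th_le d s : 0 < d <= 1 -> `|th d s| <= d^-1.
Proof.
move=> /andP[d0 d1]; have den := den_gt0 s (ltW d0).
rewrite normrM normfV (gtr0_norm den) ler_pdivrMr// mulrC ler_pdivlMr//.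
rewrite -(real_normK (num_real s)); set a := `|s|.
have := mulr_ge0 (ltW d0) (sqr_ge0 (a - 1)).
have : 0 <= d * a := mulr_ge0 (ltW d0) (normr_ge0 s).
nra.
Qed.

Let dth_le d s : 0 <= d -> `|dth d s| <= 1.
Proof.
move=> d0; have den := den_gt0 s d0; have q : 0 <= d * s ^+ 2 by rewrite mulr_ge0// sqr_ge0.
rewrite normrM normfV (gtr0_norm (exprn_gt0 2 den)) ler_pdivrMr ?exprn_gt0// mul1r.
by rewrite ler_norml; apply/andP; split; nra.
Qed.

Let dth_continuous d : 0 <= d -> continuous (dth d).
Proof.
move=> d0 s; have den := den_gt0 s d0.
have c1 : d * t ^+ 2 @[t --> s] --> d * s ^+ 2.
  exact: (cvgM (cvg_cst d) (@exprn_continuous R 2 s)).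
have c2 : (1 + d * t ^+ 2 : R) @[t --> s] --> (1 + d * s ^+ 2 : R).
  by apply: cvgD; [exact: cvg_cst|exact: c1].
have c3 : ((1 + d * t ^+ 2) ^+ 2 : R) @[t --> s] --> ((1 + d * s ^+ 2) ^+ 2 : R).
  by under eq_fun do rewrite expr2; rewrite expr2; exact: (cvgM c2 c2).
have c4 : (1 - d * t ^+ 2 : R) @[t --> s] --> (1 - d * s ^+ 2 : R).
  by apply: cvgB; [exact: cvg_cst|exact: c1].
have den2 : (1 + d * s ^+ 2) ^+ 2 != 0 by rewrite expf_neq0// gt_eqF.
exact: (cvgM c4 (cvgV den2 c3)).
Qed.

Let thC d : 0 <= d -> C1 (fun x => th d (mu x)) (fun i x => dth d (mu x) * dmu i x).
Proof.
move=> d0; apply: (C1_comp (k := th d) muC) => x; first exact: is_derive_th.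
exact: dth_continuous.
Qed.

(** The terms of the divergence of the compactly supported field [cutoff d * th d mu * u * grad mu],
    that is, the case [j = i] of [pieceC]. *)
Let piece d i x := cutoff d x * th d (mu x) * dw i i x +
  u x * dmu i x * (cutoff d x * (dth d (mu x) * dmu i x) + th d (mu x) * dcutoff d i x).

Let pieceC d i : 0 <= d -> C1 (fun x => cutoff d x * th d (mu x) * (u x * dmu i x))
  (fun j x => cutoff d x * th d (mu x) * dw j i x +
    u x * dmu i x * (cutoff d x * (dth d (mu x) * dmu j x) + th d (mu x) * dcutoff d j x)).
Proof. by move=> d0; exact: (C1M (C1M (C1_cutoff d) (thC d0)) (wC i)). Qed.

Let piece_boxed d i : 0 < d ->
  boxed (d ^- 2) (fun x => cutoff d x * th d (mu x) * (u x * dmu i x)).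
Proof.
move=> d0 x xi; have := boxed_cutoff_root (fun=> 1) d0 xi.
by rewrite mulr1 /cutoff expr2 => ->; rewrite !mul0r.
Qed.

Let integral_piece d i : 0 < d -> (\int[leb]_x (piece d i x)%:E = 0)%E.
Proof.
move=> d0; have b := @piece_boxed d i d0.
have N0 : 0 < d ^- 2 by rewrite invr_gt0 exprn_gt0.
exact: (integral_partial_boxed i N0 (pieceC i (ltW d0)) b).
Qed.

Let integrable_piece d i : 0 < d -> leb.-integrable setT (EFin \o piece d i).
Proof.
move=> d0; have b := @piece_boxed d i d0; have c := pieceC i (ltW d0).
exact: (boxed_integrable (C1_dcontinuous c i) (boxed_derive i c b)).
Qed.

(** The divergence of the truncated field integrates to [0]. As [d] tends to [0] its three groups of
    terms tend to [mu * S], to [E] and, for the derivative of the cutoff, to [0]. *)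
Lemma dissipation_identity :
  \int[leb]_x (mu x * S x) = - \int[leb]_x (E x).
Proof.
pose d_ (k : nat) : R := harmonic k.
have d_gt0 k : 0 < d_ k by rewrite /d_ /harmonic/= invr_gt0.
have d_le1 k : d_ k <= 1 by rewrite /d_ /harmonic/= invf_le1// ler1n.
have d_01 k : 0 < d_ k <= 1 by rewrite d_gt0 d_le1.
have d_cvg : d_ k @[k --> \oo] --> 0 by exact: cvg_harmonic.
have cut x : cutoff (d_ k) x @[k --> \oo] --> (1 : R).
  have := @cutoff_root_cvg _ _ x _ d_cvg => m1.
  rewrite -[X in _ --> X]mulr1 /cutoff.
  by under eq_fun do rewrite expr2; exact: cvgM.
have dcut (i : 'I_n) x : dcutoff (d_ k) i x @[k --> \oo] --> (0 : R).
  apply/cvgrPdist_le => e e0; near=> k.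
  rewrite sub0r normrN; apply: (le_trans (dcutoff_le i x (d_01 k))).
  apply: (@le_trans _ _ (4 * d_ k)).
    by rewrite ler_pM2l// expr2 ger_pMl.
  rewrite mulrC -ler_pdivlMr//.
  have : `|0 - d_ k| <= e / 4.
    near: k; have /cvgrPdist_le := d_cvg; apply; by rewrite divr_gt0.
  by rewrite sub0r normrN gtr0_norm.
have den s : 1 + d_ k * s ^+ 2 @[k --> \oo] --> (1 : R).
  rewrite -[X in _ --> X]addr0 -[X in _ --> _ + X](mul0r (s ^+ 2)).
  by apply: cvgD; [exact: cvg_cst|exact: (cvgM d_cvg (cvg_cst (s ^+ 2)))].
have thc s : th (d_ k) s @[k --> \oo] --> s.
  rewrite -[X in _ --> X]divr1.
  by apply: cvgM; [exact: cvg_cst|exact: (cvgV (oner_neq0 R) (den s))].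
have dthc s : dth (d_ k) s @[k --> \oo] --> (1 : R).
  have num : 1 - d_ k * s ^+ 2 @[k --> \oo] --> (1 : R).
    rewrite -[X in _ --> X]subr0 -[X in _ --> _ - X](mul0r (s ^+ 2)).
    by apply: cvgB; [exact: cvg_cst|exact: (cvgM d_cvg (cvg_cst (s ^+ 2)))].
  have den2 : (1 + d_ k * s ^+ 2) ^+ 2 @[k --> \oo] --> (1 : R).
    rewrite -[X in _ --> X]mulr1; under eq_fun do rewrite expr2.
    exact: (cvgM (den s) (den s)).
  rewrite -[X in _ --> X]divr1.
  exact: (cvgM num (cvgV (oner_neq0 R) den2)).
pose P k x := \sum_i piece (d_ k) i x.
have PE k x : P k x = cutoff (d_ k) x * th (d_ k) (mu x) * S x +
    \sum_i (cutoff (d_ k) x * dth (d_ k) (mu x) * (dmu i x ^+ 2 * u x) +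
      th (d_ k) (mu x) * dcutoff (d_ k) i x * (u x * dmu i x)).
  rewrite /P /S mulr_sumr -big_split/=; apply: eq_bigr => i _.
  rewrite /piece; ring.
have P0 k : \int[leb]_x P k x = 0.
  rewrite /Rintegral /P; under eq_integral do rewrite -sumEFin.
  rewrite integral_sum//=; last by move=> i; exact: integrable_piece.
  by rewrite big1// => i _; exact: integral_piece.
have mP k : measurable_fun setT (P k).
  apply: measurable_sum => i; apply/measurable_EFinP.
  exact: measurable_int (integrable_piece i (d_gt0 k)).
(* One summand for each group in [PE]: [|th| <= |mu|] gives the first and [|dth| <= 1] the second;
   the rest comes from [|th * dcutoff| <= 4] and [|dmu i| <= 1 + dmu i ^+ 2]. *)
pose G x := `|mu x * S x| + (E x + (\sum_(i < n) 4 * u x + 4 * E x)).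
have iG : leb.-integrable setT (EFin \o G).
  apply: integrableDr; first exact: (integrable_norm iS).
  apply: integrableDr => //; apply: integrableDr; last exact: integrableZr.
  rewrite (_ : (fun x => _) = (fun x => (\sum_(i < n) 4) * u x)).
    exact: integrableZr.
  by apply/funext => x; rewrite mulr_suml.
have Pcv x : P k x @[k --> \oo] --> mu x * S x + E x.
  under eq_fun do rewrite PE.
  apply: cvgD.
    rewrite [X in _ --> X](_ : _ = 1 * mu x * S x); last by rewrite mul1r.
    apply: cvgM; last exact: cvg_cst.
    by apply: cvgM; [exact: cut|exact: thc].
  apply: cvg_big => [|i _]; first exact: add_continuous.
  rewrite [X in _ --> X](_ : _ = 1 * 1 * (dmu i x ^+ 2 * u x) +
    mu x * 0 * (u x * dmu i x)); last by rewrite mulr0 mul0r addr0 !mul1r.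
  apply: cvgD; (apply: cvgM; last exact: cvg_cst).
    by apply: cvgM; [exact: cut|exact: dthc].
  by apply: cvgM; [exact: thc|exact: dcut].
have PG k x : `|P k x| <= G x.
  rewrite PE; apply: (le_trans (ler_normD _ _)); apply: lerD.
    rewrite normrM (normrM (mu x)) ler_wpM2r// normrM (ger0_norm (cutoff_ge0 _ _)).
    rewrite -[leRHS]mul1r; apply: ler_pM => //; [exact: cutoff_ge0|exact: cutoff_le1|].
    by apply: th_le_abs; exact: ltW.
  apply: (le_trans (ler_norm_sum _ _ _)).
  rewrite /E mulr_sumr -!big_split/=; apply: ler_sum => i _.
  apply: (le_trans (ler_normD _ _)); apply: lerD.
    have q0 : 0 <= dmu i x ^+ 2 * u x by rewrite mulr_ge0 ?sqr_ge0.
    rewrite normrM (ger0_norm q0) -[leRHS]mul1r ler_wpM2r// normrM.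
    rewrite (ger0_norm (cutoff_ge0 _ _)) -[leRHS]mul1r.
    by apply: ler_pM => //; [exact: cutoff_ge0|exact: cutoff_le1|by apply: dth_le; exact: ltW].
  rewrite normrM (normrM (u x)) (ger0_norm (u0 x)).
  have t1 : `|th (d_ k) (mu x) * dcutoff (d_ k) i x| <= 4.
    rewrite normrM; apply: (@le_trans _ _ ((d_ k)^-1 * (4 * d_ k ^+ 2))).
      by apply: ler_pM => //; [exact: th_le|exact: dcutoff_le].
    have dk0 : d_ k != 0 by rewrite gt_eqF.
    rewrite mulrCA expr2 mulKf//.
    by rewrite -[leRHS]mulr1 ler_pM2l.
  apply: (@le_trans _ _ (4 * (u x * `|dmu i x|))).
    by rewrite ler_wpM2r// mulr_ge0.
  rewrite -mulrDr ler_pM2l// (mulrC _ (u x)) -[X in _ <= X + _]mulr1 -mulrDr.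
  rewrite ler_wpM2l// -(real_normK (num_real (dmu i x))).
  by set a := `|_|; nra.
have := Rintegral_dominated_cvg mP Pcv iG PG.
under eq_fun do rewrite P0.
move=> /(cvg_unique (@Rhausdorff R)) /(_ (cvg_cst 0)).
rewrite RintegralD// => /eqP; rewrite addr_eq0 => /eqP ->.
Unshelve. all: by end_near. Qed.

End dissipation_identity.

(** * From joint smoothness in space and time to [C1] slices *)

Section smooth_slices.
Context {R : realType} {n : nat}.
Local Notation e_ i := (delta_mx ord0 i : 'rV[R]_n).
Local Notation V := ('rV[R]_n * R)%type.

Lemma is_derive_slice (K : V -> R) (x v : 'rV[R]_n) (t d : R) :
  is_derive ((x, t) : V) ((v, 0) : V) K d -> is_derive x v (fun y => K (y, t)) d.
Proof.
have E : (fun h : R => h^-1 *: (K (h *: ((v, 0) : V) + ((x, t) : V)) - K (x, t))) =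
         (fun h : R => h^-1 *: (K (h *: v + x, t) - K (x, t))).
  apply/funext => h; congr (_ *: (K _ - _)).
  by apply/pair_eqP; rewrite /= scaler0 add0r !eqxx.
by case; rewrite /derivable /derive => H <-; apply: DeriveDef;
  rewrite /derivable /derive/= -?E.
Qed.

Lemma is_derive_time (K : V -> R) (x : 'rV[R]_n) (t d : R) :
  is_derive ((x, t) : V) ((0, 1) : V) K d -> is_derive t 1 (fun s => K (x, s)) d.
Proof.
have E : (fun h : R => h^-1 *: (K (h *: ((0, 1) : V) + ((x, t) : V)) - K (x, t))) =
         (fun h : R => h^-1 *: (K (x, h *: 1 + t) - K (x, t))).
  apply/funext => h; congr (_ *: (K _ - _)).
  by apply/pair_eqP; rewrite /= scaler0 add0r !eqxx.
by case; rewrite /derivable /derive => H <-; apply: DeriveDef;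
  rewrite /derivable /derive/= -?E.
Qed.

(** The list [vs] lets one statement cover the solution and its spatial derivatives alike. *)
Lemma smooth_slice_C1 (F : V -> R) (vs : seq V) (t : R) : 0 < t ->
  smooth_on [set p : V | 0 < p.2] F ->
  let K := foldr (fun v k => 'D_v k) F vs in
  C1 (fun x => K (x, t)) (fun i x => 'D_((e_ i, 0) : V) K (x, t)).
Proof.
move=> t0 sF /=.
have cont us : continuous (fun x => foldr (fun v k => 'D_v k) F us (x, t)).
  move=> x; have [c _] := sF us (x, t) t0.
  have cp : (y, t) @[y --> x] --> ((x, t) : V).
    move=> A /nbhs_ballP[e /= e0 eA]; apply/nbhs_ballP; exists e => //= y xy.
    by apply: eA; split => //=; exact: ballxx.
  exact: (cvg_comp (fun y => (y, t)) _ cp c).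
split; first exact: cont.
- move=> x i; apply: is_derive_slice; apply/derivableP.
  by have [_] := sF vs (x, t) t0; apply.
- by move=> i; exact: (cont ((e_ i, 0) :: vs)).
Qed.

Lemma smooth_C1 (phi : 'rV[R]_n -> R) (vs : seq 'rV[R]_n) : smooth_on setT phi ->
  let k := foldr (fun v k => 'D_v k) phi vs in C1 k (fun i => partial i k).
Proof.
move=> sphi /=; split.
- by move=> x; have [] := sphi vs x I.
- by move=> x i; apply/derivableP; have [_] := sphi vs x I; apply.
- by move=> i x; have [] := sphi (e_ i :: vs) x I.
Qed.

End smooth_slices.

(** * Entropy against L^1 distance, and exponential decay from a differential inequality *)

Section real_inequalities.
Context {R : realType}.

(* A weak form of the Csiszar-Kullback-Pinsker inequality: the relative entropy
   dominates the squared Hellinger distance. *)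
Lemma abs_sub_le_entropy (a f p : R) : 0 < a -> 0 < f -> 0 < p ->
  `|f - p| <= a / 2 * (f * ln (f / p) - f + p) + a^-1 * (f + p).
Proof.
move=> a0 f0 p0; set s := Num.sqrt f; set q := Num.sqrt p.
have s0 : 0 < s by rewrite sqrtr_gt0.
have q0 : 0 < q by rewrite sqrtr_gt0.
have fE : f = s ^+ 2 by rewrite sqr_sqrtr// ltW.
have pE : p = q ^+ 2 by rewrite sqr_sqrtr// ltW.
have lE : ln (f / p) = - (2 * ln (q / s)).
  rewrite mulr_natl -lnXn ?divr_gt0// -lnV ?posrE ?exprn_gt0 ?divr_gt0//; congr ln.
  by rewrite fE pE; field; rewrite !gt_eqF.
have lq := ln_le_subr1 (divr_gt0 q0 s0).
(* Since [f * ln (f / p) = - 2 * s ^+ 2 * ln (q / s)], the bound [ln y <= y - 1] at [y = q / s]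
   leaves a perfect square. *)
have H : (s - q) ^+ 2 <= f * ln (f / p) - f + p.
  have := ler_wpM2l (sqr_ge0 s) lq; rewrite lE fE pE.
  have -> : s ^+ 2 * (q / s - 1) = s * q - s ^+ 2 by field; rewrite gt_eqF.
  nra.
have -> : `|f - p| = `|s - q| * (s + q).
  by rewrite fE pE subr_sqr normrM (gtr0_norm (addr_gt0 s0 q0)).
apply: (@le_trans _ _ (a / 2 * (s - q) ^+ 2 + a^-1 * (f + p))); last first.
  by rewrite lerD2r ler_pM2l// divr_gt0.
rewrite -(real_normK (num_real (s - q))); set b := `|s - q|.
have c0 : 0 < s + q by lra.
(* Young's inequality with weight [a], followed by [(s + q) ^+ 2 <= 2 * (f + p)]. *)
apply: (@le_trans _ _ (a / 2 * b ^+ 2 + (2 * a)^-1 * (s + q) ^+ 2)).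
  rewrite -subr_ge0.
  have -> : a / 2 * b ^+ 2 + (2 * a)^-1 * (s + q) ^+ 2 - b * (s + q) =
    (2 * a)^-1 * (a * b - (s + q)) ^+ 2 by field; rewrite gt_eqF.
  by rewrite mulr_ge0 ?sqr_ge0// invr_ge0 mulr_ge0// ltW.
rewrite lerD2l invfM mulrAC [leRHS]mulrC ler_pM2r ?invr_gt0//.
have := sqr_ge0 (s - q); rewrite fE pE; lra.
Qed.

(** [H t * exp (l * t)] is nonincreasing on positive times, hence bounded by its right limit at [0];
    the initial value enters only through this limit. *)
Lemma gronwall_decay (H dH : R -> R) (l H0 : R) :
  (forall t : R, 0 < t -> is_derive t 1 H (dH t)) ->
  (forall t, 0 < t -> dH t <= - (l * H t)) ->
  H t @[t --> 0^'+] --> H0 ->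
  forall t, 0 < t -> H t <= H0 * expR (- (l * t)).
Proof.
move=> Hd dHle Hc t t0.
pose L s := H s * expR (l * s).
pose dL s := H s *: (l * expR (l * s)) + expR (l * s) *: dH s.
have Ld (s : R) : 0 < s -> is_derive s 1 L (dL s).
  move=> s0; apply: is_deriveM; first exact: Hd.
  have h : is_derive s 1 (fun s : R => l * s) l.
    have := is_deriveZ l (is_derive_id s (1 : R)).
    by rewrite /GRing.scale/= mulr1.
  have := is_derive1_comp (f := expR) (is_derive_expR _) h.
  by rewrite mulrC.
have Lmono s : 0 < s -> s <= t -> L t <= L s.
  move=> s0 st.
  have [||c cI] := @MVT_segment R L dL s t st.
  - by move=> x; rewrite in_itv/= => /andP[sx _]; apply: Ld; exact: lt_trans sx.
  - apply: derivable_within_continuous => x; rewrite in_itv/= => /andP[sx _].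
    by have [] := Ld x (lt_le_trans s0 sx).
  move=> E; have c0 : 0 < c.
    by move: cI; rewrite in_itv/= => /andP[sc _]; exact: lt_le_trans sc.
  rewrite -subr_le0 E; apply: mulr_le0_ge0; last by rewrite subr_ge0.
  rewrite /dL /GRing.scale/= (_ : _ + _ = expR (l * c) * (dH c + l * H c)); last by ring.
  rewrite pmulr_rle0 ?expR_gt0//; have := dHle c c0; lra.
have Lc : L s @[s --> 0^'+] --> H0.
  rewrite [X in _ --> X](_ : _ = H0 * expR (l * 0)); last by rewrite mulr0 expR0 mulr1.
  apply: cvgM; first exact: Hc.
  apply: cvg_at_right_filter.
  have cl : l * s @[s --> (0 : R)] --> l * 0 by apply: cvgM; [exact: cvg_cst|exact: cvg_id].
  exact: (cvg_comp (fun s => l * s) (@expR R) cl (@continuous_expR R _)).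
have : L t <= H0.
  apply: (ler_cvg_to (cvg_cst (L t)) Lc).
  near=> s; apply: Lmono; first by [].
  by near: s; exact: nbhs_right_le.
by rewrite /L expRN -ler_pdivlMr ?expR_gt0.
Unshelve. all: by end_near. Qed.

End real_inequalities.

(** * The potential and its equilibrium *)

Section potential.
Context {R : realType} {n : nat}.
Variables (D lambda C0 : R) (phi : 'rV[R]_n -> R).
Local Notation leb := (lebesgue_rV n).
Local Notation V := (fun x : 'rV[R]_n => (phi x - C0) / D).
Hypothesis D0 : 0 < D.
Hypothesis sphi : smooth_on setT phi.
Hypothesis hess : forall x : 'rV[R]_n, loewner_le lambda%:M (hessian phi x).

(** The equilibrium is [exp (- V)], and the division by [D] in [V] changes the convexity constant
    [lambda] of [phi] into [lambda / D]. *)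
Lemma potential_convex s x y : 0 <= s <= 1 ->
  V ((1 - s) *: x + s *: y) <= (1 - s) * V x + s * V y
    - lambda / D / 2 * (s * (1 - s)) * sqnorm (x - y).
Proof.
move=> s01.
have phiC := smooth_C1 [::] sphi.
have dphiC j := smooth_C1 [:: delta_mx ord0 j] sphi.
have h z v : lambda * sqnorm v <=
    \sum_i \sum_j v ord0 i * v ord0 j * partial i (partial j phi) z.
  have := hess z v; rewrite mul_mx_scalar -scalemxAl !mxE.
  have -> : \sum_j v ord0 j * v^T j ord0 = sqnorm v.
    by apply: eq_bigr => j _; rewrite mxE expr2.
  move=> /le_trans; apply; rewrite le_eqVlt; apply/orP; left; apply/eqP.
  rewrite exchange_big/=; apply: eq_bigr => j _; rewrite !mxE mulr_suml.
  by apply: eq_bigr => i _; rewrite !mxE; ring.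
have := strong_convexity phiC dphiC h x y s01.
set z := (1 - s) *: x + s *: y => H.
rewrite /= ler_pdivrMr//.
have -> : ((1 - s) * ((phi x - C0) / D) + s * ((phi y - C0) / D)
    - lambda / D / 2 * (s * (1 - s)) * sqnorm (x - y)) * D =
  (1 - s) * phi x + s * phi y - lambda / 2 * (s * (1 - s)) * sqnorm (x - y) - C0.
  by field; rewrite gt_eqF.
by rewrite lerD2r.
Qed.

Hypothesis eq1 : (\int[leb]_x (equilibrium D phi C0 x)%:E = 1)%E.

Lemma measurable_potential : measurable_fun setT phi.
Proof.
by apply: continuous_measurable_rV; exact: C1_continuous (smooth_C1 [::] sphi).
Qed.

Lemma integrable_prob (g : 'rV[R]_n -> R) : measurable_fun setT g ->
  (forall x, 0 <= g x) -> (\int[leb]_x (g x)%:E = 1)%E ->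
  leb.-integrable setT (EFin \o g).
Proof.
move=> mg g0 g1; apply/integrableP; split; first exact/measurable_EFinP.
under eq_integral do rewrite /= ger0_norm//.
by rewrite g1 ltry.
Qed.

Lemma integrable_equilibrium : leb.-integrable setT (EFin \o equilibrium D phi C0).
Proof.
apply: integrable_prob => //; last by move=> x; exact: expR_ge0.
apply: measurableT_comp => //; apply: measurableT_comp => //.
apply: measurable_funM => //; apply: measurable_funB => //.
exact: measurable_potential.
Qed.

Lemma Rintegral_equilibrium : \int[leb]_x equilibrium D phi C0 x = 1.
Proof. by rewrite /Rintegral eq1. Qed.

(** At the equilibrium [D * ln f + phi] is the constant [C0], so the energy density is [C0 - D]
    times a density of mass [1]. *)
Lemma free_energy_equilibrium :
  free_energy D phi (equilibrium D phi C0) = (C0 - D)%:E.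
Proof.
rewrite /free_energy; under eq_integral => x _.
  rewrite (_ : energy_density _ _ _ x = (C0 - D) * equilibrium D phi C0 x).
    rewrite EFinM; over.
  rewrite /energy_density /equilibrium expRK; field; by rewrite gt_eqF.
by rewrite integralZl// ?eq1 ?mule1//; exact: integrable_equilibrium.
Qed.

End potential.

(** * Estimates at a fixed positive time *)

Section at_time.
Context {R : realType} {n : nat}.
Variables (D C0 lambda : R) (phi f0 : 'rV[R]_n -> R) (f : 'rV[R]_n -> R -> R).
Local Notation leb := (lebesgue_rV n).
Local Notation e_ i := (delta_mx ord0 i : 'rV[R]_n).
Local Notation p := (equilibrium D phi C0).
Hypothesis D0 : 0 < D.
Hypothesis lambda0 : 0 < lambda.
Hypothesis sphi : smooth_on setT phi.
Hypothesis hess : forall x : 'rV[R]_n, loewner_le lambda%:M (hessian phi x).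
Hypothesis sol : classical_solution D phi f0 f.
Hypothesis reg : regular_solution D phi f0 f.
Hypothesis eq1 : (\int[leb]_x (p x)%:E = 1)%E.

Definition energy (t : R) : R := \int[leb]_x energy_density D phi (f ^~ t) x.
Definition potential_mu (t : R) (x : 'rV[R]_n) : R := D * ln (f x t) + phi x.

Variable t : R.
Hypothesis t0 : 0 < t.
Let u x := f x t.
Let mu := potential_mu t.
Let F (q : 'rV[R]_n * R) := f q.1 q.2.
Let du i (x : 'rV[R]_n) := 'D_((e_ i, 0) : 'rV[R]_n * R) F (x, t).
Let ddu j i (x : 'rV[R]_n) :=
  'D_((e_ j, 0) : 'rV[R]_n * R) ('D_((e_ i, 0) : 'rV[R]_n * R) F) (x, t).
Let dphi i := partial i phi.
Let dmu i x := D * ((u x)^-1 * du i x) + dphi i x.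
(** The derivative of [u * dmu i] in the form [D * du i + u * dphi i], where the quotient by [u] has
    cancelled. *)
Let dw j i x := D * ddu j i x + (u x * partial j (partial i phi) x + dphi i x * du j x).
Let S x := \sum_i dw i i x.
Let E x := \sum_i dmu i x ^+ 2 * u x.

Let u0 x : 0 < u x. Proof. exact: (sol_positive sol x (ltW t0)). Qed.

Let uC : C1 u du.
Proof. exact: (smooth_slice_C1 [::] t0 (sol_smooth sol)). Qed.

Let duC i : C1 (du i) (fun j => ddu j i).
Proof. exact: (smooth_slice_C1 [:: (e_ i, 0)] t0 (sol_smooth sol)). Qed.

Let phiC : C1 phi dphi.
Proof. exact: (smooth_C1 [::] sphi). Qed.

Let dphiC i : C1 (dphi i) (fun j => partial j (partial i phi)).
Proof. exact: (smooth_C1 [:: e_ i] sphi). Qed.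

Let muC : C1 mu dmu.
Proof.
have lnC : C1 (fun x => ln (u x)) (fun i x => (u x)^-1 * du i x).
  apply: (C1_comp (k := @ln R) (dk := fun y => y^-1) uC) => x.
    exact: is_derive1_ln.
  by apply: inv_continuous; rewrite gt_eqF.
exact: (C1D (C1Z D lnC) phiC).
Qed.

Let wC i : C1 (fun x => u x * dmu i x) (fun j => dw j i).
Proof.
have := C1D (C1Z D (duC i)) (C1M uC (dphiC i)); apply: C1_eq => // x.
by rewrite /dmu; field; rewrite gt_eqF.
Qed.

Let mu_meas : measurable_fun setT u.
Proof. by apply: continuous_measurable_rV; exact: C1_continuous uC. Qed.

Let u1 : (\int[leb]_x (u x)%:E = 1)%E.
Proof. exact: (sol_mass sol (ltW t0)). Qed.

Let iu : leb.-integrable setT (EFin \o u).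
Proof. by apply: integrable_prob => // x; exact: ltW. Qed.

Let velocityE x i : velocity D phi (f ^~ t) x ord0 i = - dmu i x.
Proof. by rewrite /velocity !mxE (C1_partial i muC). Qed.

Let time_derive x : is_derive t 1 (f x) (S x).
Proof.
have dt : is_derive t 1 (f x) ('D_((0, 1) : 'rV[R]_n * R) F (x, t)).
  apply: (is_derive_time (K := F)); apply/derivableP.
  by have [_] := sol_smooth sol [::] (x := (x, t)) t0; apply.
have := sol_equation sol x t0; rewrite derive1E (@derive_val _ _ _ _ _ _ _ dt).
have -> : divergence (fun y => f y t *: velocity D phi (f ^~ t) y) x = - S x.
  rewrite /divergence /S -sumrN; apply: eq_bigr => i _.
  have -> : (fun y => (f y t *: velocity D phi (f ^~ t) y) ord0 i) =
      (fun y => - 1 * (u y * dmu i y)).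
    by apply/funext => y; rewrite mxE velocityE /u; ring.
  by rewrite (C1_partial i (C1Z (-1) (wC i))) mulN1r.
by move/eqP; rewrite subr_eq0 => /eqP <-.
Qed.

(** [mu] is the derivative of [y |-> D * y * (ln y - 1) + y * phi x] at [y = u x], and by the
    equation [S] is the time derivative of the solution. *)
Lemma is_derive_energy_density x :
  is_derive t 1 (fun r => energy_density D phi (f ^~ r) x) (mu x * S x).
Proof.
pose k (y : R) := D * y * (ln y - 1) + y * phi x.
have kd : is_derive (f x t) 1 k (mu x).
  have fx : 0 < f x t := u0 x.
  have h1 : is_derive (f x t) 1 (cst D * id * (@ln R - cst 1) + id * cst (phi x) : R -> R) (mu x).
    have h := is_derive1_ln fx.
    apply: is_derive_eq.
    rewrite /GRing.scale/= !fctE/= /mu /potential_mu; field; by rewrite gt_eqF.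
  exact: h1.
exact: (is_derive1_comp kd (time_derive x)).
Qed.

Let iE : leb.-integrable setT (EFin \o E).
Proof.
have mE : measurable_fun setT E.
  apply: measurable_sum => i; apply: measurable_funM => //; apply: measurable_funX.
  by apply: continuous_measurable_rV; exact: C1_dcontinuous muC i.
have E0 x : 0 <= E x by apply: sumr_ge0 => i _; rewrite mulr_ge0 ?sqr_ge0// ltW.
apply/integrableP; split; first exact/measurable_EFinP.
apply: le_lt_trans (reg_dissipation reg t0).
rewrite le_eqVlt; apply/orP; left; apply/eqP; apply: eq_integral => x _ /=.
rewrite ger0_norm//; congr EFin; rewrite /E /sqnorm mulr_suml; apply: eq_bigr => i _.
by rewrite velocityE sqrrN.
Qed.

(** [mu * S] is the time derivative of the energy density, which the regularity hypothesis dominates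
    near [t], in particular at [t] itself. *)
Let iS : leb.-integrable setT (EFin \o (fun x => mu x * S x)).
Proof.
have [e [G [e0 iG GP]]] := reg_derivative reg t0.
apply: (le_integrable measurableT _ _ iG).
  apply/measurable_EFinP; apply: measurable_funM.
    by apply: continuous_measurable_rV; exact: C1_continuous muC.
  apply: measurable_sum => i; apply: continuous_measurable_rV.
  exact: C1_dcontinuous (wC i) i.
move=> x _ /=; rewrite lee_fin.
have := GP x t; rewrite subrr normr0 => /(_ e0).
rewrite derive1E (@derive_val _ _ _ _ _ _ _ (is_derive_energy_density x)).
by move=> /le_trans; apply; exact: ler_norm.
Qed.

Definition dissipation_at : R := \int[leb]_x E x.

Let mu_S : \int[leb]_x (mu x * S x) = - dissipation_at.
Proof.
by apply: (dissipation_identity muC wC _ iu iS iE) => x; exact: ltW.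
Qed.

Let ien : leb.-integrable setT (EFin \o energy_density D phi (f ^~ t)).
Proof. exact: (reg_energy reg t0). Qed.

(** The logarithm of [u] relative to the equilibrium, equal to [(mu - C0) / D]; this is the function
    to which [lsi] is applied. *)
Let g0 x := ln (u x) + (phi x - C0) / D.

Let g0E x : energy_density D phi (f ^~ t) x = D * (g0 x * u x) + (C0 - D) * u x.
Proof. by rewrite /energy_density /g0 -/(u x); field; rewrite gt_eqF. Qed.

Let ig0 : leb.-integrable setT (EFin \o (fun x => g0 x * u x)).
Proof.
have := integrableZr D^-1 (integrableDr ien (integrableZr (- (C0 - D)) iu)).
congr (_.-integrable _ _); apply/funext => x /=; congr EFin; rewrite g0E; field.
by rewrite gt_eqF.
Qed.

Let Ru1 : \int[leb]_x u x = 1. Proof. by rewrite /Rintegral u1. Qed.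

(** The excess of free energy over the equilibrium value [C0 - D] is [D] times the relative entropy,
    because [u] has mass [1]. *)
Lemma energy_entropy : energy t - (C0 - D) = D * \int[leb]_x (g0 x * u x).
Proof.
rewrite /energy; under eq_Rintegral => x _ do rewrite g0E.
rewrite RintegralD//; [|exact: integrableZr|exact: integrableZr].
by rewrite !RintegralZl// Ru1 mulr1 addrK.
Qed.

Let hp x : expR (g0 x) * expR (- ((phi x - C0) / D)) = u x.
Proof. by rewrite -expRD /g0 addrK lnK// posrE. Qed.

(** The powers of [D] cancel: one from [energy_entropy], one from the constant [lambda / D] in
    [lsi], and two from the gradient [grad mu / D] of [g0]. *)
Lemma energy_le_dissipation :
  energy t - (C0 - D) <= (2 * lambda)^-1 * dissipation_at.
Proof.
have ip := integrable_equilibrium sphi eq1.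
have p1 := Rintegral_equilibrium eq1.
have kappa0 : 0 < lambda / D by rewrite divr_gt0.
have g0C : C1 g0 (fun i x => D^-1 * dmu i x).
  have := C1D (C1Z D^-1 muC) (C1_cst (- C0 / D)); apply: C1_eq => [x|i x].
    by rewrite /mu /potential_mu /g0 -/(u x); field; rewrite gt_eqF.
  by rewrite addr0.
have E1 : (fun x => expR (g0 x) * expR (- ((phi x - C0) / D))) = u.
  by apply/funext => x; exact: hp.
have E2 : (fun x => g0 x * expR (g0 x) * expR (- ((phi x - C0) / D))) =
    (fun x => g0 x * u x).
  by apply/funext => x; rewrite -mulrA hp.
have E3 : (fun x => \sum_i (D^-1 * dmu i x) ^+ 2 * expR (g0 x) * expR (- ((phi x - C0) / D))) =
    (fun x => D ^- 2 * E x).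
  apply/funext => x; rewrite /E mulr_sumr; apply: eq_bigr => i _.
  by rewrite -mulrA hp; field; rewrite gt_eqF.
have := @lsi R n (fun x => (phi x - C0) / D) g0 (fun i x => D^-1 * dmu i x) (lambda / D)
  kappa0 (@potential_convex R n D lambda C0 phi D0 sphi hess) ip p1 g0C.
rewrite E1 E2 E3 RintegralZl//.
move=> /(_ iu Ru1 ig0 (integrableZr _ iE)) H.
rewrite energy_entropy; apply: (le_trans (ler_wpM2l (ltW D0) H)).
rewrite /dissipation_at le_eqVlt; apply/orP; left; apply/eqP; field.
by rewrite !gt_eqF.
Qed.

(** Pointwise [g0 * u >= u - p], by [exp (- y) >= 1 - y] and [p = exp (- g0) * u]; both densities
    have mass [1]. *)
Lemma entropy_ge0 : 0 <= energy t - (C0 - D).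
Proof.
rewrite energy_entropy mulr_ge0 ?(ltW D0)//.
have ip := integrable_equilibrium sphi eq1.
have p1 := Rintegral_equilibrium eq1.
have <- : \int[leb]_x (u x + (-1) * p x) = 0.
  by rewrite RintegralD// ?RintegralZl// ?Ru1 ?p1 ?mulr1 ?subrr//; exact: integrableZr.
apply: le_Rintegral => //; first by apply: integrableDr => //; exact: integrableZr.
move=> x _; rewrite mulN1r.
have px : p x = expR (- g0 x) * u x by rewrite -hp mulrA -expRD addNr expR0 mul1r.
rewrite px -{1}[u x]mul1r -mulrBl ler_wpM2r ?(ltW (u0 x))//.
have := expR_ge1Dx (- g0 x); lra.
Qed.

(** Integral form of [abs_sub_le_entropy]: [p - u] contributes [0] and [u + p] contributes [2]. *)
Lemma l1_le_entropy a : 0 < a ->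
  (\int[leb]_x `|f x t - p x|%:E <=
    (a / 2 * ((energy t - (C0 - D)) / D) + 2 / a)%:E)%E.
Proof.
move=> a0.
have ip := integrable_equilibrium sphi eq1.
have p1 := Rintegral_equilibrium eq1.
pose B x := a / 2 * (g0 x * u x + (-1 * u x + p x)) + a^-1 * (u x + p x).
have iB0 : leb.-integrable setT (EFin \o (fun x => g0 x * u x + (-1 * u x + p x))).
  by apply: integrableDr => //; apply: integrableDr => //; exact: integrableZr.
have iup : leb.-integrable setT (EFin \o (fun x => u x + p x)) by exact: integrableDr.
have iB : leb.-integrable setT (EFin \o B).
  by apply: integrableDr; exact: integrableZr.
have -> : a / 2 * ((energy t - (C0 - D)) / D) + 2 / a = \int[leb]_x B x.
  rewrite /B RintegralD//; [|exact: integrableZr|exact: integrableZr].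
  have iup' : leb.-integrable setT (EFin \o (fun x => -1 * u x + p x)).
    by apply: integrableDr => //; exact: integrableZr.
  have J1 : \int[leb]_x (-1 * u x + p x) = 0.
    rewrite RintegralD//; last exact: integrableZr.
    by rewrite RintegralZl// Ru1 p1 mulr1 addNr.
  have J2 : \int[leb]_x (u x + p x) = 2 by rewrite RintegralD// Ru1 p1.
  rewrite !RintegralZl// J2 RintegralD// J1 energy_entropy; field.
  by rewrite !gt_eqF.
rewrite /Rintegral fineK; last exact: integrable_fin_num.
have mup : measurable_fun setT (fun x => f x t - p x).
  apply: measurable_funB => //; apply/measurable_EFinP; exact: measurable_int ip.
have px0 x : 0 < p x by exact: expR_gt0.
have up x : `|f x t - p x| <= B x.
  apply: (le_trans (abs_sub_le_entropy a0 (u0 x) (px0 x))).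
  rewrite /B lerD2r ler_pM2l ?divr_gt0// le_eqVlt; apply/orP; left; apply/eqP.
  rewrite ln_div ?posrE// expRK /g0; ring.
apply: ge0_le_integral => //.
- by apply/measurable_EFinP; exact: measurableT_comp.
- exact: measurable_int iB.
- by move=> x _; rewrite lee_fin.
Qed.

Lemma integral_derive_energy_density :
  \int[leb]_x derive1 (fun r => energy_density D phi (f ^~ r) x) t = - dissipation_at.
Proof.
rewrite -mu_S; apply: eq_Rintegral => x _.
by rewrite derive1E; exact: (@derive_val _ _ _ _ _ _ _ (is_derive_energy_density x)).
Qed.

End at_time.

(** * Exponential decay *)

Section decay.
Context {R : realType} {n : nat}.
Variables (D C0 lambda : R) (phi f0 : 'rV[R]_n -> R) (f : 'rV[R]_n -> R -> R).
Local Notation leb := (lebesgue_rV n).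
Local Notation p := (equilibrium D phi C0).
Hypothesis D0 : 0 < D.
Hypothesis lambda0 : 0 < lambda.
Hypothesis sphi : smooth_on setT phi.
Hypothesis hess : forall x : 'rV[R]_n, loewner_le lambda%:M (hessian phi x).
Hypothesis sol : classical_solution D phi f0 f.
Hypothesis reg : regular_solution D phi f0 f.
Hypothesis eq1 : (\int[leb]_x (p x)%:E = 1)%E.

Lemma is_derive_energy (t : R) : 0 < t ->
  is_derive t 1 (energy D phi f) (- dissipation_at D phi f t).
Proof.
move=> t0.
have [e [G [e0 iG GP]]] := reg_derivative reg t0.
(* The interval on which the integral is differentiated must stay inside the positive times. *)
pose e' := Num.min e t.
have e'0 : 0 < e' by rewrite lt_min e0.
have ee : e' <= e by rewrite ge_min lexx.
have et : e' <= t by rewrite ge_min lexx orbT.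
have It : `]t - e', t + e'[%classic t by rewrite /= in_itv/=; apply/andP; split; lra.
have Ipos s : `]t - e', t + e'[%classic s -> 0 < s.
  by rewrite /= in_itv/= => /andP[a _]; lra.
have intf s : `]t - e', t + e'[%classic s ->
    leb.-integrable setT (EFin \o (fun x => energy_density D phi (f ^~ s) x)).
  by move=> /Ipos s0; exact: (reg_energy reg s0).
have derf s (x : 'rV[R]_n) : `]t - e', t + e'[%classic s -> setT x ->
    derivable ((fun r x => energy_density D phi (f ^~ r) x) ^~ x) s 1.
  by move=> /Ipos s0 _; have [] := is_derive_energy_density sphi sol s0 x.
have G0 x : 0 <= G x.
  by apply: le_trans (GP x t _); rewrite ?subrr ?normr0.
have Gub s x : `]t - e', t + e'[%classic s -> setT x ->
    `|partial1of2 (fun r x => energy_density D phi (f ^~ r) x) s x| <= G x.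
  rewrite /= in_itv/= => /andP[a b] _; apply: GP.
  by rewrite ltr_norml; apply/andP; split; lra.
have dE := derivable_under_integral measurableT It intf derf G0 iG Gub.
have DE := differentiation_under_integral measurableT It intf derf G0 iG Gub.
apply: DeriveDef; first exact: dE.
rewrite -derive1E; apply: (etrans DE).
exact: (integral_derive_energy_density sphi sol reg t0).
Qed.

Let H t := energy D phi f t - (C0 - D).

Lemma energy_decay (t : R) : (free_energy D phi f0 < +oo)%E -> 0 < t ->
  H t <= (fine (free_energy D phi f0) - (C0 - D)) * expR (- (2 * lambda * t)).
Proof.
move=> F0oo t0.
have feE s : 0 < s -> free_energy D phi (f ^~ s) = (energy D phi f s)%:E.
  move=> s0; rewrite /energy /Rintegral fineK//.
  exact: (integrable_fin_num measurableT (reg_energy reg s0)).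
(* The hypothesis excludes only [+oo]. The value [-oo] is excluded because the initial free energy
   is the limit of free energies that are at least [C0 - D]; then [fine] keeps its meaning. *)
have F0ge : ((C0 - D)%:E <= free_energy D phi f0)%E.
  apply: (cvge_ge _ (reg_energy0 reg)); near=> s.
  have s0 : 0 < s by [].
  rewrite feE// lee_fin -subr_ge0.
  exact: (entropy_ge0 D0 sphi sol reg eq1 s0).
have F0fin : free_energy D phi f0 \is a fin_num.
  by rewrite fin_numE; apply/andP; split; [
    apply: contraTN F0ge => /eqP ->|rewrite lt_eqF].
have Ecv : energy D phi f s @[s --> 0^'+] --> fine (free_energy D phi f0).
  have c : free_energy D phi (f ^~ s) @[s --> 0^'+] --> (fine (free_energy D phi f0))%:E.
    by rewrite fineK//; exact: reg_energy0 reg.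
  have Eeq : {near (0 : R)^'+, energy D phi f =1
      (fun s => fine (free_energy D phi (f ^~ s)))}.
    by near=> s; rewrite feE.
  exact: (cvg_trans (near_eq_cvg Eeq) (fine_cvg c)).
apply: (@gronwall_decay R H (fun s => - dissipation_at D phi f s) (2 * lambda) _ _ _ _ t t0).
- move=> s s0.
  have := is_deriveB (is_derive_energy s0) (is_derive_cst (C0 - D) s (1 : R)).
  by rewrite subr0.
- move=> s s0; rewrite lerN2 -ler_pdivlMl ?mulr_gt0//.
  exact: (energy_le_dissipation D0 lambda0 sphi hess sol reg eq1 s0).
- by apply: cvgB; [exact: Ecv|exact: cvg_cst].
Unshelve. all: by end_near. Qed.

End decay.

Theorem theoremA3 (R : realType) :
  exists C : R -> \bar R -> \bar R -> R,
    (forall (D : R) (Feq F0 : \bar R), 0 < C D Feq F0) /\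
    forall (n : nat) (D lambda C0 : R) (phi f0 : 'rV[R]_n -> R)
      (f : 'rV[R]_n -> R -> R),
    (0 < n)%N ->
    0 < D ->
    smooth_on setT phi ->
    is_density f0 ->
    classical_solution D phi f0 f ->
    regular_solution D phi f0 f ->
    0 < lambda ->
    (forall x : 'rV[R]_n, loewner_le lambda%:M (hessian phi x)) ->
    (free_energy D phi f0 < +oo)%E ->
    (dissipation D phi f0 < +oo)%E ->
    (\int[lebesgue_rV n]_x (equilibrium D phi C0 x)%:E = 1)%E ->
    forall t : R, 0 < t ->
      ('N[lebesgue_rV n]_1[EFin \o (fun x => f x t - equilibrium D phi C0 x)%R]
        <= (C D (free_energy D phi (equilibrium D phi C0))
                (free_energy D phi f0) * expR (- (lambda * t)))%:E)%E.
Proof.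
(* [2] is the total mass of the two densities, and the quotient is half the initial relative
   entropy. The absolute values make the constant positive for all arguments, including infinite
   ones, where [fine] returns [0]. *)
exists (fun D Feq F0 => 2 + `|fine F0 - fine Feq| / (2 * `|D|)).
split; first by move=> D Feq F0; rewrite ltr_wpDr// divr_ge0.
move=> n D lambda C0 phi f0 f _ D0 sphi _ sol reg lambda0 hess F0oo _ eq1 t t0.
rewrite (free_energy_equilibrium D0 sphi eq1) Lnorm1/=.
(* This choice of [a] makes both terms of [l1_le_entropy] decay at the rate [lambda]. *)
have a0 : 0 < expR (lambda * t) by exact: expR_gt0.
apply: (le_trans (l1_le_entropy D0 sphi sol reg eq1 t0 a0)).
have := energy_decay D0 lambda0 sphi hess sol reg eq1 F0oo t0.
set H := energy _ _ _ _ - _; set H0 := fine _ - _ => HH0.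
rewrite lee_fin (gtr0_norm D0) expRN.
have E2 : expR (- (2 * lambda * t)) = (expR (lambda * t))^-1 ^+ 2.
  by rewrite -expRN expr2 -expRD; congr expR; ring.
rewrite E2 in HH0; set a := expR (lambda * t) in a0 HH0 *.
have HD : H / D <= `|H0| * a^-1 ^+ 2 / D.
  rewrite ler_pM2r ?invr_gt0//; apply: (le_trans HH0).
  by rewrite ler_wpM2r ?sqr_ge0// ler_norm.
apply: (@le_trans _ _ (a / 2 * (`|H0| * a^-1 ^+ 2 / D) + 2 / a)).
  by rewrite lerD2r ler_pM2l// divr_gt0.
rewrite le_eqVlt; apply/orP; left; apply/eqP; field.
by rewrite !gt_eqF.
Qed.
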